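(* Let $(\tau_n)$ be a sequence of tests ($\tau_n$ a test at sample size $n$) such that $$\limsup_{n\to\infty}\int \tau_n\,dP^n\le\alpha .$$ (a) Suppose the tangent set is a convex cone $\tilde{\mathcal G}$. Then $$\inf_{\tilde K}\ \limsup_{n\to\infty}\int\tau_n\,dQ_n^n\ \le\ \Phi\Bigl(-u_\alpha+\frac{c}{\Vert\tilde\kappa\Vert}\Bigr),$$ the infimum being over all sequences $(Q_n)$ in $\tilde K$. This upper bound is achieved, with $\limsup_n$ replaced by $\liminf_n$, by the sequence of tests $$\tilde\tau_n=\mathbf 1\Bigl(\tfrac1{\sqrt n}\sum_{i=1}^n\tilde\kappa(x_i)>\Vert\tilde\kappa\Vert\,u_\alpha\Bigr);$$ that is, $\limsup_n\int\tilde\tau_n\,dP^n\le\alpha$ and $\inf_{\tilde K}\liminf_n\int\tilde\tau_n\,dQ_n^n=\Phi\bigl(-u_\alpha+c/\Vert\tilde\kappa\Vert\bigr)$. (b) Suppose the tangent set is a linear space $\bar{\mathcal G}$. Then $$\inf_{\bar K}\ \limsup_{n\to\infty}\int\tau_n\,dQ_n^n\ \le\ \Phi\Bigl(-u_\alpha+\frac{c}{\Vert\bar\kappa\Vert}\Bigr).$$ This upper bound is achieved, with $\limsup_n$ replaced by $\liminf_n$, by the sequence of tests $$\bar\tau_n=\mathbf 1\Bigl(\tfrac1{\sqrt n}\sum_{i=1}^n\bar\kappa(x_i)>\Vert\bar\kappa\Vert\,u_\alpha\Bigr);$$ that is, $\limsup_n\int\bar\tau_n\,dP^n\le\alpha$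 and $\inf_{\bar K}\liminf_n\int\bar\tau_n\,dQ_n^n=\Phi\bigl(-u_\alpha+c/\Vert\bar\kappa\Vert\bigr)$. Moreover, $$\sup_{\bar H}\ \limsup_{n\to\infty}\int\bar\tau_n\,dQ_n^n\le\alpha .$$
   Context: Model and tangents. $\mathcal P$ is a set of probability measures on a sample space, $P\in\mathcal P$ is fixed, $T:\mathcal P\to\mathbb R$ is a functional. $\langle\cdot|\cdot\rangle$ and $\Vert\cdot\Vert$ are the inner product and norm of $L_2(P)$. A path in $\mathcal P$ with tangent $g\in L_2(P)$ at $P$ is a family $(P_{g,s})_{s>0}$ in $\mathcal P$ such that $\sqrt{dP_{g,s}}=(1+\tfrac12 s g)\sqrt{dP}+o(s)$ as $s\downarrow0$ in the Hilbert space of square root densities (i.e. the $L_2$-norm of the remainder, with respect to a dominating measure, is $o(s)$). Such $g$ necessarily have $\int g\,dP=0$. The tangent set $\mathcal G\subset L_2(P)$ of $\mathcal P$ at $P$ is the set of all such tangents; it is a cone with vertex $0$. It is denoted $\tilde{\mathcal G}$ when assumed to be a convex cone ($\gamma_1g_1+\gamma_2g_2\in\tilde{\mathcal G}$ for $g_i\in\tilde{\mathcal G}$, $\gamma_i\ge0$) and $\bar{\mathcal G}$ when assumed to be a linear space. Differentiability of $T$. There is $\kappa\in L_2(P)$ (an influence curve of $T$ at $P$) such that for every $g\in\mathcal G$ and any path $(P_{g,s})$ in $\mathcal P$ with tangent $g$: $T(P_{g,s})=T(P)+s\langle\kappa|g\rangle+o(s)$ as $s\downarrow0$. Projections. For a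 convex tangent cone $\tilde{\mathcal G}$, $\tilde\kappa$ is the projection (unique closest element) of $\kappa$ on the $L_2(P)$-closure of $\tilde{\mathcal G}$. For a linear tangent space $\bar{\mathcal G}$, $\bar\kappa$ is the orthogonal projection of $\kappa$ on the closure of $\bar{\mathcal G}$. It is assumed throughout that $\tilde\kappa\ne0$ and $\bar\kappa\ne0$, respectively. Tests. A test at sample size $n$ is a measurable function $\tau_n$ of $(x_1,\dots,x_n)$ with values in $[0,1]$; $Q^n$ is the $n$-fold product measure. $\alpha\in(0,1)$ is fixed, $\Phi$ is the standard normal distribution function, $u_\alpha$ is defined by $\Phi(-u_\alpha)=\alpha$, and $c\in(0,\infty)$ is a fixed constant. Hypotheses. Consider sequences $(Q_n)$ for which there are $g\in\mathcal G$, a path $(P_{g,s})$ in $\mathcal P$ with tangent $g$, and $t\in(0,\infty)$ such that $Q_n=P_{g,t/\sqrt n}$ eventually. Among these sequences, $H$ consists of those with $\limsup_n\sqrt n\,(T(Q_n)-T(P))\le0$ (equivalently $\langle\kappa|g\rangle\le0$), and $K$ of those with $\liminf_n\sqrt n\,(T(Q_n)-T(P))\ge c$ (equivalently $t\langle\kappa|g\rangle\ge c$). They are denoted $\tilde H,\tilde K$ if $\mathcal G=\tilde{\mathcal G}$ is a convex cone and $\bar H,\bar K$ if $\mathcal G=\bar{\mathcal G}$ is a linear space. *)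

(* Defs.v *)
From HB Require Import structures.
From mathcomp Require Import all_boot all_order all_algebra.
From mathcomp Require Import all_classical all_reals all_analysis.

Set Implicit Arguments.
Unset Strict Implicit.
Unset Printing Implicit Defensive.

Import Order.TTheory GRing.Theory Num.Theory.
Import numFieldNormedType.Exports.

Local Open Scope classical_set_scope.
Local Open Scope charge_scope.
Local Open Scope ring_scope.

Section product_power.
Context d (X : measurableType d) (R : realType).

Definition cons_pair n (xt : X * n.-tuple X) : n.+1.-tuple X :=
  [the n.+1.-tuple X of xt.1 :: xt.2].

Lemma measurable_cons_pair n : measurable_fun [set: X * n.-tuple X] (@cons_pair n).
Proof. exact: (measurable_cons measurable_fst measurable_snd). Qed.

HB.instance Definition _ n :=
  isMeasurableFun.Build _ _ _ _ (@cons_pair n) (@measurable_cons_pair n).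

(* [P ^ n] as a probability on n-tuples; [prob_powerE] characterises it. *)
Fixpoint prob_power (P : probability X R) n : probability (n.-tuple X) R :=
  match n with
  | 0 => \d_ ([tuple] : 0.-tuple X)
  | m.+1 => distribution (P \x prob_power P m)%E (@cons_pair m)
  end.

Lemma prob_powerE (P : probability X R) n (A : 'I_n -> set X) :
  (forall i, measurable (A i)) ->
  prob_power P n [set x | forall i, A i (tnth x i)] = (\prod_(i < n) P (A i))%E.
Proof.
elim: n A => [|n IH] A mA.
  rewrite big_ord0 (_ : [set _ | _] = setT) ?probability_setT//.
  by apply/seteqP; split => x //= _ [].
rewrite big_ord_recl /= /distribution /pushforward /=.
have -> : @cons_pair n @^-1` [set x | forall i, A i (tnth x i)] =
    A ord0 `*` [set x | forall i, A (lift ord0 i) (tnth x i)].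
  apply/seteqP; split => [[x t] /= h|[x t] /= [h0 h] i].
    split; first by have := h ord0.
    by move=> i; have := h (lift ord0 i); rewrite tnthS.
  by case: (unliftP ord0 i) => [j ->|-> //]; rewrite tnthS.
rewrite product_measure1E//; last first.
  rewrite (_ : [set _ | _] =
      \bigcap_(i in [set: 'I_n]) ((@tnth n X)^~ i @^-1` A (lift ord0 i))).
    apply: fin_bigcap_measurable => // i _.
    by rewrite -[X in measurable X]setTI; exact: measurable_tnth.
  by apply/seteqP; split => x /= h i; [move=> _; exact: h|exact: h].
by congr (_ * _)%E; exact: (IH (fun i => A (lift ord0 i))).
Qed.

End product_power.

Section dominating.
Context d (X : measurableType d) (R : realType) (P Q : probability X R).

Let measure_add_finite : fin_num_fun (measure_add P Q).
Proof.
by move=> A mA; rewrite measure_addE fin_numD !fin_num_measure.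
Qed.

HB.instance Definition _ := Measure.copy (measure_add P Q)
  (msum (fun n => if n is 0%N then (P : {measure set X -> \bar R}) else Q) 2).

HB.instance Definition _ :=
  Measure_isFinite.Build _ _ _ (measure_add P Q) measure_add_finite.

End dominating.

Section model.
Context d (X : measurableType d) (R : realType).
Implicit Types (calP : set (probability X R)) (P Q : probability X R).
Implicit Types (T : probability X R -> R) (f g h kappa : X -> R).

Definition inner P f g : R := \int[P]_x (f x * g x).

Definition l2norm P f : R := fine 'N[P]_2%:E[EFin \o f]%E.

Definition root_density (mu : {sigma_finite_measure set X -> \bar R}) Q (x : X) : R :=
  Num.sqrt (fine ('d (charge_of_finite_measure Q) '/d mu x)).

(* L2-norm of [sqrt dQ - (1 + s g / 2) sqrt dP]. It does not depend on the
   dominating measure, here [P + Q]. *)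
Definition root_remainder P g (s : R) Q : \bar R :=
  let mu := measure_add P Q in
  let rem x :=
    root_density mu Q x - (1 + 2^-1 * s * g x) * root_density mu P x in
  'N[mu]_2%:E[EFin \o rem]%E.

(* Only the values [Pg s] with [0 < s] matter. *)
Definition path_with_tangent calP P g (Pg : R -> probability X R) :=
  [/\ g \in Lfun P 2%:E,
      forall s, 0 < s -> calP (Pg s) &
      ((s^-1)%:E * root_remainder P g s (Pg s))%E @[s --> 0^'+] --> 0%E].

Definition tangent_set calP P : set (X -> R) :=
  [set g | exists Pg, path_with_tangent calP P g Pg].

Definition influence_curve calP P T kappa :=
  kappa \in Lfun P 2%:E /\
  forall g Pg, path_with_tangent calP P g Pg ->
    (T (Pg s) - T P - s * inner P kappa g) / s @[s --> 0^'+] --> (0 : R).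

(* A tangent set is never empty: the constant path has tangent 0. *)
Definition convex_cone (G : set (X -> R)) :=
  forall (a b : R) g h, 0 <= a -> 0 <= b -> G g -> G h ->
    G (fun x => a * g x + b * h x).

Definition linear_space (G : set (X -> R)) :=
  forall (a b : R) g h, G g -> G h -> G (fun x => a * g x + b * h x).

Definition l2closure P (G : set (X -> R)) : set (X -> R) :=
  [set f | f \in Lfun P 2%:E /\
    forall e : R, 0 < e -> exists2 g, G g & l2norm P (f \- g) < e].

(* Projections are determined up to P-almost sure equality. *)
Definition closest_point P (C : set (X -> R)) f pf :=
  C pf /\ forall h, C h -> l2norm P (f \- pf) <= l2norm P (f \- h).

Definition orthogonal_projection P (C : set (X -> R)) f pf :=
  C pf /\ forall h, C h -> inner P (f \- pf) h = 0.

Definition Phi (x : R) : R := fine (normal_prob 0 1 `]-oo, x]).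

Definition test_sequence (tau : forall n, n.-tuple X -> R) :=
  forall n, measurable_fun [set: n.-tuple X] (tau n) /\
    forall x, 0 <= tau n x <= 1.

Definition power (tau : forall n, n.-tuple X -> R) (Q : nat -> probability X R)
    (n : nat) : \bar R :=
  (\int[prob_power (Q n) n]_x (tau n x)%:E)%E.

Definition score_test P (k : X -> R) (u : R) n (x : n.-tuple X) : R :=
  if l2norm P k * u < (Num.sqrt n%:R)^-1 * \sum_(i < n) k (tnth x i)
  then 1 else 0.

Definition local_sequences calP P : set (nat -> probability X R) :=
  [set Q | exists g Pg (t : R),
    [/\ tangent_set calP P g, path_with_tangent calP P g Pg, 0 < t &
        \forall n \near \oo, Q n = Pg (t / Num.sqrt n%:R)]].

Definition hypH calP P T : set (nat -> probability X R) :=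
  local_sequences calP P `&`
  [set Q | limn_esup (fun n => (Num.sqrt n%:R * (T (Q n) - T P))%:E) <= 0]%E.

Definition hypK calP P T (c : R) : set (nat -> probability X R) :=
  local_sequences calP P `&`
  [set Q | c%:E <= limn_einf (fun n => (Num.sqrt n%:R * (T (Q n) - T P))%:E)]%E.

End model.

(* Main.v *)
(* Weak convergence is only needed for the functions [x |-> Phi ((x - a) / e)],
   on which Gaussian smoothing is explicit: averaging out one observation with
   mean [m] and second moment [b] turns [Phi ((x + y) / r)] into
   [Phi ((x + m) / sqrt (r ^ 2 + b))] up to a Lindeberg remainder. Iterating over
   the coordinates gives the central limit theorem without characteristic
   functions.

   Along a path with tangent [g], [P_{g, s}] is replaced by the exponential tilt
   [exp (s h) dP / Z], where [h] is a bounded centred function close to [g] in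
   [L_2(P)]. Since the affinity is multiplicative, the integrals of a test under
   the [n]-th powers of the two measures, with [s = t / sqrt n], differ by
   O([||g - h||]). Under the tilts the sums of [k(x_i)] are asymptotically normal
   with mean [t <k, h>], and the likelihood ratio is a function of the sum of the
   [h(x_i)], so that the Neyman-Pearson lemma bounds the power of any test of
   asymptotic level [Phi (- u)] by [Phi (- u + t ||h||)].

   For [g] close to the projection [pk] of [kappa] and [t = c / <kappa, g>] this
   bound tends to [Phi (- u + c / ||pk||)]. The score test has limiting power
   [Phi (- u + t <pk, g> / ||pk||)], which is at least this value on the
   alternatives because [<kappa, g> <= <pk, g>] on the tangent cone. *)

Require Import Defs.
From HB Require Import structures.
From mathcomp Require Import all_boot all_order all_algebra.
From mathcomp Require Import all_classical all_reals all_analysis measurable_realfun.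
From mathcomp Require Import ring lra.
Import Order.TTheory GRing.Theory Num.Theory.
Import numFieldNormedType.Exports.
Local Open Scope classical_set_scope.
Local Open Scope ring_scope.

Set Implicit Arguments.
Unset Strict Implicit.
Unset Printing Implicit Defensive.

(** * Taylor expansions of the normal distribution function *)


(** The measures of a path are close to [P] only in the sense of square roots: they need not be
    dominated by [P], nor give [k] a finite second moment, so neither the central limit theorem nor
    the likelihood ratio is directly available under them. Tests are bounded, however, and their
    integrals can be moved to measures with bounded densities at a cost that is uniform in the test.
    At [s] the squared Hellinger distance between path and tilt is of order [s^2 ||g - h||^2] up to
    o(s^2); with [s = t / sqrt n] it stays of order [||g - h||^2] over [n] observations. Hence [h]
    is fixed first, then [n] grows, and only then does [h] approach [g]. The projection need not be
    a tangent, only a limit of tangents, so the bound on the infimum is reached through nearby [g].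
    Both kinds of projection enter only through [<kappa, g> <= <pk, g>] on tangents and
    [<kappa, pk> = <pk, pk>]. The level on the whole null hypothesis uses the reverse inequality as
    well, which orthogonality supplies. *)

Section Taylor.
Context {R : realType}.

(** The intermediate point is recorded as an offset [t], so that one statement covers both signs of
    [y] and the bound on [t] can be fed into the expansion of the next order. *)
Lemma MVT_between (f f1 : R -> R) (x y : R) : (forall z : R, is_derive z 1 f (f1 z)) ->
  exists2 t, `|t| <= `|y| & f (x + y) - f x = f1 (x + t) * y.
Proof.
move=> df.
have cf : continuous f.
  by move=> z; apply/differentiable_continuous/derivable1_diffP; have [] := df z.
have cfw (A : set R) : {within A, continuous f} by exact: continuous_subspaceT.
have [y0|y0] := leP 0 y.
- have xy : x <= x + y by rewrite lerDl.
  have [c] := MVT_segment xy (fun z _ => df z) (cfw _).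
  rewrite in_itv/= => /andP[xc cy] E; exists (c - x).
    by rewrite !ger0_norm ?subr_ge0//; lra.
  have -> : x + (c - x) = c by ring.
  by rewrite E; congr (_ * _); ring.
- have xy : x + y <= x by rewrite gerDl ltW.
  have [c] := MVT_segment xy (fun z _ => df z) (cfw _).
  rewrite in_itv/= => /andP[xc cy] E; exists (c - x).
    by rewrite (ler0_norm (ltW y0)) ler0_norm ?subr_le0//; lra.
  have -> : x + (c - x) = c by ring.
  by rewrite -opprB E -mulrN; congr (_ * _); ring.
Qed.

Lemma Lipschitz_of_derive (f f1 : R -> R) (C x y : R) :
  (forall z : R, is_derive z 1 f (f1 z)) -> (forall z, `|f1 z| <= C) ->
  `|f (x + y) - f x| <= C * `|y|.
Proof.
move=> df fC; have [t _ ->] := MVT_between x y df.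
by rewrite normrM ler_wpM2r.
Qed.

Lemma Taylor1 (f f1 f2 : R -> R) (C x y : R) :
  (forall z : R, is_derive z 1 f (f1 z)) -> (forall z : R, is_derive z 1 f1 (f2 z)) ->
  (forall z, `|f2 z| <= C) -> `|f (x + y) - f x - y * f1 x| <= C * y ^+ 2.
Proof.
move=> df df1 fC; have [t ty ->] := MVT_between x y df.
have C0 : 0 <= C by rewrite (le_trans _ (fC 0)).
rewrite mulrC -mulrBr normrM -[y ^+ 2]real_normK ?num_real// expr2 mulrCA.
rewrite ler_wpM2l//; have := Lipschitz_of_derive x t df1 fC.
by move/le_trans; apply; rewrite ler_wpM2l.
Qed.

(** The minimum is what Lindeberg's method consumes: the quadratic bound asks only for second
    moments, the cubic one gains for small [y]. They come from two bounds on the derivative [F1] of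
    the remainder, a crude one by the Lipschitz property of [f1] and a finer one by [Taylor1] for
    [f1]. *)
Lemma Taylor2 (f f1 f2 f3 : R -> R) (C2 C3 x y : R) :
  (forall z : R, is_derive z 1 f (f1 z)) -> (forall z : R, is_derive z 1 f1 (f2 z)) ->
  (forall z : R, is_derive z 1 f2 (f3 z)) ->
  (forall z, `|f2 z| <= C2) -> (forall z, `|f3 z| <= C3) ->
  `|f (x + y) - f x - y * f1 x - y ^+ 2 / 2 * f2 x| <=
    (2 * C2 + C3) * Num.min (y ^+ 2) (`|y| ^+ 3).
Proof.
move=> df df1 df2 fC2 fC3.
have C20 : 0 <= C2 by rewrite (le_trans _ (fC2 0)).
have C30 : 0 <= C3 by rewrite (le_trans _ (fC3 0)).
pose F t := f (x + t) - f x - t * f1 x - t ^+ 2 / 2 * f2 x.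
pose F1 t := f1 (x + t) - f1 x - t * f2 x.
have dF (t : R) : is_derive t 1 F (F1 t).
  have dfxt := df (x + t).
  have d1 : is_derive t 1 (fun t => f (x + t)) (f1 (x + t)).
    have d0 : is_derive t 1 (fun t => x + t) (0 + 1).
      exact: (is_deriveD (is_derive_cst x t 1) (is_derive_id t 1)).
    by have := is_derive1_comp dfxt d0; rewrite add0r mulr1.
  have d2 : is_derive t 1 (fun t => t * f1 x) (f1 x).
    have := is_deriveM (is_derive_id t (1 : R)) (is_derive_cst (f1 x) t 1).
    by rewrite /GRing.scale/= mulr0 add0r mulr1.
  have d3 : is_derive t 1 (fun t => t ^+ 2 / 2 * f2 x) (t * f2 x).
    have -> : (fun t : R => t ^+ 2 / 2 * f2 x) = (id ^+ 2 * cst (f2 x / 2)).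
      by apply/funext => z; rewrite !fctE/=; field.
    refine (is_derive_eq (is_deriveM (is_deriveX 2 (is_derive_id t (1 : R)))
      (is_derive_cst (f2 x / 2) t 1)) _).
    by rewrite /GRing.scale/= !fctE; field.
  have := is_deriveB (is_deriveB (is_deriveB d1 (is_derive_cst (f x) t 1)) d2) d3.
  by move/is_derive_eq; apply; congr (_ - _ - _); exact: subr0.
have [t ty E] := MVT_between 0 y dF.
have -> : f (x + y) - f x - y * f1 x - y ^+ 2 / 2 * f2 x = F1 t * y.
  by rewrite add0r in E; rewrite add0r in E; rewrite -E /F addr0; ring.
rewrite normrM.
have Ft1 : `|F1 t| <= 2 * C2 * `|t|.
  apply: (le_trans (ler_normB _ _)).
  have := Lipschitz_of_derive x t df1 fC2.
  rewrite normrM; have := fC2 x; have := normr_ge0 t; nra.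
have Ft2 : `|F1 t| <= C3 * t ^+ 2 by exact: (Taylor1 _ _ df1 df2).
have yy : y ^+ 2 = `|y| ^+ 2 by rewrite real_normK ?num_real.
have tt : t ^+ 2 = `|t| ^+ 2 by rewrite real_normK ?num_real.
rewrite yy in Ft2 *; rewrite tt in Ft2.
move: ty Ft1 Ft2; have := normr_ge0 t; have := normr_ge0 y; have := normr_ge0 (F1 t).
move: (`|F1 t|) (`|t|) (`|y|) => a b e a0 e0 b0 be h1 h2.
rewrite /Num.min; case: ifPn => _.
  have : a <= 2 * C2 * e by apply: le_trans h1 _; nra.
  have : 0 <= C3 * e ^+ 2 by rewrite mulr_ge0// sqr_ge0.
  nra.
have h3 : a <= C3 * e ^+ 2.
  by apply: le_trans h2 _; rewrite ler_wpM2l// ler_pXn2r.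
have : 0 <= C2 * e ^+ 3 by rewrite mulr_ge0// exprn_ge0.
rewrite exprS; nra.
Qed.

End Taylor.


Section standard_normal.
Context {R : realType}.
Local Notation phi := (normal_pdf (0 : R) 1).
Implicit Types x y z : R.

Lemma normal_pdf01E x : phi x = normal_peak 1 * expR (- (x ^+ 2 / 2)).
Proof.
by rewrite normal_pdfE ?oner_eq0// /normal_fun subr0 expr1n mulNr.
Qed.

Lemma is_derive_normal_pdf01 x : is_derive x 1 phi (- x * phi x).
Proof.
rewrite normal_pdf01E.
have -> : phi = (fun y : R => normal_peak 1 * expR (- (y ^+ 2 / 2))).
  by apply/funext => y; rewrite normal_pdf01E.
have d1 : is_derive x 1 (fun y : R => - (y ^+ 2 / 2)) (- x).
  have -> : (fun y : R => - (y ^+ 2 / 2)) = - 2^-1 *: (id ^+ 2).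
    by apply/funext => y; rewrite !fctE /GRing.scale/=; field.
  refine (is_derive_eq (is_deriveZ (- 2^-1) (is_deriveX 2 (is_derive_id x (1 : R)))) _).
  by rewrite /GRing.scale/=; field.
have d2 := @is_derive1_comp _ (@expR R) (fun y : R => - (y ^+ 2 / 2)) x _ _ (is_derive_expR (- (x ^+ 2 / 2))) d1.
refine (is_derive_eq (is_deriveZ (normal_peak 1) d2) _).
by rewrite /GRing.scale/=; ring.
Qed.

Lemma is_derive_Phi x : is_derive x 1 (@Phi R) (phi x).
Proof.
have xx1 : x < x + 1 by rewrite ltrDl.
have iphi : lebesgue_measure.-integrable `]-oo, (x + 1)] (EFin \o phi).
  by apply: integrableS (integrable_normal_pdf 0 1).
have cphi : {for x, continuous phi}.
  by apply: continuous_normal_pdf; rewrite oner_eq0.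
have [d1 d2] := @continuous_FTC1 R phi -oo%O x (x + 1) xx1 iphi (ltNyr _) cphi.
rewrite derive1E in d2.
exact: (DeriveDef d1 d2).
Qed.

Lemma is_derive_opp_id_normal_pdf01 x :
  is_derive x 1 (fun y : R => - y * phi y) ((x ^+ 2 - 1) * phi x).
Proof.
have := is_deriveM (is_deriveN (is_derive_id x (1 : R))) (is_derive_normal_pdf01 x).
by move/is_derive_eq; apply; rewrite /GRing.scale/= !fctE; ring.
Qed.

Lemma Phi_ge0 x : 0 <= Phi x.
Proof. by rewrite fine_ge0. Qed.

Lemma Phi_le1 x : Phi x <= 1.
Proof.
by rewrite -lee_fin /Phi fineK ?fin_num_measure//; exact: probability_le1.
Qed.

Lemma Phi_nondecreasing x y : x <= y -> Phi x <= Phi y.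
Proof.
move=> xy; rewrite fine_le ?fin_num_measure//.
by apply: le_measure; rewrite ?inE//; apply: subset_itvl; rewrite bnd_simp.
Qed.

Lemma continuous_Phi : continuous (@Phi R).
Proof.
move=> x; apply/differentiable_continuous/derivable1_diffP.
by have [] := is_derive_Phi x.
Qed.

(** The limits at infinity are those of the distribution function of a random variable; the identity
    on the line has law [normal_prob 0 1] and distribution function [Phi]. *)
Let idTR : measurableTypeR R -> R := idfun.

#[local] HB.instance Definition _ :=
  @isMeasurableFun.Build _ _ _ _ idTR (@measurable_id _ _ setT).

Lemma cvg_Phiy : Phi x @[x --> +oo] --> (1 : R).
Proof.
by have /fine_cvg := @cvg_cdfy1 _ _ R (normal_prob 0 1) idTR.
Qed.

Lemma cvg_PhiNy : Phi x @[x --> -oo] --> (0 : R).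
Proof.
by have /fine_cvg := @cvg_cdfNy0 _ _ R (normal_prob 0 1) idTR.
Qed.

(** Up to sign these are the second and third derivatives of [Phi] and, for the expansion in the
    scale, [x] times the third. The polynomials are at most [2 (1 + x^4)], and
    [expR (x^2 / 2) >= x^4 / 8] gives [x^4 phi <= 8] peaks, hence 18 peaks in all, rounded up to
    20. *)
Lemma poly_normal_pdf01_bounded : exists2 K : R, 0 < K & forall x,
  [/\ `|x * phi x| <= K, `|(x ^+ 2 - 1) * phi x| <= K &
      `|x * ((x ^+ 2 - 1) * phi x)| <= K].
Proof.
have p0 : 0 < normal_peak (1 : R) by rewrite normal_peak_gt0 ?oner_eq0.
exists (20 * normal_peak 1); first by rewrite mulr_gt0.
move=> x; have phi0 : 0 <= phi x by exact: normal_pdf_ge0.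
have phi1 : phi x <= normal_peak 1 by apply: normal_pdf_ub; rewrite oner_eq0.
have phi4 : x ^+ 4 * phi x <= 8 * normal_peak 1.
  rewrite normal_pdf01E expRN mulrCA mulrC ler_pM2r//.
  rewrite ler_pdivrMr ?expR_gt0//.
  have := @expR_ge1Dxn R (x ^+ 2 / 2) 1.
  rewrite divr_ge0 ?sqr_ge0// => /(_ isT).
  have -> : (2`! = 2)%N by [].
  have -> : (x ^+ 2 / 2) ^+ 2 / 2 = x ^+ 4 / 8 by field.
  lra.
have key (p : R) : `|p| <= 2 * (1 + x ^+ 4) -> `|p * phi x| <= 20 * normal_peak 1.
  move=> hp; rewrite normrM (ger0_norm phi0).
  apply: (@le_trans _ _ (2 * (1 + x ^+ 4) * phi x)); first by rewrite ler_wpM2r.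
  nra.
rewrite mulrA; split; apply: key; have := sqr_ge0 (x ^+ 2 - 1); have := sqr_ge0 x;
  rewrite ler_norml.
- by move: (sqr_ge0 (x - 1)) (sqr_ge0 (x + 1)) => *; apply/andP; split; nra.
- by move=> *; apply/andP; split; nra.
- have := mulr_ge0 (sqr_ge0 x) (sqr_ge0 (x - 1)).
  have := mulr_ge0 (sqr_ge0 x) (sqr_ge0 (x + 1)).
  by move: (sqr_ge0 (x - 1)) (sqr_ge0 (x + 1)) => *; apply/andP; split; nra.
Qed.

(* [a |-> Phi (expR a * z)] has derivatives bounded uniformly in [z], which
   makes the expansion in the variance uniform. *)
Lemma Phi_scale_expansion : exists2 K : R, 0 < K & forall z a : R,
  `|Phi (expR a * z) - Phi z - a * (z * phi z)| <= K * a ^+ 2.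
Proof.
have [K K0 KP] := poly_normal_pdf01_bounded.
exists (2 * K); first by rewrite mulr_gt0.
move=> z a.
pose w (a : R) := expR a * z.
have dw (t : R) : is_derive t 1 w (w t).
  have -> : w = z *: @expR R by apply/funext => y; rewrite /w mulrC.
  exact: is_deriveZ.
pose f1 (t : R) := w t * phi (w t).
have df (t : R) : is_derive t 1 (fun t => Phi (w t)) (f1 t).
  by have := @is_derive1_comp _ (@Phi R) w t _ _ (is_derive_Phi (w t)) (dw t); rewrite mulrC.
pose f2 (t : R) := w t * phi (w t) - w t * ((w t) ^+ 2 * phi (w t)).
have df1 (t : R) : is_derive t 1 f1 (f2 t).
  have d := @is_derive1_comp _ phi w t _ _ (is_derive_normal_pdf01 (w t)) (dw t).
  refine (is_derive_eq (is_deriveM (dw t) d) _).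
  by rewrite /GRing.scale/= /f2 /= mulrC; ring.
have := @Taylor1 _ _ _ _ (2 * K) 0 a df df1.
rewrite add0r /f1 /w expR0 !mul1r; apply => t.
rewrite /f2; move: (w t) => x; have [_ _] := KP x.
have [h _ _] := KP x => h3.
have -> : x * phi x - x * (x ^+ 2 * phi x) = - (x * ((x ^+ 2 - 1) * phi x)) by ring.
by rewrite normrN; lra.
Qed.

End standard_normal.


(** * Integrals of real-valued functions *)

Section integrable_real.
Context d (X : measurableType d) (R : realType).
Variable mu : {measure set X -> \bar R}.
Implicit Types f g h : X -> R.

Definition rintegrable f := mu.-integrable [set: X] (EFin \o f).

Lemma rintegrable_measurable f : rintegrable f -> measurable_fun [set: X] f.
Proof. by move=> /measurable_int/measurable_EFinP. Qed.

Lemma rintegrableD f g : rintegrable f -> rintegrable g ->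
  rintegrable (fun x => f x + g x).
Proof. by move=> fi gi; exact: (integrableD measurableT fi gi). Qed.

Lemma rintegrableB f g : rintegrable f -> rintegrable g ->
  rintegrable (fun x => f x - g x).
Proof. by move=> fi gi; exact: (integrableB measurableT fi gi). Qed.

Lemma rintegrableZ (a : R) f : rintegrable f -> rintegrable (fun x => a * f x).
Proof. by move=> fi; exact: (integrableZl measurableT a fi). Qed.

Lemma le_rintegrable f g : measurable_fun [set: X] f -> rintegrable g ->
  (forall x, `|f x| <= g x) -> rintegrable f.
Proof.
move=> mf gi fg; apply: le_integrable gi => //; first exact/measurable_EFinP.
by move=> x _; rewrite lee_fin (le_trans (fg x))// ler_norm.
Qed.

Lemma rintegrable_norm f : rintegrable f -> rintegrable (fun x => `|f x|).
Proof. by move=> fi; exact: (integrable_norm fi). Qed.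

Lemma ExpD f g : rintegrable f -> rintegrable g ->
  \int[mu]_x (f x + g x) = \int[mu]_x f x + \int[mu]_x g x.
Proof. by move=> fi gi; exact: RintegralD. Qed.

Lemma ExpB f g : rintegrable f -> rintegrable g ->
  \int[mu]_x (f x - g x) = \int[mu]_x f x - \int[mu]_x g x.
Proof. by move=> fi gi; exact: RintegralB. Qed.

Lemma ExpZ (a : R) f : rintegrable f ->
  \int[mu]_x (a * f x) = a * \int[mu]_x f x.
Proof. by move=> fi; exact: RintegralZl. Qed.

Lemma le_Exp f g : rintegrable f -> rintegrable g -> (forall x, f x <= g x) ->
  \int[mu]_x f x <= \int[mu]_x g x.
Proof. by move=> fi gi fg; exact: le_Rintegral. Qed.

Lemma normr_Exp f g : measurable_fun [set: X] f -> rintegrable g ->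
  (forall x, `|f x| <= g x) -> `|\int[mu]_x f x| <= \int[mu]_x g x.
Proof.
move=> mf gi fg; have fi := le_rintegrable mf gi fg.
by apply: (le_trans (le_normr_Rintegral _ fi)) => //; exact: le_Exp (rintegrable_norm fi) gi fg.
Qed.

Lemma eq_Exp f g : f =1 g -> \int[mu]_x f x = \int[mu]_x g x.
Proof. by move=> fg; apply: eq_Rintegral => x _. Qed.

End integrable_real.

Section integrable_probability.
Context d (X : measurableType d) (R : realType) (Q : probability X R).
Implicit Types f g : X -> R.

Lemma rintegrable_cst (a : R) : rintegrable Q (fun=> a).
Proof. exact: finite_measure_integrable_cst. Qed.

Lemma rintegrable_bounded f (M : R) : measurable_fun [set: X] f ->
  (forall x, `|f x| <= M) -> rintegrable Q f.
Proof. by move=> mf fM; apply: le_rintegrable (rintegrable_cst M) fM. Qed.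

Lemma Exp_cst (a : R) : \int[Q]_x a = a.
Proof.
rewrite Rintegral_cst// -[RHS]mulr1; congr (_ * _).
exact: (congr1 fine (probability_setT Q)).
Qed.

End integrable_probability.

(** * Expansions for averaging out one observation *)

Section one_step.
Context {R : realType}.
Local Notation phi := (normal_pdf (0 : R) 1).

Lemma Phi_increment : exists2 K : R, 0 < K & forall z y,
  `|Phi (z + y) - Phi z - y * phi z + y ^+ 2 / 2 * (z * phi z)| <=
    K * Num.min (y ^+ 2) (`|y| ^+ 3).
Proof.
have [K K0 KP] := @poly_normal_pdf01_bounded R.
exists (3 * K); first by rewrite mulr_gt0.
move=> z y; have := @Taylor2 _ (@Phi R) _ _ _ K K z y (@is_derive_Phi R)
  (@is_derive_normal_pdf01 R) (@is_derive_opp_id_normal_pdf01 R).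
have -> : 2 * K + K = 3 * K by ring.
have -> : Phi (z + y) - Phi z - y * phi z - y ^+ 2 / 2 * (- z * phi z) =
  Phi (z + y) - Phi z - y * phi z + y ^+ 2 / 2 * (z * phi z) by ring.
apply => x; have [? ? _] := KP x => //.
by rewrite mulNr normrN.
Qed.

(** The main terms are those of [Phi_increment] with [y] and [y^2] replaced by [m] and [b]. They
    therefore cancel against the averaged increment of an observation with mean [m] and second
    moment [b]. *)
Lemma Phi_shift_scale : exists2 K : R, 0 < K & forall z m b : R, 0 <= b <= 1 ->
  `|Phi ((z + m) / Num.sqrt (1 + b)) - Phi z - m * phi z + b / 2 * (z * phi z)|
    <= K * (m ^+ 2 + b ^+ 2).
Proof.
have [K K0 KP] := @poly_normal_pdf01_bounded R.
have [K' K'0 K'P] := @Phi_scale_expansion R.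
exists (2 * K + K'); first by rewrite addr_gt0// mulr_gt0.
move=> z m b /andP[b0 b1].
(* Written as [expR a], the factor [1 / sqrt (1 + b)] fits [Phi_scale_expansion], and
   [b - b^2 <= l <= b] gives [a = - b / 2 + O(b^2)]. *)
pose l := ln (1 + b); pose a := - (l / 2).
have b1' : 0 < 1 + b by lra.
have lb : l <= b by apply: le_ln1Dx; lra.
have lb' : b - b ^+ 2 <= l.
  have : ln (1 + (- (b / (1 + b)))) <= - (b / (1 + b)).
    by apply: le_ln1Dx; rewrite ltrN2 ltr_pdivrMr// mul1r ltrDr.
  have -> : 1 + (- (b / (1 + b))) = (1 + b)^-1 by field; rewrite gt_eqF.
  rewrite lnV ?posrE// lerN2; apply: le_trans.
  by rewrite ler_pdivlMr//; nra.
have l0 : 0 <= l by apply: ln_ge0; lra.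
have sE : (Num.sqrt (1 + b))^-1 = expR a.
  rewrite expRN; congr (_^-1); rewrite -[RHS]ger0_norm ?expR_ge0//.
  rewrite -sqrtr_sqr; congr Num.sqrt.
  rewrite -expRM_natr; have -> : l / 2 * 2 = l by field.
  by rewrite lnK.
rewrite sE mulrC.
have h1 := K'P (z + m) a.
have h2 : `|Phi (z + m) - Phi z - m * phi z| <= K * m ^+ 2.
  apply: (@Taylor1 _ (@Phi R) _ _ K z m (@is_derive_Phi R)
    (@is_derive_normal_pdf01 R)) => x.
  by have [? _ _] := KP x; rewrite mulNr normrN.
have h3 : `|(z + m) * phi (z + m) - z * phi z| <= K * `|m|.
  have := @Lipschitz_of_derive _ _ _ K z m (@is_derive_opp_id_normal_pdf01 R).
  have -> : - (z + m) * phi (z + m) - (- z * phi z) =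
    - ((z + m) * phi (z + m) - z * phi z) by ring.
  by rewrite normrN; apply => x; have [] := KP x.
have a2 : a ^+ 2 <= b ^+ 2 by rewrite /a; nra.
have ab : `|a + b / 2| <= b ^+ 2 / 2 by rewrite ler_norml /a; apply/andP; split; lra.
have ab' : `|a| <= b / 2 by rewrite ler_norml /a; apply/andP; split; lra.
have [h4 _ _] := KP z.
have -> : Phi (expR a * (z + m)) - Phi z - m * phi z + b / 2 * (z * phi z) =
  (Phi (expR a * (z + m)) - Phi (z + m) - a * ((z + m) * phi (z + m))) +
  (Phi (z + m) - Phi z - m * phi z) +
  a * ((z + m) * phi (z + m) - z * phi z) + (a + b / 2) * (z * phi z) by ring.
apply: (le_trans (ler_normD _ _)).
have h5 : `|(a + b / 2) * (z * phi z)| <= b ^+ 2 / 2 * K.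
  by rewrite normrM ler_pM.
have h6 : `|a * ((z + m) * phi (z + m) - z * phi z)| <= b / 2 * (K * `|m|).
  by rewrite normrM ler_pM.
have h7 := le_trans h1 (ler_wpM2l (ltW K'0) a2).
have h8 : `|m| ^+ 2 = m ^+ 2 by rewrite real_normK ?num_real.
have h9 : b / 2 * (K * `|m|) <= K * ((m ^+ 2 + b ^+ 2) / 2).
  rewrite -h8; have : 0 <= K * (`|m| - b) ^+ 2 by rewrite mulr_ge0 ?sqr_ge0// ltW.
  have : 0 <= K * (`|m| ^+ 2 + b ^+ 2) by rewrite mulr_ge0 ?addr_ge0 ?sqr_ge0// ltW.
  nra.
have := le_trans h6 h9; move: h5 h7 h2.
set A := `| _ * (z * _) |; set B := `|Phi _ - Phi (z + m) - _|.
set C := `|Phi (z + m) - _ - _|; set D := `|a * _|.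
move=> h5 h7 h2 h10.
have : `|Phi (expR a * (z + m)) - Phi (z + m) - a * ((z + m) * phi (z + m)) +
     (Phi (z + m) - Phi z - m * phi z) + a * ((z + m) * phi (z + m) - z * phi z)| <= B + C + D.
  by apply: (le_trans (ler_normD _ _)); rewrite lerD2r; exact: ler_normD.
have := mulr_ge0 (ltW K0) (sqr_ge0 m); have := mulr_ge0 (ltW K0) (sqr_ge0 b).
have := mulr_ge0 (ltW K'0) (sqr_ge0 m); have := mulr_ge0 (ltW K'0) (sqr_ge0 b).
by nra.
Qed.

End one_step.

(** * Integrals over product powers *)


Section fubini_bounded.
Context d1 d2 (X1 : measurableType d1) (X2 : measurableType d2) (R : realType).
Variables (P1 : probability X1 R) (P2 : probability X2 R).
Variables (f : X1 * X2 -> R) (M : R).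
Hypotheses (mf : measurable_fun [set: X1 * X2] f) (f0 : forall z, 0 <= f z)
  (fM : forall z, f z <= M).

Let mf1 x : measurable_fun [set: X2] (fun y => f (x, y)).
Proof. exact: measurableT_comp. Qed.

Let inner_fin x :
  (\int[P2]_y (f (x, y))%:E = (\int[P2]_y f (x, y))%:E)%E.
Proof.
rewrite /Rintegral fineK//; apply: integrable_fin_num => //.
apply: (@rintegrable_bounded _ _ _ P2 _ M) => // y.
by rewrite ger0_norm.
Qed.

Lemma measurable_Exp2 :
  measurable_fun [set: X1] (fun x => \int[P2]_y f (x, y)).
Proof.
have -> : (fun x => \int[P2]_y f (x, y)) =
  fine \o (fun x => \int[P2]_y (EFin \o f) (x, y))%E.
  by apply/funext => x.
apply: measurableT_comp => //.
apply: measurable_fun_fubini_tonelli_F => //.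
exact/measurable_EFinP.
Qed.

Lemma Exp2_bounds x : 0 <= \int[P2]_y f (x, y) <= M.
Proof.
rewrite Rintegral_ge0//= -[leRHS](Exp_cst P2).
by apply: le_Exp => //; [|exact: rintegrable_cst];
  apply: (@rintegrable_bounded _ _ _ P2 _ M) => // y; rewrite ger0_norm.
Qed.

Lemma Exp_prod : \int[(P1 \x P2)%E]_z f z = \int[P1]_x \int[P2]_y f (x, y).
Proof.
rewrite {1}/Rintegral fubini_tonelli1//=; last exact/measurable_EFinP.
by rewrite /fubini_F; under eq_integral do rewrite inner_fin.
Qed.

End fubini_bounded.

Section prob_power_recursion.
Context d (X : measurableType d) (R : realType).
Variables (Q : probability X R) (n : nat).
Variables (f : n.+1.-tuple X -> R) (M : R).
Hypotheses (mf : measurable_fun [set: n.+1.-tuple X] f)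
  (f0 : forall z, 0 <= f z) (fM : forall z, f z <= M).

Let mfc : measurable_fun [set: X * n.-tuple X] (f \o @cons_pair _ X n).
Proof. by apply: measurableT_comp => //; exact: measurable_cons_pair. Qed.

Lemma Exp_prob_powerS : \int[prob_power Q n.+1]_t f t =
  \int[Q]_x \int[prob_power Q n]_t f (cons_pair (x, t)).
Proof.
transitivity (\int[(Q \x prob_power Q n)%E]_z f (cons_pair z)).
  rewrite /Rintegral; congr fine.
  rewrite [LHS]ge0_integral_distribution//; exact/measurable_EFinP.
exact: (@Exp_prod _ _ _ _ _ Q (prob_power Q n) (f \o @cons_pair _ X n) M
  mfc (fun=> f0 _) (fun=> fM _)).
Qed.

Lemma measurable_Exp_prob_powerS : measurable_fun [set: X]
  (fun x => \int[prob_power Q n]_t f (cons_pair (x, t))).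
Proof.
exact: (@measurable_Exp2 _ _ _ _ _ _ (f \o @cons_pair _ X n) mfc (fun=> f0 _)).
Qed.

Lemma Exp_prob_powerS_bounds x :
  0 <= \int[prob_power Q n]_t f (cons_pair (x, t)) <= M.
Proof.
exact: (@Exp2_bounds _ _ _ _ _ _ (f \o @cons_pair _ X n) M
  mfc (fun=> f0 _) (fun=> fM _)).
Qed.

End prob_power_recursion.

Lemma Exp_prob_power0 d (X : measurableType d) (R : realType)
    (Q : probability X R) (f : 0.-tuple X -> R) :
  measurable_fun [set: 0.-tuple X] f -> \int[prob_power Q 0]_t f t = f [tuple].
Proof.
move=> mf; rewrite /Rintegral/= integral_dirac//.
  by rewrite diracT mul1e.
exact/measurable_EFinP.
Qed.

(** * Central limit theorem *)


Lemma measurable_Phi_comp d (X : measurableType d) (R : realType) (Y : X -> R) :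
  measurable_fun [set: X] Y -> measurable_fun [set: X] (fun x => Phi (Y x)).
Proof.
move=> mY; apply: (@measurableT_comp _ _ _ _ _ _ (@Phi R)) => //.
exact: continuous_measurable_fun (@continuous_Phi R).
Qed.

Section lindeberg.
Context d (X : measurableType d) (R : realType).
Implicit Types (Q : probability X R) (Y : X -> R).

(** The first two terms measure how far the moments of [Y] are from [m] and [b], the third is the
    integrated remainder of [Phi_increment], and the last two are the remainder of
    [Phi_shift_scale]. *)
Definition lindeberg_error Q Y (m b : R) : R :=
  `|\int[Q]_x Y x - m| + `|\int[Q]_x (Y x ^+ 2) - b| +
  \int[Q]_x Num.min (Y x ^+ 2) (`|Y x| ^+ 3) + m ^+ 2 + b ^+ 2.

Lemma min_sqr_cube_ge0 (y : R) : 0 <= Num.min (y ^+ 2) (`|y| ^+ 3).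
Proof. by rewrite le_min sqr_ge0 exprn_ge0. Qed.

Lemma rintegrable_min_sqr_cube Q Y : measurable_fun [set: X] Y ->
  rintegrable Q (fun x => Y x ^+ 2) ->
  rintegrable Q (fun x => Num.min (Y x ^+ 2) (`|Y x| ^+ 3)).
Proof.
move=> mY iY2; apply: le_rintegrable iY2 _.
  apply: measurable_minr; first exact: measurable_funX.
  by apply: measurable_funX; exact: measurableT_comp.
by move=> x; rewrite ger0_norm ?min_sqr_cube_ge0// ge_min lexx.
Qed.

Lemma Phi_norm_le1 (x : R) : `|Phi x| <= 1.
Proof. by rewrite ger0_norm ?Phi_ge0// Phi_le1. Qed.

(** Integrating [Phi_increment] along [Y] and subtracting [Phi_shift_scale] leaves the two
    remainders and the mismatches of the moments. The coefficients [phi] and [z * phi / 2] of the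
    mismatches are bounded in [z], so one constant serves every starting point. *)
Lemma lindeberg_step1 : exists2 K : R, 0 < K & forall Q Y (m b z : R),
  measurable_fun [set: X] Y -> rintegrable Q Y ->
  rintegrable Q (fun x => Y x ^+ 2) -> 0 <= b <= 1 ->
  `|\int[Q]_x Phi (z + Y x) - Phi ((z + m) / Num.sqrt (1 + b))| <=
    K * lindeberg_error Q Y m b.
Proof.
have [K1 K10 K1P] := @Phi_increment R.
have [K2 K20 K2P] := @Phi_shift_scale R.
have [K3 K30 K3P] := @poly_normal_pdf01_bounded R.
pose p : R := normal_peak 1.
have p0 : 0 <= p by exact: normal_peak_ge0.
exists (K1 + K2 + K3 + p); first by rewrite ltr_wpDr// !addr_gt0.
move=> Q Y m b z mY iY iY2 b01; rewrite /lindeberg_error.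
have imin := rintegrable_min_sqr_cube mY iY2.
set phi := normal_pdf 0 1 z.
have phi0 : 0 <= phi by exact: normal_pdf_ge0.
have phip : phi <= p by apply: normal_pdf_ub; rewrite oner_eq0.
have mPhi : measurable_fun [set: X] (fun x => Phi (z + Y x)).
  by apply: measurable_Phi_comp; exact: measurable_funD.
have iPhi : rintegrable Q (fun x => Phi (z + Y x)).
  by apply: rintegrable_bounded mPhi _ => x; exact: Phi_norm_le1.
have iP1 := rintegrable_cst Q (Phi z).
have iP2 := rintegrableZ phi iY.
have iP3 := rintegrableZ (z * phi / 2) iY2.
have i1 := rintegrableB iPhi iP1.
have i2 := rintegrableB i1 iP2.
have i3 := rintegrableD i2 iP3.
have h1 : `|\int[Q]_x Phi (z + Y x) - Phi z - phi * \int[Q]_x Y x +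
    z * phi / 2 * \int[Q]_x (Y x ^+ 2)| <=
    K1 * \int[Q]_x Num.min (Y x ^+ 2) (`|Y x| ^+ 3).
  rewrite -[X in _ - X - _](Exp_cst Q) -(ExpB iPhi iP1) -(ExpZ _ iY) -(ExpB i1 iP2).
  rewrite -(ExpZ _ iY2) -(ExpD i2 iP3) -(ExpZ _ imin).
  apply: normr_Exp; [exact: rintegrable_measurable i3|exact: rintegrableZ|].
  move=> x; apply: le_trans (K1P z (Y x)); rewrite le_eqVlt; apply/orP; left.
  by apply/eqP; congr (`| _ |); rewrite -/phi; field.
have h2 := K2P z m b b01.
have [h3 _ _] := K3P z.
move: h1 h2; rewrite -/phi in h3 *.
set E1 := \int[Q]_x Phi _; set E2 := \int[Q]_x Y x; set E3 := \int[Q]_x _ ^+ 2.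
set E4 := \int[Q]_x _; set P2 := Phi (_ / _).
have E40 : 0 <= E4 by apply: Rintegral_ge0 => x _; exact: min_sqr_cube_ge0.
move=> h1 h2.
have -> : E1 - P2 = (E1 - Phi z - phi * E2 + z * phi / 2 * E3) -
   (P2 - Phi z - m * phi + b / 2 * (z * phi)) + phi * (E2 - m) -
   (z * phi) * ((E3 - b) / 2) by field.
have h4 : `|phi * (E2 - m)| <= p * `|E2 - m| by rewrite normrM ger0_norm// ler_wpM2r.
have h5 : `|z * phi * ((E3 - b) / 2)| <= K3 * `|E3 - b|.
  rewrite normrM ler_pM// normrM normfV (@ger0_norm _ 2)// ler_piMr// ; lra.
apply: (le_trans (ler_normB _ _)); apply: (le_trans (lerD (ler_normD _ _) h5)).
apply: (le_trans (lerD (lerD (ler_normB _ _) h4) (lexx _))).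
apply: (le_trans (lerD (lerD (lerD h1 h2) (lexx _)) (lexx _))).
have a1 := normr_ge0 (E2 - m); have a2 := normr_ge0 (E3 - b).
have a3 := sqr_ge0 m; have a4 := sqr_ge0 b.
move: (`|E2 - m|) (`|E3 - b|) (m ^+ 2) (b ^+ 2) a1 a2 a3 a4 => e1 e2 e3 e4 a1 a2 a3 a4.
rewrite -subr_ge0.
have -> : (K1 + K2 + K3 + p) * (e1 + e2 + E4 + e3 + e4) -
  (K1 * E4 + K2 * (e3 + e4) + p * e1 + K3 * e2) =
  K1 * (e1 + e2 + e3 + e4) + K2 * (e1 + e2 + E4) + K3 * (e1 + E4 + e3 + e4) +
  p * (e2 + E4 + e3 + e4) by ring.
by rewrite !addr_ge0// ?mulr_ge0// ?addr_ge0// ltW.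
Qed.

(** Division by [r] reduces to scale one; the terms of the error pick up powers of [1 / r] between
    the first and the fourth, all at most [e^-4] because [e <= 1]. The constant must serve all
    [r >= e], since the scale grows along the induction in [lindeberg]. *)
Lemma lindeberg_step (e : R) : 0 < e <= 1 ->
  exists2 K : R, 0 < K & forall Q Y (m b : R),
  measurable_fun [set: X] Y -> rintegrable Q Y ->
  rintegrable Q (fun x => Y x ^+ 2) -> 0 <= b <= e ^+ 2 ->
  forall r x : R, e <= r ->
  `|\int[Q]_t Phi ((x + Y t) / r) - Phi ((x + m) / Num.sqrt (r ^+ 2 + b))| <=
    K * lindeberg_error Q Y m b.
Proof.
move=> /andP[e0 e1]; have [K K0 KP] := lindeberg_step1.
exists (K * (e ^-1) ^+ 4); first by rewrite mulr_gt0// exprn_gt0// invr_gt0.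
move=> Q Y m b mY iY iY2 /andP[b0 be] r x er.
have r0 : 0 < r by exact: lt_le_trans er.
pose i := r^-1.
have i0 : 0 < i by rewrite invr_gt0.
have ie : i <= e^-1 by rewrite lef_pV2.
have e1' : 1 <= e^-1 by rewrite invf_ge1.
pose Z t := i * Y t.
have mZ : measurable_fun [set: X] Z by exact: measurable_funM.
have iZ : rintegrable Q Z by exact: rintegrableZ.
have Z2 : (fun t => Z t ^+ 2) = (fun t => i ^+ 2 * Y t ^+ 2).
  by apply/funext => t; rewrite exprMn.
have iZ2 : rintegrable Q (fun t => Z t ^+ 2) by rewrite Z2; exact: rintegrableZ.
have b01 : 0 <= i ^+ 2 * b <= 1.
  rewrite mulr_ge0// ?sqr_ge0//= exprVn mulrC ler_pdivrMr ?exprn_gt0// mul1r.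
  by apply: (le_trans be); rewrite ler_pXn2r// ?nnegrE ltW.
have := KP Q Z (i * m) (i ^+ 2 * b) (i * x) mZ iZ iZ2 b01.
have -> : (i * x + i * m) / Num.sqrt (1 + i ^+ 2 * b) =
    (x + m) / Num.sqrt (r ^+ 2 + b).
  have -> : r ^+ 2 + b = r ^+ 2 * (1 + i ^+ 2 * b).
    by rewrite /i; field; rewrite gt_eqF.
  rewrite sqrtrM ?sqr_ge0// sqrtr_sqr gtr0_norm// invfM -/i; ring.
have -> : \int[Q]_t Phi (i * x + Z t) = \int[Q]_t Phi ((x + Y t) / r).
  by apply: eq_Exp => t; congr Phi; rewrite /Z /i; ring.
move/le_trans; apply; rewrite -mulrA ler_wpM2l ?(ltW K0)//.
rewrite /lindeberg_error /Z (ExpZ _ iY).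
have -> : \int[Q]_t (i * Y t) ^+ 2 = i ^+ 2 * \int[Q]_t (Y t) ^+ 2.
  by rewrite -(ExpZ _ iY2); apply: eq_Exp => t; rewrite exprMn.
set I := e^-1 in ie e1' *.
have I0 : 0 < I by exact: lt_le_trans e1'.
have I24 : I ^+ 2 <= I ^+ 4 by rewrite ler_weXn2l.
have I14 : I <= I ^+ 4 by apply: ler_eXnr.
have I34 : I ^+ 3 <= I ^+ 4 by rewrite ler_weXn2l.
have i24 : i ^+ 2 <= I ^+ 4 by apply: le_trans I24; rewrite ler_pXn2r// nnegrE ltW.
have i34 : i ^+ 3 <= I ^+ 4 by apply: le_trans I34; rewrite ler_pXn2r// nnegrE ltW.
have i44 : i ^+ 4 <= I ^+ 4 by rewrite ler_pXn2r// nnegrE ltW.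
have i14 : i <= I ^+ 4 by exact: le_trans I14.
rewrite !mulrDr; apply: lerD; [apply: lerD; [apply: lerD; [apply: lerD|]|]|].
- by rewrite -mulrBr normrM gtr0_norm// ler_wpM2r.
- by rewrite -mulrBr normrM ger0_norm ?sqr_ge0// ler_wpM2r.
- have imin := rintegrable_min_sqr_cube mY iY2.
  rewrite -(ExpZ _ imin); apply: le_Exp.
  + exact: rintegrable_min_sqr_cube.
  + exact: rintegrableZ.
  + move=> t; rewrite exprMn normrM exprMn gtr0_norm//.
    have I40 : 0 <= I ^+ 4 by rewrite exprn_ge0// ltW.
    rewrite (minr_pMr _ _ I40).
    by rewrite le_min !ge_min !ler_wpM2r ?orbT ?sqr_ge0 ?exprn_ge0.
- by rewrite exprMn ler_wpM2r ?sqr_ge0.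
- by rewrite exprMn -exprM ler_wpM2r ?sqr_ge0.
Qed.

Lemma measurable_sum_tnth n Y : measurable_fun [set: X] Y ->
  measurable_fun [set: n.-tuple X] (fun t => \sum_(i < n) Y (tnth t i)).
Proof.
move=> mY; apply: measurable_sum => i.
by apply: measurableT_comp => //; exact: measurable_tnth.
Qed.

(** Under the integral over the first observation, the induction hypothesis with [x] moved to
    [x + Y y] replaces the other [n] by a shift and a larger scale; one [lindeberg_step] at scale
    [sqrt (e^2 + n b)] then treats the first. The errors add up because [K] depends on [e] alone. *)
Lemma lindeberg (e : R) : 0 < e <= 1 ->
  exists2 K : R, 0 < K & forall Q Y (m b : R),
  measurable_fun [set: X] Y -> rintegrable Q Y ->
  rintegrable Q (fun x => Y x ^+ 2) -> 0 <= b <= e ^+ 2 ->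
  forall n (x : R),
  `|\int[prob_power Q n]_t Phi ((x + \sum_(i < n) Y (tnth t i)) / e) -
    Phi ((x + n%:R * m) / Num.sqrt (e ^+ 2 + n%:R * b))| <=
    n%:R * (K * lindeberg_error Q Y m b).
Proof.
move=> e01; have /andP[e0 _] := e01; have [K K0 KP] := lindeberg_step e01.
exists K => // Q Y m b mY iY iY2 /andP[b0 be]; elim => [|n IH] x.
  rewrite !mul0r !addr0 sqrtr_sqr (gtr0_norm e0) Exp_prob_power0; last first.
    apply: measurable_Phi_comp; apply: measurable_funM => //.
    by apply: measurable_funD => //; exact: measurable_sum_tnth.
  by rewrite big_ord0 addr0 subrr normr0.
set en := Num.sqrt (e ^+ 2 + n%:R * b).
have nb0 : 0 <= n%:R * b by rewrite mulr_ge0.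
have een : e <= en.
  by rewrite -[leLHS](gtr0_norm e0) -sqrtr_sqr ler_sqrt ?lerDl// addr_ge0// sqr_ge0.
have en2 : en ^+ 2 = e ^+ 2 + n%:R * b by rewrite sqr_sqrtr// addr_ge0// sqr_ge0.
have b0e : 0 <= b <= e ^+ 2 by rewrite b0.
have step := KP Q Y m b mY iY iY2 b0e en (x + n%:R * m) een.
pose f (t : n.+1.-tuple X) := Phi ((x + \sum_(i < n.+1) Y (tnth t i)) / e).
have mf : measurable_fun [set: n.+1.-tuple X] f.
  apply: measurable_Phi_comp; apply: measurable_funM => //.
  by apply: measurable_funD => //; exact: measurable_sum_tnth.
have f0 t : 0 <= f t by exact: Phi_ge0.
have f1 t : f t <= 1 by exact: Phi_le1.
rewrite (Exp_prob_powerS Q mf f0 f1).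
have mF := measurable_Exp_prob_powerS Q mf f0.
have F01 := Exp_prob_powerS_bounds Q mf f0 f1.
set F := (fun x : X => _) in mF F01 *.
have fE y t : f (cons_pair (y, t)) =
    Phi ((x + Y y + \sum_(i < n) Y (tnth t i)) / e).
  have sE : \sum_(i < n.+1) Y (tnth (cons_pair (y, t)) i) =
      Y y + \sum_(i < n) Y (tnth t i).
    rewrite big_ord_recl; congr (_ + _).
    by apply: eq_bigr => i _; rewrite tnthS.
  by rewrite /f sE addrA.
pose G y := Phi ((x + n%:R * m + Y y) / en).
have FG y : `|F y - G y| <= n%:R * (K * lindeberg_error Q Y m b).
  have := IH (x + Y y); rewrite -/en /F /G.
  under [in X in _ -> X]eq_Rintegral do rewrite fE.
  by rewrite (addrAC x).
have mG : measurable_fun [set: X] G.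
  apply: measurable_Phi_comp; apply: measurable_funM => //.
  exact: measurable_funD.
have iF : rintegrable Q F.
  apply: (@rintegrable_bounded _ _ _ _ _ 1) => // y.
  by have /andP[? ?] := F01 y; rewrite ger0_norm.
have iG : rintegrable Q G.
  by apply: (@rintegrable_bounded _ _ _ _ _ 1) => // y; exact: Phi_norm_le1.
have h1 : `|\int[Q]_y F y - \int[Q]_y G y| <= n%:R * (K * lindeberg_error Q Y m b).
  rewrite -(ExpB iF iG) -[leRHS](Exp_cst Q).
  apply: normr_Exp; [exact: measurable_funB|exact: rintegrable_cst|exact: FG].
move: step; rewrite en2 -[\int[Q]_t _]/(\int[Q]_y G y).
have -> : x + n%:R * m + m = x + n.+1%:R * m by rewrite -natr1; ring.
have -> : e ^+ 2 + n%:R * b + b = e ^+ 2 + n.+1%:R * b by rewrite -natr1; ring.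
set H := Phi _ => h2.
rewrite -[_ - H](subrKA (\int[Q]_y G y)) (le_trans (ler_normD _ _))//.
apply: (le_trans (lerD h1 h2)); rewrite -natr1; lra.
Qed.

End lindeberg.


Lemma sandwich_dist (R : realType) (l p1 p2 e1 e2 z h : R) :
  `|p1 - e1| <= h -> `|p2 - e2| <= h -> `|l - p1| <= h -> `|l - p2| <= h ->
  e1 - h <= z -> z <= e2 + h -> `|l - z| <= 3 * h.
Proof.
rewrite !ler_norml => /andP[? ?] /andP[? ?] /andP[? ?] /andP[? ?] ? ?.
by apply/andP; split; lra.
Qed.

Section central_limit.
Context d (X : measurableType d) (R : realType).

Definition standardized_sum (k : X -> R) n (t : n.-tuple X) : R :=
  (Num.sqrt n%:R)^-1 * \sum_(i < n) k (tnth t i).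

(** For [a = l2norm P k * u] this is [score_test P k u] by unfolding. *)
Definition exceedance (k : X -> R) (a : R) n (t : n.-tuple X) : R :=
  if a < standardized_sum k t then 1 else 0.

Lemma measurable_standardized_sum (k : X -> R) n : measurable_fun [set: X] k ->
  measurable_fun [set: n.-tuple X] (@standardized_sum k n).
Proof.
by move=> mk; apply: measurable_funM => //; exact: measurable_sum_tnth.
Qed.

Lemma measurable_exceedance (k : X -> R) a n : measurable_fun [set: X] k ->
  measurable_fun [set: n.-tuple X] (@exceedance k a n).
Proof.
move=> mk; apply: measurable_fun_ifT => //.
by apply: measurable_fun_ltr => //; exact: measurable_standardized_sum.
Qed.

Lemma exceedance_bounds (k : X -> R) a n (t : n.-tuple X) :
  0 <= exceedance k a t <= 1.
Proof. by rewrite /exceedance; case: ifP; rewrite ?lexx ?ler01. Qed.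

Variables (Q : nat -> probability X R) (k : X -> R) (m s : R).
Hypotheses (mk : measurable_fun [set: X] k) (s0 : 0 < s)
  (ik : forall n, rintegrable (Q n) k)
  (ik2 : forall n, rintegrable (Q n) (fun x => k x ^+ 2))
  (km : Num.sqrt n%:R * \int[Q n]_x k x @[n --> \oo] --> m)
  (ks : \int[Q n]_x (k x ^+ 2) @[n --> \oo] --> s ^+ 2)
  (kl : \int[Q n]_x (k x ^+ 2 * Num.min 1 (`|k x| / Num.sqrt n%:R))
     @[n --> \oo] --> (0 : R)).

Let Y n x : R := (Num.sqrt n%:R)^-1 * k x.

(** Multiplication by [n] turns the first three terms of the error into the quantities of [km], [ks]
    and [kl]: for [y = k / sqrt n] the minimum of [y^2] and [|y|^3] is
    [k^2 min 1 (|k| / sqrt n) / n]. The other two terms become O(1/n). *)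
Let err_cvg : n%:R * lindeberg_error (Q n) (Y n) (m / n%:R) (s ^+ 2 / n%:R)
  @[n --> \oo] --> (0 : R).
Proof.
pose u n := `|Num.sqrt n%:R * \int[Q n]_x k x - m| +
  `|\int[Q n]_x (k x ^+ 2) - s ^+ 2| +
  \int[Q n]_x (k x ^+ 2 * Num.min 1 (`|k x| / Num.sqrt n%:R)) +
  (m ^+ 2 + s ^+ 4) * n%:R^-1.
have uE : \forall n \near \oo, u n =
    n%:R * lindeberg_error (Q n) (Y n) (m / n%:R) (s ^+ 2 / n%:R).
  near=> n.
  have n0 : 0 < n%:R :> R by rewrite ltr0n; near: n; exists 1%N.
  have sn0 : 0 < Num.sqrt n%:R :> R by rewrite sqrtr_gt0.
  have snE : (Num.sqrt n%:R) ^+ 2 = n%:R :> R by rewrite sqr_sqrtr// ltW.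
  move: sn0 snE; set w : R := Num.sqrt n%:R => sn0 snE.
  have wn0 : w != 0 by rewrite gt_eqF.
  rewrite /u /lindeberg_error /Y -/w (ExpZ _ (ik n)).
  have -> : \int[Q n]_x (w^-1 * k x) ^+ 2 = w^-2 * \int[Q n]_x (k x ^+ 2).
    by rewrite -(ExpZ _ (ik2 n)); apply: eq_Exp => x; rewrite exprMn exprVn.
  have min0 x : 0 <= Num.min 1 (`|k x| / w).
    by rewrite le_min ler01 divr_ge0// ltW.
  have imin : rintegrable (Q n) (fun x => k x ^+ 2 * Num.min 1 (`|k x| / w)).
    apply: le_rintegrable (ik2 n) _.
      apply: measurable_funM; first exact: measurable_funX.
      apply: measurable_minr => //; apply: measurable_funM => //.
      exact: measurableT_comp.
    move=> x; rewrite ger0_norm; last by rewrite (mulr_ge0 (sqr_ge0 _) (min0 x)).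
    by rewrite ler_piMr ?sqr_ge0// ge_min lexx.
  have -> : \int[Q n]_x Num.min ((w^-1 * k x) ^+ 2) (`|w^-1 * k x| ^+ 3) =
      w^-2 * \int[Q n]_x (k x ^+ 2 * Num.min 1 (`|k x| / w)).
    rewrite -(ExpZ _ imin); apply: eq_Exp => x.
    rewrite mulrA minr_pMr; last by rewrite mulr_ge0 ?sqr_ge0// invr_ge0 sqr_ge0.
    rewrite mulr1 exprMn exprVn normrM (@ger0_norm _ w^-1) ?invr_ge0 ?ltW//.
    congr Num.min; rewrite -(@real_normK _ (k x)) ?num_real//.
    by move: (`|k x|) => y; field.
  have nz z : w ^+ 2 * `|z| = `|w ^+ 2 * z| by rewrite normrM (ger0_norm (sqr_ge0 w)).
  rewrite -snE !mulrDr -[RHS]addrA; congr (_ + _ + _ + _).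
  - rewrite nz; congr (`| _ |).
    by field.
  - rewrite nz; congr (`| _ |).
    by field.
  - by rewrite mulrA divff ?mul1r// sqrf_eq0.
  - by field.
apply: (@cvg_trans _ (u @ \oo)); last first.
  rewrite (_ : 0 = `|m - m| + `|s ^+ 2 - s ^+ 2| + 0 + (m ^+ 2 + s ^+ 4) * 0).
    apply: cvgD; [apply: cvgD => //; apply: cvgD|].
    - by apply: cvg_norm; apply: cvgB => //; exact: cvg_cst.
    - by apply: cvg_norm; apply: cvgB => //; exact: cvg_cst.
    - apply: cvgMr; apply/gtr0_cvgV0; last exact: cvgr_idn.
      by exists 1%N => // n /=; rewrite ltr0n.
  by rewrite !subrr normr0 mulr0 !addr0.
exact: near_eq_cvg.
Unshelve. all: by end_near. Qed.

Let smoothed_cvg (e a : R) : 0 < e <= 1 ->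
  \int[prob_power (Q n) n]_t Phi ((standardized_sum k t - a) / e)
    @[n --> \oo] --> Phi ((m - a) / Num.sqrt (e ^+ 2 + s ^+ 2)).
Proof.
move=> e01; have [e0 _] := andP e01; have [K K0 KP] := @lindeberg _ X R e e01.
apply/cvgrPdist_le => eta eta0.
near=> n.
have n0 : 0 < n%:R :> R by rewrite ltr0n; near: n; exists 1%N.
have sn0 : 0 < Num.sqrt n%:R :> R by rewrite sqrtr_gt0.
have iYn : rintegrable (Q n) (Y n) by exact: rintegrableZ.
have iYn2 : rintegrable (Q n) (fun x => Y n x ^+ 2).
  have -> : (fun x => Y n x ^+ 2) = fun x => (Num.sqrt n%:R)^-1 ^+ 2 * k x ^+ 2.
    by apply/funext => x; rewrite exprMn.
  exact: rintegrableZ.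
have mYn : measurable_fun [set: X] (Y n) by exact: measurable_funM.
have be : 0 <= s ^+ 2 / n%:R <= e ^+ 2.
  rewrite divr_ge0 ?sqr_ge0//= ler_pdivrMr// mulrC -ler_pdivrMr ?exprn_gt0//.
  by near: n; exact: nbhs_infty_ger.
have := KP (Q n) (Y n) (m / n%:R) _ mYn iYn iYn2 be n (- a).
have -> : n%:R * (m / n%:R) = m by rewrite mulrC divfK// gt_eqF.
have -> : n%:R * (s ^+ 2 / n%:R) = s ^+ 2 by rewrite mulrC divfK// gt_eqF.
rewrite (addrC (- a) m) distrC.
have -> : \int[prob_power (Q n) n]_t Phi ((- a + \sum_(i < n) Y n (tnth t i)) / e) =
  \int[prob_power (Q n) n]_t Phi ((standardized_sum k t - a) / e).
  by apply: eq_Exp => t; rewrite addrC -mulr_sumr.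
move=> /le_trans; apply; rewrite mulrCA mulrC -ler_pdivlMr//.
near: n; have := err_cvg; move/cvgrPdist_le => /(_ (eta / K)).
rewrite divr_gt0// => /(_ isT); apply: filterS => n.
by rewrite sub0r normrN; apply: le_trans; exact: ler_norm.
Unshelve. all: by end_near. Qed.

(** The indicator of exceeding [a] lies, up to [eta / 3], between the smoothed indicators with
    thresholds [a + M e] and [a - M e], where [M] is so large that [Phi] is within [eta / 3] of its
    limits beyond [M] and [- M]. *)
Theorem central_limit (a : R) :
  \int[prob_power (Q n) n]_t exceedance k a t @[n --> \oo] --> Phi ((m - a) / s).
Proof.
apply/cvgrPdist_le => eta eta0.
have eta3 : 0 < eta / 3 by rewrite divr_gt0.
have [M [M0 PhiM PhiNM]] : exists M : R, [/\ 0 < M, 1 - eta / 3 <= Phi M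
    & Phi (- M) <= eta / 3].
  have /cvgrPdist_le/(_ _ eta3)[M1 [_ M1P]] := @cvg_Phiy R.
  have /cvgrPdist_le/(_ _ eta3)[M2 [_ M2P]] := @cvg_PhiNy R.
  pose M := Num.max 1 (Num.max (M1 + 1) (1 - M2)).
  exists M; split.
  - by rewrite /M lt_max ltr01.
  - have := M1P M; rewrite /M !lt_max ltrDl ltr01 orbT => /(_ isT).
    by rewrite ler_norml => /andP[_]; rewrite lerBlDl addrC -lerBlDl.
  - have := M2P (- M); rewrite ltrNl /M !lt_max ltrDr ltr01 !orbT => /(_ isT).
    by rewrite sub0r normrN; apply: le_trans; exact: ler_norm.
(* The shifted threshold and the added variance [e^2] are harmless for small [e]. Such an [e] is
   fixed before [n] grows, since the constant of [lindeberg] depends on it. *)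
have side (c : R) : \forall e \near 0^'+,
    `|Phi ((m - a) / s) - Phi ((m - (a + c * e)) / Num.sqrt (e ^+ 2 + s ^+ 2))|
      <= eta / 3.
  have : Phi ((m - (a + c * e)) / Num.sqrt (e ^+ 2 + s ^+ 2)) @[e --> 0^'+] -->
      Phi ((m - a) / s).
    apply: cvg_at_right_filter; apply: continuous_cvg; first exact: continuous_Phi.
    apply: cvgM.
      apply: cvgB; first exact: cvg_cst.
      rewrite -[X in _ --> X]addr0; apply: cvgD; first exact: cvg_cst.
      by rewrite -[X in _ --> X](mulr0 c); apply: cvgMr.
    apply: cvgV; first by rewrite gt_eqF.
    rewrite -[X in _ --> X](gtr0_norm s0) -sqrtr_sqr.
    apply: continuous_cvg; first exact: sqrt_continuous.
    rewrite -[X in _ --> X]add0r; apply: cvgD; last exact: cvg_cst.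
    by have := @exprn_continuous R 2 0; rewrite /continuous_at expr0n.
  by move/cvgrPdist_le; apply.
have [e [e0 e1 eP eN]] : exists e : R, [/\ 0 < e, e <= 1,
    `|Phi ((m - a) / s) - Phi ((m - (a + M * e)) / Num.sqrt (e ^+ 2 + s ^+ 2))|
      <= eta / 3 &
    `|Phi ((m - a) / s) - Phi ((m - (a + - M * e)) / Num.sqrt (e ^+ 2 + s ^+ 2))|
      <= eta / 3].
  near (0 : R)^'+ => e; exists e; split => //.
  - by near: e; apply: nbhs_right_le.
  - by near: e; exact: side.
  - by near: e; exact: side.
have e01 : 0 < e <= 1 by rewrite e0.
have /cvgrPdist_le/(_ _ eta3) lo := @smoothed_cvg e (a + M * e) e01.
have /cvgrPdist_le/(_ _ eta3) up := @smoothed_cvg e (a + - M * e) e01.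
apply: filterS2 lo up => n lon upn.
have iPhi c : rintegrable (prob_power (Q n) n)
    (fun t => Phi ((standardized_sum k t - c) / e)).
  apply: (@rintegrable_bounded _ _ _ _ _ 1) => [|t]; last exact: Phi_norm_le1.
  apply: measurable_Phi_comp; apply: measurable_funM => //.
  by apply: measurable_funB => //; exact: measurable_standardized_sum.
have iE : rintegrable (prob_power (Q n) n) (@exceedance k a n).
  apply: (@rintegrable_bounded _ _ _ _ _ 1) => [|t]; first exact: measurable_exceedance.
  by have /andP[? ?] := exceedance_bounds k a t; rewrite ger0_norm.
have ic := rintegrable_cst (prob_power (Q n) n) (eta / 3).
have hlo : \int[prob_power (Q n) n]_t Phi ((standardized_sum k t - (a + M * e)) / e)
    - eta / 3 <= \int[prob_power (Q n) n]_t exceedance k a t.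
  rewrite -[X in _ - X](Exp_cst (prob_power (Q n) n)) -(ExpB (iPhi _) ic).
  apply: le_Exp; [exact: rintegrableB|exact: iE|move=> t].
  rewrite /exceedance; case: ifPn => [_|].
    by rewrite lerBlDr (le_trans (Phi_le1 _))// lerDl ltW.
  rewrite -leNgt => ta; rewrite subr_le0; apply: le_trans PhiNM.
  apply: Phi_nondecreasing; rewrite ler_pdivrMr// mulNr.
  by rewrite opprD addrA gerDr subr_le0.
have hup : \int[prob_power (Q n) n]_t exceedance k a t <=
  \int[prob_power (Q n) n]_t Phi ((standardized_sum k t - (a + - M * e)) / e)
    + eta / 3.
  rewrite -[X in _ + X](Exp_cst (prob_power (Q n) n)) -(ExpD (iPhi _) ic).
  apply: le_Exp; [exact: iE|exact: rintegrableD|move=> t].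
  rewrite /exceedance; case: ifPn => [ta|_]; last by rewrite addr_ge0 ?Phi_ge0 ?ltW.
  rewrite -lerBlDr; apply: (le_trans PhiM).
  apply: Phi_nondecreasing; rewrite ler_pdivlMr// mulNr.
  by rewrite opprD opprK addrA lerDr subr_ge0 ltW.
have -> : eta = 3 * (eta / 3) by field.
exact: sandwich_dist lon upn eP eN hlo hup.
Unshelve. all: by end_near. Qed.

End central_limit.

(** * Affinity of product measures *)


Section affinity.
Context d (X : measurableType d) (R : realType).
Implicit Types (Q : probability X R) (r : R).

(* Dual form of [r <= (\int sqrt (dQ * dQ')) ^ 2]: it mentions no densities,
   so that it passes to product measures by Fubini. *)
Definition affinity_ge r Q Q' := forall (f : X -> R) (a b : R),
  measurable_fun [set: X] f -> 0 < a -> (forall x, a <= f x <= b) ->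
  r <= (\int[Q]_x f x) * (\int[Q']_x (f x)^-1).

End affinity.

Lemma measurable_fun_inv_gt0 d (X : measurableType d) (R : realType) (f : X -> R) :
  measurable_fun [set: X] f -> (forall x, 0 < f x) ->
  measurable_fun [set: X] (fun x => (f x)^-1).
Proof.
move=> mf f0; have -> : (fun x => (f x)^-1) = (fun x => expR (- ln (f x))).
  by apply/funext => x; rewrite expRN lnK// posrE.
by apply: measurableT_comp => //; apply: measurableT_comp => //;
  exact: measurableT_comp.
Qed.

Section affinity_lemmas.
Context d (X : measurableType d) (R : realType).
Implicit Types (Q : probability X R) (r : R).

(** Let [F] and [G] be the integrals of [f] and [1 / f] over all observations but the first. The
    induction hypothesis gives [r^n <= F G] pointwise, so [r^n] times the integral of [1 / F] is at
    most that of [G]; the inequality for one observation, applied to the function [F], supplies the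
    last factor [r]. *)
Lemma affinity_ge_power r Q Q' n : 0 <= r -> affinity_ge r Q Q' ->
  affinity_ge (r ^+ n) (prob_power Q n) (prob_power Q' n).
Proof.
move=> r0 rQ; elim: n => [|n IH] f a b mf a0 fab.
  have f0 t : 0 < f t by rewrite (lt_le_trans a0)//; have /andP[] := fab t.
  have mfV := measurable_fun_inv_gt0 mf f0.
  by rewrite !Exp_prob_power0// expr0 divff// gt_eqF.
have f0 t : 0 < f t by rewrite (lt_le_trans a0)//; have /andP[] := fab t.
have mfV := measurable_fun_inv_gt0 mf f0.
have fge0 t : 0 <= f t by exact: ltW.
have fleb t : f t <= b by have /andP[] := fab t.
have fVge0 t : 0 <= (f t)^-1 by rewrite invr_ge0.
have fVlea t : (f t)^-1 <= a^-1.
  by rewrite lef_pV2 ?posrE//; have /andP[] := fab t.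
rewrite (Exp_prob_powerS Q mf fge0 fleb) (Exp_prob_powerS Q' mfV fVge0 fVlea).
have mF := measurable_Exp_prob_powerS Q mf fge0.
have Fb := Exp_prob_powerS_bounds Q mf fge0 fleb.
have mG := measurable_Exp_prob_powerS Q' mfV fVge0.
have Gb := Exp_prob_powerS_bounds Q' mfV fVge0 fVlea.
have FG x : r ^+ n <= (\int[prob_power Q n]_t f (cons_pair (x, t))) *
    (\int[prob_power Q' n]_t (f (cons_pair (x, t)))^-1).
  apply: (IH (fun t => f (cons_pair (x, t))) a b) => //.
  by apply: measurableT_comp => //; apply: measurableT_comp => //;
    exact: measurable_cons_pair.
have Fa x : a <= \int[prob_power Q n]_t f (cons_pair (x, t)).
  rewrite -[leLHS](Exp_cst (prob_power Q n)); apply: le_Exp => [||t].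
  - exact: rintegrable_cst.
  - apply: (@rintegrable_bounded _ _ _ _ _ b) => [|t]; last by rewrite ger0_norm.
    by apply: measurableT_comp => //; apply: measurableT_comp => //;
      exact: measurable_cons_pair.
  - by have /andP[] := fab (cons_pair (x, t)).
set F := (fun x : X => _) in mF Fb *; set G := (fun x : X => _) in mG Gb *.
have {}Fa x : a <= F x by exact: Fa.
have {}FG x : r ^+ n <= F x * G x by exact: FG.
have F0 x : 0 < F x by exact: lt_le_trans (Fa x).
have mFV := measurable_fun_inv_gt0 mF F0.
have iFV : rintegrable Q' (fun x => (F x)^-1).
  apply: (@rintegrable_bounded _ _ _ _ _ a^-1) => // x.
  by rewrite ger0_norm ?invr_ge0 ?(ltW (F0 x))// lef_pV2 ?posrE.
have iG : rintegrable Q' G.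
  apply: (@rintegrable_bounded _ _ _ _ _ a^-1) => // x.
  by have /andP[? ?] := Gb x; rewrite ger0_norm.
have h1 : r ^+ n * \int[Q']_x (F x)^-1 <= \int[Q']_x G x.
  rewrite -(ExpZ _ iFV); apply: le_Exp => [||x] //; first exact: rintegrableZ.
  by rewrite ler_pdivrMr// mulrC.
have h2 : r <= \int[Q]_x F x * \int[Q']_x (F x)^-1.
  by apply: (rQ F a b) => // x; rewrite Fa; have /andP[] := Fb x.
have h3 : 0 <= \int[Q]_x F x by apply: Rintegral_ge0 => x _; exact: ltW.
apply: le_trans (ler_wpM2l h3 h1); rewrite mulrCA exprSr.
by rewrite ler_wpM2l// exprn_ge0.
Qed.

Lemma affinity_ge_le1 r Q Q' : affinity_ge r Q Q' -> r <= 1.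
Proof.
move=> /(_ (cst 1) 1 1 (measurable_cst _) ltr01) h.
have {h} : r <= \int[Q]_x cst 1 x * \int[Q']_x (cst 1 x)^-1.
  by apply: h => x; rewrite /cst lexx.
by rewrite /cst invr1 !Exp_cst mulr1.
Qed.

(** The affinity is tried on [1 + x w] with [w = 2 tau - 1]. As [w^2 <= 1], its inverse is at most
    [(1 - x w) / (1 - x^2)], which makes both integrals affine in those of [tau]. The parameter [x]
    is left free; taken of order [sqrt (1 - r)], it gives the usual bound of total variation by
    Hellinger distance. *)
Lemma affinity_ge_testr r Q Q' (tau : X -> R) (x : R) : affinity_ge r Q Q' ->
  measurable_fun [set: X] tau -> (forall t, 0 <= tau t <= 1) -> 0 < x < 1 ->
  \int[Q']_t tau t - \int[Q]_t tau t <= (1 - r) / (2 * x) + x.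
Proof.
move=> rQ mtau tau01 /andP[x0 x1]; have r1 := affinity_ge_le1 rQ.
pose w t := 2 * tau t - 1.
have w1 t : -1 <= w t <= 1.
  by rewrite /w; have /andP[? ?] := tau01 t; apply/andP; split; lra.
have itau Q0 : rintegrable Q0 tau.
  apply: (@rintegrable_bounded _ _ _ _ _ 1) => // t.
  by have /andP[? ?] := tau01 t; rewrite ger0_norm.
have i2tau Q0 : rintegrable Q0 (fun t => 2 * tau t) by exact: rintegrableZ.
have i1 Q0 : rintegrable Q0 (fun=> 1) by exact: rintegrable_cst.
have iw Q0 : rintegrable Q0 w by exact: rintegrableB.
have mw : measurable_fun [set: X] w by exact: rintegrable_measurable (iw Q).
have wE Q0 : \int[Q0]_t w t = 2 * \int[Q0]_t tau t - 1.
  by rewrite (ExpB (i2tau Q0) (i1 Q0)) ExpZ// Exp_cst.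
have i1xw Q0 (y : R) : rintegrable Q0 (fun t => 1 + y * w t).
  by apply: rintegrableD => //; exact: rintegrableZ.
have h := rQ (fun t => 1 + x * w t) (1 - x) (1 + x).
have {h} := h _ _ _.
rewrite subr_gt0 => /(_ (rintegrable_measurable (i1xw Q x)) x1).
have fb t : 1 - x <= 1 + x * w t <= 1 + x.
  by have /andP[? ?] := w1 t; apply/andP; split; nra.
move=> /(_ fb).
have fpos t : 0 < 1 + x * w t.
  by have /andP[+ _] := fb t; apply: lt_le_trans; rewrite subr_gt0.
have xx0 : 0 < 1 - x ^+ 2 by nra.
have hV : \int[Q']_t (1 + x * w t)^-1 <= (1 - x ^+ 2)^-1 * (1 - x * \int[Q']_t w t).
  have -> : 1 - x * \int[Q']_t w t = \int[Q']_t (1 + - x * w t).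
    by rewrite (ExpD (i1 Q') (rintegrableZ (- x) (iw Q'))) (ExpZ _ (iw Q')) Exp_cst mulNr.
  rewrite -(ExpZ _ (i1xw Q' _)); apply: le_Exp => [||t].
  - apply: (@rintegrable_bounded _ _ _ _ _ (1 - x)^-1) => [|t].
      apply: measurable_fun_inv_gt0 => //; exact: rintegrable_measurable (i1xw Q x).
    rewrite ger0_norm ?invr_ge0 ?(ltW (fpos t))// lef_pV2 ?posrE ?subr_gt0//.
    by have /andP[] := fb t.
  - exact: rintegrableZ.
  - rewrite [leRHS]mulrC ler_pdivlMr// [leLHS]mulrC ler_pdivrMr//.
    have /andP[? ?] := w1 t.
    have : (w t) ^+ 2 <= 1 by nra.
    nra.
have E1 : \int[Q]_t (1 + x * w t) = 1 + x * \int[Q]_t w t.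
  by rewrite (ExpD (i1 Q) (rintegrableZ x (iw Q))) (ExpZ _ (iw Q)) Exp_cst.
rewrite E1.
have qb Q0 : 0 <= \int[Q0]_t tau t <= 1.
  rewrite Rintegral_ge0; last by move=> t _; have /andP[] := tau01 t.
  rewrite -[leRHS](Exp_cst Q0); apply: le_Exp => // t.
  by have /andP[] := tau01 t.
move: (qb Q) (qb Q') hV; rewrite !wE.
move: (\int[Q']_t (1 + _ * _)^-1) (\int[Q]_t tau t) (\int[Q']_t tau t) => V q q'.
move=> /andP[q0 q1] /andP[q'0 q'1] hV h.
have A0 : 0 < 1 + x * (2 * q - 1) by nra.
have h2 : r * (1 - x ^+ 2) <= (1 + x * (2 * q - 1)) * (1 - x * (2 * q' - 1)).
  rewrite -ler_pdivlMr//; apply: (le_trans h).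
  by rewrite -mulrA ler_wpM2l ?(ltW A0)// mulrC.
have -> : (1 - r) / (2 * x) + x = ((1 - r) + 2 * x ^+ 2) / (2 * x).
  by field; rewrite gt_eqF.
rewrite ler_pdivlMr ?mulr_gt0//.
have h3 : `|(2 * q - 1) * (2 * q' - 1)| <= 1.
  by rewrite normrM mulr_ile1// ler_norml; apply/andP; split; lra.
have : - (x ^+ 2) <= x ^+ 2 * ((2 * q - 1) * (2 * q' - 1)).
  move: h3; rewrite ler_norml => /andP[h3 _].
  by have := ler_wpM2l (sqr_ge0 x) h3; rewrite mulrN1.
have : r * x ^+ 2 <= x ^+ 2 by rewrite ler_piMl// sqr_ge0.
lra.
Qed.

Lemma affinity_ge_test r Q Q' (tau : X -> R) (x : R) : affinity_ge r Q Q' ->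
  measurable_fun [set: X] tau -> (forall t, 0 <= tau t <= 1) -> 0 < x < 1 ->
  `|\int[Q]_t tau t - \int[Q']_t tau t| <= (1 - r) / (2 * x) + x.
Proof.
move=> rQ mtau tau01 x01; rewrite ler_norml lerNl opprB.
rewrite (affinity_ge_testr rQ mtau tau01 x01)/=.
have itau Q0 : rintegrable Q0 tau.
  apply: (@rintegrable_bounded _ _ _ _ _ 1) => // t.
  by have /andP[? ?] := tau01 t; rewrite ger0_norm.
have i1 Q0 : rintegrable Q0 (fun=> 1) by exact: rintegrable_cst.
have -> : \int[Q]_t tau t - \int[Q']_t tau t =
    \int[Q']_t (1 - tau t) - \int[Q]_t (1 - tau t).
  by rewrite !ExpB// !Exp_cst; ring.
apply: affinity_ge_testr => //; first exact: measurable_funB.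
by move=> t; have /andP[? ?] := tau01 t; apply/andP; split; lra.
Qed.

End affinity_lemmas.

(** * Densities *)


Section density.
Context d (X : measurableType d) (R : realType).
Variables (nu : probability X R) (mu : {sigma_finite_measure set X -> \bar R}).
Variable rho : X -> R.
Hypotheses (mrho : measurable_fun [set: X] rho) (rho0 : forall x, 0 <= rho x)
  (nuE : forall A, measurable A -> (nu A = \int[mu]_(x in A) (rho x)%:E)%E).

Lemma density_dominates : nu `<< mu.
Proof.
apply/null_content_dominatesP => A mA muA0.
rewrite nuE//; apply: null_set_integral => //.
by apply/measurable_EFinP; exact: measurable_funTS.
Qed.

Let SF := Radon_Nikodym_SigmaFinite.f nu mu.

Let SF_rho : ae_eq mu [set: X] SF (EFin \o rho).
Proof.
apply: integral_ae_eq => //.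
- exact: (Radon_Nikodym_SigmaFinite.f_integrable density_dominates).
- exact/measurable_EFinP.
- move=> A _ mA; rewrite -nuE// /SF.
  by rewrite -(Radon_Nikodym_SigmaFinite.f_integral density_dominates).
Qed.

Let mSF : measurable_fun [set: X] SF.
Proof.
exact: measurable_int (Radon_Nikodym_SigmaFinite.f_integrable density_dominates).
Qed.

Lemma ge0_integral_density (f : X -> \bar R) : (forall x, 0 <= f x)%E ->
  measurable_fun [set: X] f ->
  (\int[nu]_x f x = \int[mu]_x (f x * (rho x)%:E))%E.
Proof.
move=> f0 mf.
rewrite -(Radon_Nikodym_SigmaFinite.change_of_variables density_dominates f0)//.
apply: ae_eq_integral => //.
- exact: emeasurable_funM.
- by apply: emeasurable_funM => //; exact/measurable_EFinP.
- exact: ae_eqe_mul2l.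
Qed.

Lemma rintegrable_density (f : X -> R) : measurable_fun [set: X] f ->
  rintegrable nu f <-> rintegrable mu (fun x => f x * rho x).
Proof.
move=> mf; have E : (\int[nu]_x `|(f x)%:E| = \int[mu]_x `|(f x * rho x)%:E|)%E.
  rewrite ge0_integral_density//; last first.
    by apply/measurable_EFinP; exact: measurableT_comp.
  by apply: eq_integral => x _; rewrite /= normrM (ger0_norm (rho0 x)).
split => /integrableP[_ h]; apply/integrableP; split.
- by apply/measurable_EFinP; exact: measurable_funM.
- by rewrite -E.
- exact/measurable_EFinP.
- by rewrite /= E.
Qed.

Lemma Exp_density (f : X -> R) : rintegrable nu f ->
  \int[nu]_x f x = \int[mu]_x (f x * rho x).
Proof.
move=> intf; have mf := rintegrable_measurable intf.
rewrite /Rintegral; congr fine.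
rewrite -(Radon_Nikodym_change_of_variables density_dominates measurableT intf).
apply: ae_eq_integral => //.
- apply: emeasurable_funM; first exact/measurable_EFinP.
  exact: (measurable_int mu (@Radon_Nikodym_integrable _ _ _
    (charge_of_finite_measure nu) mu density_dominates)).
- by apply/measurable_EFinP; exact: measurable_funM.
- apply: (@ae_eqe_mul2l _ _ _ _ _ _ (EFin \o rho) (EFin \o f)).
  apply: ae_eq_trans SF_rho; apply: ae_eq_sym.
  exact: ae_eq_Radon_Nikodym_SigmaFinite density_dominates _ measurableT.
Qed.

End density.

Section density_probability.
Context d (X : measurableType d) (R : realType) (P : probability X R).
Variable w : X -> R.
Hypotheses (mw : measurable_fun [set: X] w) (w0 : forall x, 0 <= w x)
  (w1 : (\int[P]_x (w x)%:E = 1)%E).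

Lemma density_probability_exists : exists Q : probability X R,
  forall A, measurable A -> (Q A = \int[P]_(x in A) (w x)%:E)%E.
Proof.
pose m (A : set X) := (\int[P]_(x in A) (w x)%:E)%E.
have m0 : m set0 = 0%E by rewrite /m integral_set0.
have mge0 A : (0 <= m A)%E by apply: integral_ge0 => x _; rewrite lee_fin.
have msa : semi_sigma_additive m.
  move=> /= F mF tF mUF; rewrite /m ge0_integral_bigcup//.
  - apply: is_cvg_ereal_nneg_natsum_cond => n _ _.
    by apply: integral_ge0 => x _; rewrite lee_fin.
  - by apply/measurable_EFinP; exact: measurable_funTS.
  - by move=> x _; rewrite lee_fin.
pose M := isMeasure.Build _ _ _ m m0 mge0 msa.
pose mu : {measure set X -> \bar R} := HB.pack m M.
have mu1 : mu [set: X] = 1%E by [].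
pose N := Measure_isProbability.Build _ _ R mu mu1.
pose Q : probability X R := HB.pack m M N.
by exists Q.
Qed.

End density_probability.


(** * Square integrable functions and the Cauchy-Schwarz inequality *)

Section square_integrable.
Context d (X : measurableType d) (R : realType).
Implicit Types (mu : {measure set X -> \bar R}) (f g : X -> R).

Definition L2 mu f := measurable_fun [set: X] f /\ rintegrable mu (fun x => f x ^+ 2).

Lemma rintegrable_mul mu f g : L2 mu f -> L2 mu g ->
  rintegrable mu (fun x => f x * g x).
Proof.
move=> [mf if2] [mg ig2]; apply: le_rintegrable (rintegrableD if2 ig2) _.
  exact: measurable_funM.
move=> x; rewrite ler_norml; have := sqr_ge0 (f x - g x).
have := sqr_ge0 (f x + g x); move=> *; apply/andP; split; nra.
Qed.

Lemma L2D mu f g : L2 mu f -> L2 mu g -> L2 mu (fun x => f x + g x).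
Proof.
move=> [mf if2] [mg ig2]; split; first exact: measurable_funD.
apply: (le_rintegrable _ (rintegrableZ 2 (rintegrableD if2 ig2))) => [|x].
  by apply: measurable_funX; exact: measurable_funD.
rewrite ger0_norm ?sqr_ge0//; have := sqr_ge0 (f x - g x).
by move=> *; nra.
Qed.

Lemma L2Z mu (a : R) f : L2 mu f -> L2 mu (fun x => a * f x).
Proof.
move=> [mf if2]; split; first exact: measurable_funM.
have -> : (fun x => (a * f x) ^+ 2) = fun x => a ^+ 2 * f x ^+ 2.
  by apply/funext => x; rewrite exprMn.
exact: rintegrableZ.
Qed.

Lemma L2B mu f g : L2 mu f -> L2 mu g -> L2 mu (fun x => f x - g x).
Proof.
move=> Lf Lg; have -> : (fun x => f x - g x) = (fun x => f x + -1 * g x).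
  by apply/funext => x; rewrite mulN1r.
by apply: L2D => //; exact: L2Z.
Qed.

Lemma Exp_sqr_of_Lnorm mu f (r : R) : measurable_fun [set: X] f ->
  ('N[mu]_2%:E[EFin \o f] <= r%:E)%E ->
  L2 mu f /\ \int[mu]_x (f x ^+ 2) <= r ^+ 2.
Proof.
move=> mf fr.
have r0 : 0 <= r by rewrite -lee_fin (le_trans _ fr)// Lnorm_ge0.
have : (\int[mu]_x (f x ^+ 2)%:E <= (r ^+ 2)%:E)%E.
  have := @gt0_ler_poweR R 2 (ler0n _ _) 'N[mu]_2%:E[EFin \o f]%E r%:E.
  rewrite !in_itv/= !leey Lnorm_ge0 lee_fin r0 => /(_ isT isT fr) /=.
  rewrite powR_Lnorm// powR_mulrn//.
  under eq_integral do rewrite /= powR_mulrn// real_normK ?num_real//.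
  by [].
move=> h; have f2 : L2 mu f.
  split=> //; apply/integrableP; split.
    by apply/measurable_EFinP; exact: measurable_funX.
  under eq_integral do rewrite /= ger0_norm ?sqr_ge0//.
  by rewrite (le_lt_trans h)// ltry.
split => //; rewrite -lee_fin /Rintegral fineK//.
exact: integrable_fin_num f2.2.
Qed.

Lemma Lfun2P mu f : f \in Lfun mu 2%:E <-> L2 mu f.
Proof.
split=> [fL|[mf if2]].
  split; last exact: Lfun2_integrable_sqr.
  by move: fL; rewrite inE => /andP[]; rewrite inE.
rewrite inE; apply/andP; split; rewrite inE//=.
rewrite /finite_norm unlock/= poweR_lty//.
under eq_integral do rewrite /= powR_mulrn// real_normK ?num_real//.
by move: if2 => /integrableP[_]; under eq_integral do rewrite /= ger0_norm ?sqr_ge0//.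
Qed.

Lemma l2norm_ge0 (P : probability X R) f : 0 <= l2norm P f.
Proof. by rewrite fine_ge0// Lnorm_ge0. Qed.

Lemma sqr_l2norm (P : probability X R) f : L2 P f ->
  l2norm P f ^+ 2 = \int[P]_x (f x ^+ 2).
Proof.
move=> f2; have /Lfun2P := f2; rewrite inE => /andP[_]; rewrite inE/= => ffin.
have fN : 'N[P]_2%:E[EFin \o f]%E \is a fin_num by rewrite ge0_fin_numE// Lnorm_ge0.
rewrite /Rintegral.
have := @powR_Lnorm _ _ _ P (EFin \o f) 2 _.
rewrite pnatr_eq0 => /(_ isT).
under eq_integral do rewrite /= powR_mulrn// real_normK ?num_real//.
move=> <-; rewrite /l2norm -[in RHS](fineK fN) poweR_EFin/= powR_mulrn//.
by rewrite fine_ge0// Lnorm_ge0.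
Qed.

Lemma L2_rintegrable (P : probability X R) f : L2 P f -> rintegrable P f.
Proof.
move=> fL; have -> : f = (fun x => f x * 1).
  by apply/funext => x; rewrite mulr1.
by apply: rintegrable_mul => //; split => //; exact: rintegrable_cst.
Qed.

Lemma bounded_L2 (P : probability X R) f (M : R) : measurable_fun [set: X] f ->
  (forall x, `|f x| <= M) -> L2 P f.
Proof.
move=> mf fM; split => //.
apply: (@rintegrable_bounded _ _ _ _ _ (M ^+ 2)); first exact: measurable_funX.
by move=> x; rewrite normrX ler_pXn2r// nnegrE// (le_trans _ (fM x)).
Qed.

Lemma cauchy_schwarz (P : probability X R) f g : L2 P f -> L2 P g ->
  `|inner P f g| <= l2norm P f * l2norm P g.
Proof.
move=> Lf Lg; have ifg := rintegrable_mul Lf Lg.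
set a := l2norm P f; set b := l2norm P g.
have a0 : 0 <= a by exact: l2norm_ge0.
have b0 : 0 <= b by exact: l2norm_ge0.
have key (t : R) : 0 <= a ^+ 2 + 2 * t * inner P f g + t ^+ 2 * b ^+ 2.
  have i1 := Lf.2; have i2 := rintegrableZ (2 * t) ifg.
  have i3 := rintegrableZ (t ^+ 2) Lg.2.
  rewrite /a /b !sqr_l2norm// /inner -(ExpZ _ ifg) -(ExpZ _ Lg.2).
  rewrite -(ExpD i1 i2) -(ExpD (rintegrableD i1 i2) i3).
  apply: Rintegral_ge0 => x _; have := sqr_ge0 (f x + t * g x).
  by nra.
have [b00|bn0] := eqVneq b 0.
  rewrite b00 mulr0 normr_le0; apply/eqP; apply/eqP.
  move: key; rewrite b00 expr0n/=; set c := inner P f g => key.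
  apply/negPn/negP => c0.
  (* For [b = 0] the nonnegative polynomial in [t] is affine; at this [t] its value would be -1. *)
  have := key (- (a ^+ 2 + 1) / (2 * c)); rewrite mulr0 addr0.
  have -> : a ^+ 2 + 2 * (- (a ^+ 2 + 1) / (2 * c)) * c = -1.
    by field; rewrite c0.
  by rewrite ler0N1.
have b1 : 0 < b by rewrite lt_def bn0.
have := key (- inner P f g / b ^+ 2); set c := inner P f g.
have -> : a ^+ 2 + 2 * (- c / b ^+ 2) * c + (- c / b ^+ 2) ^+ 2 * b ^+ 2 =
  a ^+ 2 - c ^+ 2 / b ^+ 2 by field.
rewrite subr_ge0 ler_pdivrMr ?exprn_gt0// -exprMn -[X in X <= _ -> _]real_normK ?num_real//.
by rewrite ler_pXn2r// nnegrE// mulr_ge0.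
Qed.

End square_integrable.


Lemma ler_norm_mul2 (R : realFieldType) (a b : R) :
  2 * `|a * b| <= a ^+ 2 + b ^+ 2.
Proof.
have := sqr_ge0 (`|a| - `|b|).
by rewrite sqrrB !real_normK ?num_real// normrM; lra.
Qed.

Lemma sqrD_le (R : realFieldType) (a b : R) :
  (a + b) ^+ 2 <= 2 * a ^+ 2 + 2 * b ^+ 2.
Proof. by have := sqr_ge0 (a - b); rewrite sqrrB sqrrD; lra. Qed.

(** * Root densities and the remainder of a path *)

Section root_density.
Context d (X : measurableType d) (R : realType).
Variables (mu : {sigma_finite_measure set X -> \bar R}) (Q : probability X R).
Hypothesis Qmu : Q `<< mu.

Local Notation rd := (root_density mu Q).

Let mRN : measurable_fun [set: X] (Radon_Nikodym (charge_of_finite_measure Q) mu).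
Proof.
exact: (measurable_int mu (@Radon_Nikodym_integrable _ _ _
  (charge_of_finite_measure Q) mu Qmu)).
Qed.

Lemma measurable_root_density : measurable_fun [set: X] rd.
Proof.
apply: (@measurableT_comp _ _ _ _ _ _ (@Num.sqrt R)).
  exact: continuous_measurable_fun (@sqrt_continuous R).
by apply: measurableT_comp => //.
Qed.

Lemma root_densityE A : measurable A ->
  (Q A = \int[mu]_(x in A) (rd x ^+ 2)%:E)%E.
Proof.
move=> mA; rewrite (Radon_Nikodym_SigmaFinite.f_integral Qmu mA).
apply: ae_eq_integral => //.
- apply: measurable_funTS; apply: measurable_int.
  exact: Radon_Nikodym_SigmaFinite.f_integrable Qmu.
- apply/measurable_EFinP; apply: measurable_funTS; apply: measurable_funX.
  exact: measurable_root_density.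
- have := ae_eq_Radon_Nikodym_SigmaFinite Qmu mA; apply: filterS.
  move=> x /[apply] h; rewrite /root_density -h.
  have h0 := Radon_Nikodym_SigmaFinite.f_ge0 Qmu x.
  have hf := Radon_Nikodym_SigmaFinite.f_fin_num Qmu x.
  by rewrite sqr_sqrtr ?fineK// fine_ge0.
Qed.

Lemma rintegrable_root_density (f : X -> R) : measurable_fun [set: X] f ->
  rintegrable Q f <-> rintegrable mu (fun x => f x * rd x ^+ 2).
Proof.
move=> mf; apply: rintegrable_density => //; last exact: root_densityE.
  by apply: measurable_funX; exact: measurable_root_density.
by move=> x; rewrite sqr_ge0.
Qed.

Lemma Exp_root_density (f : X -> R) : rintegrable Q f ->
  \int[Q]_x f x = \int[mu]_x (f x * rd x ^+ 2).
Proof.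
move=> intf; apply: Exp_density => //; last exact: root_densityE.
  by apply: measurable_funX; exact: measurable_root_density.
Qed.

Lemma L2_root_density : L2 mu rd.
Proof.
split; first exact: measurable_root_density.
have := (@rintegrable_root_density (fun=> 1) (measurable_cst _)).1 (rintegrable_cst _ _).
by under eq_fun do rewrite mul1r.
Qed.

Lemma Exp_sqr_root_density : \int[mu]_x (rd x ^+ 2) = 1.
Proof.
have := Exp_root_density (rintegrable_cst Q 1); rewrite Exp_cst => ->.
by apply: eq_Exp => x; rewrite mul1r.
Qed.

End root_density.

Section remainder.
Context d (X : measurableType d) (R : realType).
Variables (P Q : probability X R).
Local Notation mu := (measure_add P Q : {sigma_finite_measure set X -> \bar R}).

Lemma dominates_measure_addl : P `<< mu.
Proof.
apply/null_content_dominatesP => A mA muA0; apply/eqP.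
by rewrite eq_le measure_ge0 andbT -muA0 [leRHS]measure_addE leeDl.
Qed.

Lemma dominates_measure_addr : Q `<< mu.
Proof.
apply/null_content_dominatesP => A mA muA0; apply/eqP.
by rewrite eq_le measure_ge0 andbT -muA0 [leRHS]measure_addE leeDr.
Qed.

Local Notation p := (root_density mu P).
Local Notation q := (root_density mu Q).

Variables (g : X -> R) (s r : R).
Hypotheses (gL : L2 P g) (r0 : 0 <= r) (hr : (root_remainder P g s Q <= r%:E)%E).

Let rem x := q x - (1 + 2^-1 * s * g x) * p x.

Let pL := L2_root_density dominates_measure_addl.
Let qL := L2_root_density dominates_measure_addr.

Lemma L2_mul_root_density (f : X -> R) : L2 P f -> L2 mu (fun x => f x * p x).
Proof.
move=> [mf if2]; split.
  by apply: measurable_funM => //; exact: pL.1.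
have -> : (fun x => (f x * p x) ^+ 2) = (fun x => f x ^+ 2 * p x ^+ 2).
  by apply/funext => x; rewrite exprMn.
by apply/rintegrable_root_density => //; [exact: dominates_measure_addl|exact: measurable_funX].
Qed.

Lemma Exp_sqr_mul_root_density (f : X -> R) : L2 P f ->
  \int[mu]_x ((f x * p x) ^+ 2) = \int[P]_x (f x ^+ 2).
Proof.
move=> [mf if2]; rewrite (Exp_root_density dominates_measure_addl if2).
by apply: eq_Exp => x; rewrite exprMn.
Qed.

Let mrem : measurable_fun [set: X] rem.
Proof.
apply: measurable_funB; first exact: qL.1.
apply: measurable_funM; last exact: pL.1.
by apply: measurable_funD => //; apply: measurable_funM => //; exact: gL.1.
Qed.

Let rem2 : L2 mu rem /\ \int[mu]_x (rem x ^+ 2) <= r ^+ 2.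
Proof. exact: Exp_sqr_of_Lnorm. Qed.

(** Since [q - f p = rem + (1 + s g / 2 - f) p], replacing the linear factor by [f] costs its
    distance to [f] in [L_2(P)]. The choice [f = 1] yields the mean of a tangent, and [f = sqrt w]
    the comparison with a measure of density [w]. *)
Lemma remainder_dist (f : X -> R) : L2 P f ->
  L2 mu (fun x => q x - f x * p x) /\
  \int[mu]_x ((q x - f x * p x) ^+ 2) <=
    2 * r ^+ 2 + 2 * \int[P]_x ((1 + 2^-1 * s * g x - f x) ^+ 2).
Proof.
move=> fL; have [remL remr] := rem2.
have fpL := L2_mul_root_density fL.
have L := L2B qL fpL; split => //.
have dL : L2 P (fun x => 1 + 2^-1 * s * g x - f x).
  apply: L2B => //; apply: L2D; last exact: L2Z.
  by split => //; exact: rintegrable_cst.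
rewrite -(Exp_sqr_mul_root_density dL).
have dpL := L2_mul_root_density dL.
apply: (@le_trans _ _ (2 * \int[mu]_x (rem x ^+ 2) +
    2 * \int[mu]_x (((1 + 2^-1 * s * g x - f x) * p x) ^+ 2))); last first.
  by rewrite lerD2r ler_wpM2l.
have i1 := rintegrableZ 2 remL.2; have i2 := rintegrableZ 2 dpL.2.
rewrite -(ExpZ _ remL.2) -(ExpZ _ dpL.2) -(ExpD i1 i2).
apply: le_Exp; [exact: L.2|exact: rintegrableD|move=> x].
have -> : q x - f x * p x = rem x + (1 + 2^-1 * s * g x - f x) * p x.
  by rewrite /rem; ring.
exact: sqrD_le.
Qed.

(** Both roots have norm one, so the integral of [p q] is [1 - E / 2], with [E] the squared distance
    of [p] and [q], which is quadratic in [r] and [s]. Expanding [q] in the same integral gives 1,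
    plus [s / 2] times the mean of [g], plus a remainder of size [r]. *)
Lemma tangent_mean_bound : 0 < r ->
  `|s / 2 * \int[P]_x g x| <= r + r ^+ 2 + s ^+ 2 * \int[P]_x (g x ^+ 2).
Proof.
move=> r_gt0; have [remL remr] := rem2.
have gi := L2_rintegrable gL.
have oneL : L2 P (fun=> 1) by split => //; exact: rintegrable_cst.
have [_ h1] := remainder_dist oneL.
have [qpL _] := remainder_dist oneL.
have {}h1 : \int[mu]_x ((q x - 1 * p x) ^+ 2) <=
    2 * r ^+ 2 + s ^+ 2 / 2 * \int[P]_x (g x ^+ 2).
  apply: (le_trans h1); rewrite lerD2l.
  have -> : \int[P]_x ((1 + 2^-1 * s * g x - 1) ^+ 2) =
      (2^-1 * s) ^+ 2 * \int[P]_x (g x ^+ 2).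
    by rewrite -(ExpZ _ gL.2); apply: eq_Exp => x; ring.
  by rewrite le_eqVlt; apply/orP; left; apply/eqP; field.
set E := \int[mu]_x ((q x - 1 * p x) ^+ 2) in h1.
have ipq := rintegrable_mul pL qL.
have iprem := rintegrable_mul pL remL.
have igp2 : rintegrable mu (fun x => g x * p x ^+ 2).
  by apply/rintegrable_root_density => //; [exact: dominates_measure_addl|exact: gL.1].
have EE : E = 2 - 2 * \int[mu]_x (p x * q x).
  have -> : E = \int[mu]_x (q x ^+ 2 + p x ^+ 2 - 2 * (p x * q x)).
    by apply: eq_Exp => x; ring.
  rewrite (ExpB (rintegrableD qL.2 pL.2) (rintegrableZ _ ipq)) (ExpD qL.2 pL.2).
  rewrite (ExpZ _ ipq) !Exp_sqr_root_density//; first exact: dominates_measure_addl.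
  exact: dominates_measure_addr.
have key : s / 2 * \int[P]_x g x = \int[mu]_x (p x * q x) - 1 -
    \int[mu]_x (p x * rem x).
  rewrite (Exp_root_density dominates_measure_addl gi).
  rewrite -[X in _ - X - _](Exp_sqr_root_density dominates_measure_addl).
  rewrite -(ExpB ipq pL.2) -(ExpB (rintegrableB ipq pL.2) iprem) -(ExpZ _ igp2).
  by apply: eq_Exp => x; rewrite /rem; field.
have h2 : `|\int[mu]_x (p x * rem x)| <= r.
  (* The weights of this arithmetic-geometric bound are chosen so that each of the two terms
     integrates to at most [r / 2]. *)
  have ib : rintegrable mu (fun x => r / 2 * p x ^+ 2 + (r * 2)^-1 * rem x ^+ 2).
    apply: rintegrableD; first by apply: rintegrableZ; exact: pL.2.
    by apply: rintegrableZ; exact: remL.2.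
  apply: le_trans (normr_Exp (rintegrable_measurable iprem) ib _) _ => [x|].
    have e : r / 2 * p x ^+ 2 + (r * 2)^-1 * rem x ^+ 2 =
      ((r * p x) ^+ 2 + rem x ^+ 2) / (r * 2) by field; rewrite gt_eqF.
    have r2 : 0 < r * 2 by rewrite mulr_gt0.
    rewrite e ler_pdivlMr//.
    have -> : `|p x * rem x| * (r * 2) = 2 * `|r * p x * rem x|.
      by rewrite -[r * p x * _]mulrA (normrM r) (ger0_norm r0); ring.
    exact: ler_norm_mul2.
  rewrite (ExpD (rintegrableZ _ pL.2) (rintegrableZ _ remL.2)).
  rewrite (ExpZ _ pL.2) (ExpZ _ remL.2) (Exp_sqr_root_density dominates_measure_addl).
  have : (r * 2)^-1 * \int[mu]_x rem x ^+ 2 <= (r * 2)^-1 * r ^+ 2.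
    by rewrite ler_wpM2l// invr_ge0 mulr_ge0.
  have -> : (r * 2)^-1 * r ^+ 2 = r / 2 by field; rewrite gt_eqF.
  lra.
have E0 : 0 <= E by apply: Rintegral_ge0 => x _; rewrite sqr_ge0.
have h3 : \int[mu]_x (p x * q x) = 1 - E / 2 by rewrite EE; field.
have G0 : 0 <= \int[P]_x (g x ^+ 2) by apply: Rintegral_ge0 => x _; rewrite sqr_ge0.
rewrite key h3.
move: h1 h2 E0 G0; move: (\int[P]_x _) (\int[mu]_x _) => G I h1 h2 E0 G0.
have sG : 0 <= s ^+ 2 * G by rewrite mulr_ge0// sqr_ge0.
move: h2; rewrite !ler_norml => /andP[? ?]; apply/andP; split; lra.
Qed.

Variables (Q' : probability X R) (w : X -> R) (C : R).
Hypotheses (mw : measurable_fun [set: X] w) (w0 : forall x, 0 <= w x)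
  (wC : forall x, w x <= C)
  (Q'E : forall A, measurable A -> (Q' A = \int[P]_(x in A) (w x)%:E)%E).

Let sw x := Num.sqrt (w x).

Let msw : measurable_fun [set: X] sw.
Proof.
apply: (@measurableT_comp _ _ _ _ _ _ (@Num.sqrt R)) => //.
exact: continuous_measurable_fun (@sqrt_continuous R).
Qed.

Let swL : L2 P sw.
Proof.
apply: (@bounded_L2 _ _ _ _ _ (Num.sqrt C)) => // x.
by rewrite ger0_norm ?sqrtr_ge0// ler_sqrt// (le_trans (w0 x)).
Qed.

(** With [D] the squared distance between the roots [q] and [sqrt w * p], the affinity of [Q] and
    [Q'] is [1 - D / 2], whose square is at least [1 - D]. The subtracted quantity is the bound on
    [D] from [remainder_dist]. *)
Lemma affinity_ge_remainder :
  affinity_ge (1 - (2 * r ^+ 2 +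
    2 * \int[P]_x ((1 + 2^-1 * s * g x - Num.sqrt (w x)) ^+ 2))) Q Q'.
Proof.
have [DL Dle] := remainder_dist swL.
have swpL := L2_mul_root_density swL.
move=> f a b mf a0 fab.
have f0 x : 0 < f x by rewrite (lt_le_trans a0)//; have /andP[] := fab x.
have mfV := measurable_fun_inv_gt0 mf f0.
set D := \int[mu]_x _ in Dle.
apply: (@le_trans _ _ (1 - D)); first by rewrite lerD2l lerN2.
set A := \int[Q]_x f x; set B := \int[Q']_x (f x)^-1.
have intf : rintegrable Q f.
  apply: (@rintegrable_bounded _ _ _ _ _ b) => // x.
  by rewrite ger0_norm ?(ltW (f0 x))//; have /andP[] := fab x.
have fVb x : (f x)^-1 <= a^-1 by rewrite lef_pV2 ?posrE//; have /andP[] := fab x.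
have intfV (Q0 : probability X R) : rintegrable Q0 (fun x => (f x)^-1).
  apply: (@rintegrable_bounded _ _ _ _ _ a^-1) => // x.
  by rewrite ger0_norm ?invr_ge0 ?(ltW (f0 x)).
have ifVw : rintegrable P (fun x => (f x)^-1 * w x).
  by apply/(rintegrable_density mw w0 Q'E).
have AE : A = \int[mu]_x (f x * q x ^+ 2).
  by rewrite /A (Exp_root_density dominates_measure_addr intf).
have BE : B = \int[mu]_x ((f x)^-1 * w x * p x ^+ 2).
  rewrite /B (Exp_density mw Q'E (intfV _)).
  by rewrite (Exp_root_density dominates_measure_addl ifVw).
have iA : rintegrable mu (fun x => f x * q x ^+ 2).
  by apply/(rintegrable_root_density dominates_measure_addr).
have iB : rintegrable mu (fun x => (f x)^-1 * w x * p x ^+ 2).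
  apply/(rintegrable_root_density dominates_measure_addl) => //.
  exact: measurable_funM.
have A0 : 0 < A.
  apply: (lt_le_trans a0); rewrite -(Exp_cst Q a); apply: le_Exp => // [|x].
    exact: rintegrable_cst.
  by have /andP[] := fab x.
have b0 : 0 < b.
  have [x _] : [set: X] !=set0.
    apply/set0P/negP => /eqP X0; have := probability_setT Q.
    by rewrite X0 measure0 => /eqP; rewrite eq_sym onee_eq0.
  by rewrite (lt_le_trans (f0 x))//; have /andP[] := fab x.
have B0 : 0 < B.
  apply: (@lt_le_trans _ _ b^-1); first by rewrite invr_gt0.
  rewrite -(Exp_cst Q' b^-1); apply: le_Exp => // [|x].
    exact: rintegrable_cst.
  by rewrite lef_pV2 ?posrE//; have /andP[] := fab x.
have AB0 : 0 <= A * B by rewrite mulr_ge0// ltW.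
(* For [D >= 1] the claim is trivial; otherwise [1 - D / 2] is positive and may be squared at the
   end. *)
have [D1|D1] := leP 1 D; first by rewrite (le_trans _ AB0)// subr_le0.
have w1 : \int[mu]_x ((sw x * p x) ^+ 2) = 1.
  rewrite Exp_sqr_mul_root_density//.
  have -> : \int[P]_x (sw x ^+ 2) = \int[P]_x (1 * w x).
    by apply: eq_Exp => x; rewrite mul1r sqr_sqrtr.
  by rewrite -(Exp_density mw Q'E (rintegrable_cst _ _)) Exp_cst.
have ipq := rintegrable_mul qL swpL.
have DE : D = 2 - 2 * \int[mu]_x (q x * (sw x * p x)).
  have -> : D = \int[mu]_x (q x ^+ 2 + (sw x * p x) ^+ 2 - 2 * (q x * (sw x * p x))).
    by apply: eq_Exp => x; ring.
  rewrite (ExpB (rintegrableD qL.2 swpL.2) (rintegrableZ _ ipq)) (ExpD qL.2 swpL.2).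
  by rewrite (ExpZ _ ipq) (Exp_sqr_root_density dominates_measure_addr) w1.
(* AM-GM: [2 q (sw p) <= c f q^2 + w p^2 / (c f)], with the optimal [c] *)
pose c := Num.sqrt (B / A).
have BA0 : 0 < B / A by rewrite divr_gt0.
have c0 : 0 < c by rewrite sqrtr_gt0.
have h : 2 - D <= c * A + c^-1 * B.
  rewrite DE opprB addrCA subrr addr0 AE BE -(ExpZ _ ipq) -(ExpZ _ iA) -(ExpZ _ iB).
  rewrite -(ExpD (rintegrableZ _ iA) (rintegrableZ _ iB)).
  apply: le_Exp => [||x].
  - exact: rintegrableZ.
  - by apply: rintegrableD; exact: rintegrableZ.
  - have fx := f0 x; rewrite -[in leRHS](sqr_sqrtr (w0 x)) -/(sw x).
    have -> : c * (f x * q x ^+ 2) + c^-1 * ((f x)^-1 * sw x ^+ 2 * p x ^+ 2) =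
      ((c * f x * q x) ^+ 2 + (sw x * p x) ^+ 2) / (c * f x).
      by field; rewrite !gt_eqF.
    rewrite ler_pdivlMr ?mulr_gt0//.
    have := sqr_ge0 (c * f x * q x - sw x * p x).
    rewrite sqrrB -mulr_natl; lra.
have cE : c * A + c^-1 * B = 2 * Num.sqrt (A * B).
  have c2 : c ^+ 2 = B / A by rewrite sqr_sqrtr// ltW.
  have -> : Num.sqrt (A * B) = c * A.
    rewrite -[RHS]ger0_norm ?mulr_ge0 ?ltW// -sqrtr_sqr exprMn c2.
    by congr Num.sqrt; field; rewrite gt_eqF.
  have -> : c^-1 * B = c * A.
    have -> : B = c ^+ 2 * A by rewrite c2 divfK// gt_eqF.
    by field; rewrite gt_eqF.
  by ring.
rewrite cE in h.
rewrite -(sqr_sqrtr AB0); move: h; set y := Num.sqrt (A * B) => h.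
have y1 : 1 - D / 2 <= y by lra.
have : (1 - D / 2) ^+ 2 <= y ^+ 2 by rewrite ler_pXn2r// nnegrE ?sqrtr_ge0//; lra.
apply: le_trans; have := sqr_ge0 D; rewrite sqrrB expr_div_n; lra.
Qed.

End remainder.

(** * Exponential tilting *)


Section elementary.
Context {R : realType}.

Lemma bernoulli_le (a : R) n : 0 <= a <= 1 -> 1 - n%:R * a <= (1 - a) ^+ n.
Proof.
move=> /andP[a0 a1]; elim: n => [|n IH]; first by rewrite mul0r subr0 expr0.
have h : (1 - n%:R * a) * (1 - a) <= (1 - a) ^+ n * (1 - a).
  by rewrite ler_wpM2r// subr_ge0.
rewrite exprSr (le_trans _ h)// -natr1.
have h2 : 0 <= n%:R * a * a by rewrite !mulr_ge0.
lra.
Qed.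

(** The upper bound comes from [expR (- y) >= 1 - y], that is, [expR y <= 1 / (1 - y)], which
    [1 + y + 2 y^2] dominates as long as [y <= 1/2]. *)
Lemma expR_bounds (y : R) : `|y| <= 2^-1 ->
  `|expR y - 1 - y| <= 2 * y ^+ 2 /\ expR y <= 2.
Proof.
rewrite ler_norml => /andP[y0 y1].
have l := expR_ge1Dx y; have l' := expR_ge1Dx (- y).
have y1' : 0 < 1 - y by lra.
have e0 := expR_gt0 y.
have u : expR y * (1 - y) <= 1.
  by rewrite -[leRHS](expRxMexpNx_1 y) ler_wpM2l ?(ltW e0).
have u2 : expR y <= 1 + y + 2 * y ^+ 2.
  rewrite -(ler_pM2r y1'); apply: (le_trans u); rewrite -subr_ge0.
  have -> : (1 + y + 2 * y ^+ 2) * (1 - y) - 1 = y ^+ 2 * (1 - 2 * y) by ring.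
  by rewrite mulr_ge0 ?sqr_ge0//; lra.
split; last by nra.
by rewrite ger0_norm; lra.
Qed.

Lemma inv_bounds (z a : R) : 1 <= z -> z <= 1 + a -> `|z^-1 - 1| <= a.
Proof.
move=> z1 za; have z0 : 0 < z by lra.
rewrite ler0_norm; last by rewrite subr_le0 invf_le1.
rewrite opprB -(ler_pM2r z0) mulrBl mulVf ?gt_eqF//; nra.
Qed.

End elementary.

Section tilt.
Context d (X : measurableType d) (R : realType) (P : probability X R).
Variables (h : X -> R) (M : R).
Hypotheses (mh : measurable_fun [set: X] h) (hM : forall x, `|h x| <= M)
  (h0 : \int[P]_x h x = 0).

Definition tilt_const (s : R) := \int[P]_x expR (s * h x).

Definition tilt_density (s : R) x := expR (s * h x) / tilt_const s.

Let M0 : 0 <= M.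
Proof.
have [x _] : [set: X] !=set0; last by rewrite (le_trans _ (hM x)).
apply/set0P/negP => /eqP X0; have := probability_setT P.
by rewrite X0 measure0 => /eqP; rewrite eq_sym onee_eq0.
Qed.

Let me s : measurable_fun [set: X] (fun x => expR (s * h x)).
Proof.
by apply: measurableT_comp => //; exact: measurable_funM.
Qed.

Let shM s x : `|s * h x| <= `|s| * M.
Proof. by rewrite normrM ler_wpM2l. Qed.

Let ie s : rintegrable P (fun x => expR (s * h x)).
Proof.
apply: (@rintegrable_bounded _ _ _ _ _ (expR (`|s| * M))) => // x.
by rewrite ger0_norm ?expR_ge0// ler_expR (le_trans (ler_norm _)).
Qed.

Let ih : rintegrable P h.
Proof. exact: rintegrable_bounded mh hM. Qed.

Lemma tilt_const_ge1 s : 1 <= tilt_const s.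
Proof.
have -> : 1 = \int[P]_x (1 + s * h x) :> R.
  rewrite (ExpD (rintegrable_cst _ _) (rintegrableZ _ ih)) (ExpZ _ ih) h0.
  by rewrite Exp_cst mulr0 addr0.
apply: le_Exp => // [|x]; last exact: expR_ge1Dx.
by apply: rintegrableD; [exact: rintegrable_cst|exact: rintegrableZ].
Qed.

Lemma tilt_const_gt0 s : 0 < tilt_const s.
Proof. exact: lt_le_trans (tilt_const_ge1 s). Qed.

Lemma measurable_tilt_density s : measurable_fun [set: X] (tilt_density s).
Proof. exact: measurable_funM. Qed.

Lemma tilt_density_ge0 s x : 0 <= tilt_density s x.
Proof. by rewrite divr_ge0 ?expR_ge0// ltW// tilt_const_gt0. Qed.

Lemma tilt_density_bound s x : tilt_density s x <= expR (`|s| * M).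
Proof.
rewrite ler_pdivrMr ?tilt_const_gt0// (@le_trans _ _ (expR (`|s| * M)))//.
  by rewrite ler_expR (le_trans (ler_norm _)).
by rewrite ler_peMr ?expR_ge0// tilt_const_ge1.
Qed.

Lemma tilt_exists s : exists Q : probability X R,
  forall A, measurable A -> (Q A = \int[P]_(x in A) (tilt_density s x)%:E)%E.
Proof.
apply: density_probability_exists.
- exact: measurable_tilt_density.
- exact: tilt_density_ge0.
- have iw : rintegrable P (tilt_density s).
    have := rintegrableZ (tilt_const s)^-1 (ie s).
    by under eq_fun do rewrite mulrC.
  have E : \int[P]_x tilt_density s x = 1.
    rewrite /tilt_density; under eq_Rintegral do rewrite mulrC.
    by rewrite (ExpZ _ (ie s)) mulVf// gt_eqF// tilt_const_gt0.
  rewrite -[LHS]fineK; last exact: integrable_fin_num iw.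
  by rewrite -[fine _]/(\int[P]_x tilt_density s x) E.
Qed.

Lemma tilt_const_le s : `|s| * M <= 2^-1 -> tilt_const s <= 1 + 2 * (s * M) ^+ 2.
Proof.
move=> sM.
have -> : 1 + 2 * (s * M) ^+ 2 = \int[P]_x (1 + s * h x + 2 * (s * M) ^+ 2).
  have i1 := rintegrableD (rintegrable_cst P 1) (rintegrableZ s ih).
  rewrite (ExpD i1 (rintegrable_cst _ _)) (ExpD (rintegrable_cst _ _) (rintegrableZ _ ih)).
  by rewrite (ExpZ _ ih) h0 !Exp_cst mulr0 addr0.
apply: le_Exp => // [|x].
  apply: rintegrableD; last exact: rintegrable_cst.
  by apply: rintegrableD; [exact: rintegrable_cst|exact: rintegrableZ].
have [+ _] := expR_bounds (le_trans (shM s x) sM).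
have : (s * h x) ^+ 2 <= (s * M) ^+ 2.
  rewrite -real_normK ?num_real// -[leRHS]real_normK ?num_real//.
  by rewrite ler_pXn2r ?nnegrE// [leRHS]normrM (ger0_norm M0).
by move=> e1; rewrite ler_norml => /andP[_ e2]; lra.
Qed.

(** The 6 is [2 + 2 * 2]: the exponential deviates from its linear part by [2 (s M)^2], and the
    inverse of the normalising constant from 1 by the same amount, multiplied by an exponential that
    is at most 2. *)
Lemma tilt_density_expansion s x : `|s| * M <= 2^-1 ->
  `|tilt_density s x - 1 - s * h x| <= 6 * (s * M) ^+ 2.
Proof.
move=> sM; have [e1 e2] := expR_bounds (le_trans (shM s x) sM).
have z := inv_bounds (tilt_const_ge1 s) (tilt_const_le sM).
have y2 : (s * h x) ^+ 2 <= (s * M) ^+ 2.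
  rewrite -real_normK ?num_real// -[leRHS]real_normK ?num_real//.
  by rewrite ler_pXn2r ?nnegrE// [leRHS]normrM (ger0_norm M0).
have -> : tilt_density s x - 1 - s * h x =
  (expR (s * h x) - 1 - s * h x) + expR (s * h x) * ((tilt_const s)^-1 - 1).
  by rewrite /tilt_density; ring.
apply: (le_trans (ler_normD _ _)); rewrite [X in _ + X]normrM.
rewrite (ger0_norm (expR_ge0 _)).
have := ler_pM (expR_ge0 _) (normr_ge0 _) e2 z; lra.
Qed.

(** The root of the tilt is again an exponential, with exponent [s h / 2], over the root of the
    normalising constant. That root lies between 1 and the constant itself, so the estimate for the
    tilt carries over. *)
Lemma sqrt_tilt_density_expansion s x : `|s| * M <= 2^-1 ->
  `|Num.sqrt (tilt_density s x) - 1 - 2^-1 * s * h x| <= 6 * (s * M) ^+ 2.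
Proof.
move=> sM; pose y := 2^-1 * s * h x.
have yE : y = 2^-1 * (s * h x) by rewrite /y mulrA.
have y2 : `|y| <= 2^-1.
  rewrite yE normrM (@ger0_norm _ 2^-1)// (le_trans _ (le_trans (shM s x) sM))//.
  by rewrite ler_piMl//; lra.
have [e1 e2] := expR_bounds y2.
have tc0 := ltW (tilt_const_gt0 s).
have z1 : 1 <= Num.sqrt (tilt_const s).
  by rewrite -[leLHS]sqrtr1 ler_sqrt ?tilt_const_ge1.
have zE : Num.sqrt (tilt_const s) <= 1 + 2 * (s * M) ^+ 2.
  rewrite (le_trans _ (tilt_const_le sM))// -[leRHS](sqr_sqrtr tc0).
  exact: ler_eXnr.
have z := inv_bounds z1 zE.
have y2' : y ^+ 2 <= (s * M) ^+ 2.
  rewrite yE exprMn (@le_trans _ _ ((s * h x) ^+ 2))//.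
    by rewrite ler_piMl ?sqr_ge0// expr2; lra.
  rewrite -real_normK ?num_real// -[leRHS]real_normK ?num_real//.
  by rewrite ler_pXn2r ?nnegrE// [leRHS]normrM (ger0_norm M0).
have swE : Num.sqrt (tilt_density s x) = expR y / Num.sqrt (tilt_const s).
  rewrite sqrtrM ?expR_ge0// sqrtrV//; congr (_ / _).
  rewrite -[RHS]ger0_norm ?expR_ge0// -sqrtr_sqr -expRM_natr; congr (Num.sqrt (expR _)).
  by rewrite yE; field.
have -> : Num.sqrt (tilt_density s x) - 1 - y =
  (expR y - 1 - y) + expR y * ((Num.sqrt (tilt_const s))^-1 - 1).
  by rewrite swE; ring.
apply: (le_trans (ler_normD _ _)); rewrite [X in _ + X]normrM.
rewrite (ger0_norm (expR_ge0 _)).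
have := ler_pM (expR_ge0 _) (normr_ge0 _) e2 z; lra.
Qed.

End tilt.


Lemma cvg_inv_sqrt (R : realType) : (Num.sqrt n%:R)^-1 @[n --> \oo] --> (0 : R).
Proof.
apply/gtr0_cvgV0; first by exists 1%N => // n /=; rewrite sqrtr_gt0 ltr0n.
apply/cvgryPge => A; near=> n.
rewrite (le_trans (ler_norm A))// -sqrtr_sqr ler_sqrt//.
by near: n; exact: nbhs_infty_ger.
Unshelve. all: by end_near. Qed.

Lemma cvg_div_sqrt (R : realType) (t : R) : 0 < t ->
  t / Num.sqrt n%:R @[n --> \oo] --> 0^'+.
Proof.
move=> t0; have sqrtV := @cvg_inv_sqrt R.
move=> U /= [e e0 eU]; have /cvgrPdist_lt/(_ (e / t)) := sqrtV.
  rewrite divr_gt0// => /(_ isT) [N _ NP]; exists (maxn N 1) => // n /=.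
  rewrite geq_max => /andP[Nn n1].
  have n0 : 0 < (Num.sqrt n%:R)^-1 :> R by rewrite invr_gt0 sqrtr_gt0 ltr0n.
  apply: eU; last by rewrite mulr_gt0.
  rewrite /ball_/= sub0r normrN gtr0_norm ?mulr_gt0//.
  have := NP n Nn; rewrite /= sub0r normrN gtr0_norm// ltr_pdivlMr//.
  by rewrite mulrC.
Qed.

(** * Dominated convergence and truncation *)

Section dominated.
Context d (X : measurableType d) (R : realType) (P : probability X R).

Lemma dominated_Exp_cvg0 (f : nat -> X -> R) (g : X -> R) :
  (forall n, measurable_fun [set: X] (f n)) -> rintegrable P g ->
  (forall n x, `|f n x| <= g x) -> (forall x, f n x @[n --> \oo] --> (0 : R)) ->
  \int[P]_x f n x @[n --> \oo] --> (0 : R).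
Proof.
move=> mf ig fg f0.
have : (\int[P]_x (f n x)%:E)%E @[n --> \oo] --> (\int[P]_x (cst 0 x))%E.
  apply: (@dominated_cvg _ _ _ P _ measurableT (fun n => EFin \o f n) (cst 0%E)
    (EFin \o g)) => //.
  - by move=> n; exact/measurable_EFinP.
  - by move=> x _; apply: cvg_EFin; [exact: nearW|exact: f0].
  - by move=> n x _; rewrite lee_fin.
by rewrite integral0 => /fine_cvg.
Qed.

Definition truncation (M : R) (g : X -> R) x := Num.max (- M) (Num.min M (g x)).

Lemma measurable_truncation M (g : X -> R) : measurable_fun [set: X] g ->
  measurable_fun [set: X] (truncation M g).
Proof. by move=> mg; apply: measurable_maxr => //; exact: measurable_minr. Qed.

Lemma truncation_bounds M (g : X -> R) x : 0 <= M -> `|truncation M g x| <= M.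
Proof.
by move=> M0; rewrite ler_norml le_max lexx/= ge_max ge_min lexx/=; lra.
Qed.

Lemma truncation_id M (g : X -> R) x : `|g x| <= M -> truncation M g x = g x.
Proof.
rewrite ler_norml => /andP[g0 g1]; rewrite /truncation min_r// max_r//.
Qed.

Lemma truncation_dist M (g : X -> R) x : 0 <= M -> `|g x - truncation M g x| <= `|g x|.
Proof.
move=> M0; rewrite /truncation /Num.max /Num.min.
have := ler_norm (g x); have := ler_norm (- g x); rewrite normrN.
move: (`|g x|) => a ga ag.
by case: ifPn; case: ifPn; rewrite -?leNgt => h1 h2; rewrite ler_norml;
  apply/andP; split; lra.
Qed.

(** The truncation of [g] at a large level is recentred by its mean [m]. Because [g] has mean zero,
    this lowers the squared distance to [g] by exactly [m^2]. *)
Lemma bounded_centered_approx (g : X -> R) (e : R) : L2 P g ->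
  \int[P]_x g x = 0 -> 0 < e -> exists (h : X -> R) (M : R),
  [/\ measurable_fun [set: X] h, forall x, `|h x| <= M, \int[P]_x h x = 0 &
      \int[P]_x ((g x - h x) ^+ 2) < e].
Proof.
move=> gL g0 e0.
have mt n := measurable_truncation n%:R gL.1.
have : \int[P]_x ((g x - truncation n%:R g x) ^+ 2) @[n --> \oo] --> (0 : R).
  apply: (@dominated_Exp_cvg0 _ (fun x => g x ^+ 2)).
  - by move=> n; apply: measurable_funX; apply: measurable_funB => //; exact: gL.1.
  - exact: gL.2.
  - move=> n x; rewrite ger0_norm ?sqr_ge0//.
    rewrite -real_normK ?num_real// -[leRHS]real_normK ?num_real//.
    by rewrite ler_pXn2r ?nnegrE//; exact: truncation_dist.
  - move=> x; apply: cvg_near_cst; near=> n.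
    rewrite truncation_id ?subrr ?expr0n//.
    near: n; exact: nbhs_infty_ger.
move/cvgrPdist_lt => /(_ _ e0)[N _ /(_ N (leqnn N))]/=; rewrite sub0r normrN => hN.
pose t := truncation N%:R g; pose m := \int[P]_x t x.
have tL : L2 P t.
  by apply: (@bounded_L2 _ _ _ _ _ N%:R) => [|x]; [exact: mt|exact: truncation_bounds].
have it := L2_rintegrable tL.
exists (fun x => t x - m), (N%:R + `|m|); split.
- by apply: measurable_funB => //; exact: mt.
- move=> x; rewrite (le_trans (ler_normB _ _))// lerD2r.
  exact: truncation_bounds.
- by rewrite (ExpB it (rintegrable_cst _ _)) Exp_cst subrr.
- have dL := L2B gL tL; have id := L2_rintegrable dL.
  have -> : \int[P]_x ((g x - (t x - m)) ^+ 2) =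
      \int[P]_x ((g x - t x) ^+ 2) - m ^+ 2.
    have -> : \int[P]_x ((g x - (t x - m)) ^+ 2) =
        \int[P]_x ((g x - t x) ^+ 2 + (2 * m) * (g x - t x) + m ^+ 2).
      by apply: eq_Exp => x; ring.
    rewrite (ExpD (rintegrableD dL.2 (rintegrableZ _ id)) (rintegrable_cst _ _)).
    rewrite (ExpD dL.2 (rintegrableZ _ id)) (ExpZ _ id) Exp_cst.
    rewrite (ExpB (L2_rintegrable gL) it) g0 -/m; ring.
  have := sqr_ge0 m; have := le_lt_trans (ler_norm _) hN; rewrite -/t; lra.
Unshelve. all: by end_near. Qed.

End dominated.

(** * Comparison of a path with exponential tilts *)

Section paths.
Context d (X : measurableType d) (R : realType) (P : probability X R).
Variables (calP : set (probability X R)) (g : X -> R) (Pg : R -> probability X R).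
Hypothesis path : path_with_tangent calP P g Pg.

Let gL : L2 P g.
Proof. by apply/Lfun2P; case: path. Qed.

Lemma path_remainder (e : R) : 0 < e ->
  \forall s \near 0^'+, (root_remainder P g s (Pg s) <= (e * s)%:E)%E.
Proof.
move=> e0; have [_ _ /(_ [set x | (x < e%:E)%E])] := path.
move=> /(_ (open_ereal_lt' _)); rewrite lte_fin => /(_ e0) h.
near=> s.
have s0 : 0 < s by near: s; exact: nbhs_right_gt.
have : ((s^-1)%:E * root_remainder P g s (Pg s) < e%:E)%E by near: s.
move/ltW; rewrite lee_pdivrMl//.
by rewrite mulrC EFinM.
Unshelve. all: by end_near. Qed.

(** In [tangent_mean_bound] with [r = e s / 4], division by [s / 2] leaves [e / 2] plus a term of
    order [s]. *)
Lemma tangent_mean0 : \int[P]_x g x = 0.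
Proof.
apply/eqP; rewrite -normr_le0; apply/ler_addgt0Pr => e e0; rewrite add0r.
pose G := \int[P]_x (g x ^+ 2).
have G0 : 0 <= G by apply: Rintegral_ge0 => x _; exact: sqr_ge0.
have e4 : 0 < e / 4 by rewrite divr_gt0.
have h := path_remainder e4.
have K0 : 0 < 2 * (e / 4) ^+ 2 + 2 * G.
  by rewrite ltr_wpDr ?mulr_ge0// mulr_gt0// exprn_gt0.
near (0 : R)^'+ => s.
have s0 : 0 < s by near: s; exact: nbhs_right_gt.
have hr : (root_remainder P g s (Pg s) <= (e / 4 * s)%:E)%E by near: s.
have es0 : 0 < e / 4 * s by rewrite mulr_gt0.
have := tangent_mean_bound gL (ltW es0) hr es0.
rewrite normrM gtr0_norm ?divr_gt0// -/G => hb.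
have {}hb : `|\int[P]_x g x| <= e / 2 + s * (2 * (e / 4) ^+ 2 + 2 * G).
  rewrite -(@ler_pM2l _ (s / 2)) ?divr_gt0//; apply: (le_trans hb).
  by rewrite le_eqVlt; apply/orP; left; apply/eqP; field.
apply: (le_trans hb).
have sK : s * (2 * (e / 4) ^+ 2 + 2 * G) <= e / 2.
  rewrite -ler_pdivlMr//; near: s; apply: nbhs_right_le.
  by rewrite divr_gt0// divr_gt0.
lra.
Unshelve. all: by end_near. Qed.

Lemma affinity_ge_le (r r' : R) (Q Q' : probability X R) : r' <= r ->
  affinity_ge r Q Q' -> affinity_ge r' Q Q'.
Proof.
by move=> rr' h f a b mf a0 fab; apply: le_trans rr' _; exact: (h f a b).
Qed.

Variables (h : X -> R) (M : R).
Hypotheses (mh : measurable_fun [set: X] h) (hM : forall x, `|h x| <= M)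
  (h0 : \int[P]_x h x = 0).

(** The loss [2 del s^2] has three parts: [del s^2 / 2] from the remainder of the path, by the
    choice [e^2 = del / 4]; [del s^2] from the distance between [g] and [h]; and [144 (s M)^4], at
    most [del s^2 / 2] for small [s], from expanding the root of the tilt. *)
Lemma affinity_path_tilt (del : R) : \int[P]_x ((g x - h x) ^+ 2) < del ->
  \forall s \near 0^'+, forall Q' : probability X R,
    (forall A, measurable A ->
      (Q' A = \int[P]_(x in A) (tilt_density P h s x)%:E)%E) ->
    affinity_ge (1 - 2 * del * s ^+ 2) (Pg s) Q'.
Proof.
move=> hdel.
have I0 : 0 <= \int[P]_x ((g x - h x) ^+ 2).
  by apply: Rintegral_ge0 => x _; exact: sqr_ge0.
have del0 : 0 < del by exact: le_lt_trans hdel.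
pose e := Num.sqrt (del / 4).
have e0 : 0 < e by rewrite sqrtr_gt0 divr_gt0.
have e2 : e ^+ 2 = del / 4 by rewrite sqr_sqrtr// divr_ge0// ltW.
have hrem := path_remainder e0.
have hL : L2 P h by exact: bounded_L2 mh hM.
have M0 : 0 <= M.
  have [x _] : [set: X] !=set0; last by rewrite (le_trans _ (hM x)).
  apply/set0P/negP => /eqP X0; have := probability_setT P.
  by rewrite X0 measure0 => /eqP; rewrite eq_sym onee_eq0.
have M10 : 0 < M + 1 by rewrite ltr_wpDl.
have K0 : 0 < 144 * M ^+ 4 + 1 by rewrite ltr_wpDl// mulr_ge0// exprn_ge0.
near=> s => Q' Q'E.
have s0 : 0 < s by near: s; exact: nbhs_right_gt.
have hr : (root_remainder P g s (Pg s) <= (e * s)%:E)%E by near: s.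
have sM : `|s| * M <= 2^-1.
  rewrite gtr0_norm// (@le_trans _ _ (s * (M + 1)))//.
    by rewrite ler_wpM2l ?lerDl// ltW.
  rewrite -ler_pdivlMr//; near: s; apply: nbhs_right_le.
  by rewrite divr_gt0.
have mw := measurable_tilt_density P mh s.
have w0 := tilt_density_ge0 mh hM h0 s.
have wC := tilt_density_bound mh hM h0 s.
have := affinity_ge_remainder gL hr mw w0 wC Q'E.
apply: affinity_ge_le; rewrite lerD2l lerN2.
have h2 : \int[P]_x (1 + 2^-1 * s * g x - Num.sqrt (tilt_density P h s x)) ^+ 2 <=
    s ^+ 2 / 2 * \int[P]_x ((g x - h x) ^+ 2) + 72 * (s * M) ^+ 4.
  have ghL := L2B gL hL.
  rewrite -(ExpZ _ ghL.2) -[X in _ <= _ + X](Exp_cst P).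
  rewrite -(ExpD (rintegrableZ _ ghL.2) (rintegrable_cst _ _)).
  have swL : L2 P (fun x => Num.sqrt (tilt_density P h s x)).
    apply: (@bounded_L2 _ _ _ _ _ (Num.sqrt (expR (`|s| * M)))) => [|x].
      apply: (@measurableT_comp _ _ _ _ _ _ (@Num.sqrt R)) => //.
      exact: continuous_measurable_fun (@sqrt_continuous R).
    by rewrite ger0_norm ?sqrtr_ge0// ler_sqrt// expR_ge0.
  have oneL : L2 P (fun=> 1) by split => //; exact: rintegrable_cst.
  apply: le_Exp => [||x].
  - exact: (L2B (L2D oneL (L2Z (2^-1 * s) gL)) swL).2.
  - by apply: rintegrableD; [apply: rintegrableZ; exact: ghL.2|exact: rintegrable_cst].
  - have := sqrt_tilt_density_expansion mh hM h0 x sM.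
    set a := Num.sqrt _ - 1 - _ => ha.
    have -> : 1 + 2^-1 * s * g x - Num.sqrt (tilt_density P h s x) =
      2^-1 * s * (g x - h x) + - a by rewrite /a; ring.
    apply: (le_trans (sqrD_le _ _)).
    have -> : 2 * (2^-1 * s * (g x - h x)) ^+ 2 = s ^+ 2 / 2 * (g x - h x) ^+ 2.
      by field.
    rewrite lerD2l sqrrN -[a ^+ 2]real_normK ?num_real//.
    have -> : 72 * (s * M) ^+ 4 = 2 * (6 * (s * M) ^+ 2) ^+ 2 by ring.
    by rewrite ler_pM2l// ler_pXn2r// nnegrE// mulr_ge0// sqr_ge0.
have h3 : s ^+ 2 / 2 * \int[P]_x ((g x - h x) ^+ 2) <= s ^+ 2 / 2 * del.
  by rewrite ler_wpM2l ?divr_ge0 ?sqr_ge0// ltW.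
have h4 : 144 * (s * M) ^+ 4 <= s ^+ 2 * (del / 2).
  have -> : 144 * (s * M) ^+ 4 = s ^+ 2 * (s ^+ 2 * (144 * M ^+ 4)) by ring.
  rewrite ler_wpM2l ?sqr_ge0//.
  have s1 : s <= 1 by near: s; exact: nbhs_right_le.
  apply: (@le_trans _ _ (s * (144 * M ^+ 4 + 1))).
    rewrite ler_pM ?sqr_ge0 ?mulr_ge0 ?exprn_ge0 ?lerDl//.
    by rewrite expr2 ler_piMl// ltW.
  rewrite -ler_pdivlMr//; near: s; apply: nbhs_right_le.
  by rewrite divr_gt0// divr_gt0.
have h5 := le_trans h2 (lerD h3 (lexx _)).
rewrite exprMn e2; move: h4 h5; move: (\int[P]_x _) ((s * M) ^+ 4) => I K; lra.
Unshelve. all: by end_near. Qed.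

Variable Qt : R -> probability X R.
Hypothesis QtE : forall s A, measurable A ->
  (Qt s A = \int[P]_(x in A) (tilt_density P h s x)%:E)%E.

(** By Bernoulli's inequality the [n]-th power of [1 - 2 del t^2 / n] is at least [1 - 2 del t^2],
    so the loss does not grow with [n]. The tests are quantified after [n]: the estimate is uniform
    over them. *)
Lemma path_tilt_tests (del t x : R) : \int[P]_x ((g x - h x) ^+ 2) < del ->
  0 < t -> 0 < x < 1 ->
  \forall n \near \oo, forall tau : n.-tuple X -> R,
    measurable_fun [set: n.-tuple X] tau -> (forall z, 0 <= tau z <= 1) ->
    `|\int[prob_power (Pg (t / Num.sqrt n%:R)) n]_z tau z -
      \int[prob_power (Qt (t / Num.sqrt n%:R)) n]_z tau z| <=
    t ^+ 2 * del / x + x.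
Proof.
move=> hdel t0 x01.
have del0 : 0 < del.
  by apply: le_lt_trans hdel; apply: Rintegral_ge0 => y _; exact: sqr_ge0.
have tn := cvg_div_sqrt t0.
have aff : \forall n \near \oo, affinity_ge (1 - 2 * del * (t / Num.sqrt n%:R) ^+ 2)
    (Pg (t / Num.sqrt n%:R)) (Qt (t / Num.sqrt n%:R)).
  have aff0 := tn _ (affinity_path_tilt hdel).
  near=> n; have H : forall Q' : probability X R,
    (forall A, measurable A -> (Q' A =
      \int[P]_(x in A) (tilt_density P h (t / Num.sqrt n%:R) x)%:E)%E) ->
    affinity_ge (1 - 2 * del * (t / Num.sqrt n%:R) ^+ 2) (Pg (t / Num.sqrt n%:R)) Q'.
    by near: n; exact: aff0.
  by apply: H; exact: QtE.
near=> n => tau mtau tau01.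
have n0 : 0 < n%:R :> R by rewrite ltr0n; near: n; exists 1%N.
have affn : affinity_ge (1 - 2 * del * (t / Num.sqrt n%:R) ^+ 2)
    (Pg (t / Num.sqrt n%:R)) (Qt (t / Num.sqrt n%:R)).
  by near: n.
have E : 2 * del * (t / Num.sqrt n%:R) ^+ 2 = 2 * del * t ^+ 2 / n%:R.
  by rewrite exprMn exprVn sqr_sqrtr ?(ltW n0)// mulrA.
rewrite E in affn.
have a01 : 0 <= 2 * del * t ^+ 2 / n%:R <= 1.
  apply/andP; split.
    by rewrite divr_ge0 ?(ltW n0)// (mulr_ge0 _ (sqr_ge0 _))// mulr_ge0// ltW.
  rewrite ler_pdivrMr// mul1r; near: n; exact: nbhs_infty_ger.
have r0 : 0 <= 1 - 2 * del * t ^+ 2 / n%:R by rewrite subr_ge0; case/andP: a01.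
have := affinity_ge_test (affinity_ge_power (n := n) r0 affn) mtau tau01 x01.
move/le_trans; apply; rewrite lerD2r.
have /andP[x0 _] := x01.
have := bernoulli_le n a01; rewrite mulrC divfK ?gt_eqF// => hb.
rewrite ler_pdivrMr ?mulr_gt0//.
have -> : t ^+ 2 * del / x * (2 * x) = 2 * del * t ^+ 2 by field; rewrite gt_eqF.
by rewrite lerBlDr addrC -lerBlDr.
Unshelve. all: by end_near. Qed.

End paths.


(** * Asymptotic normality under the tilts and under [P] *)

Section tilt_limits.
Context d (X : measurableType d) (R : realType) (P : probability X R).
Variables (h : X -> R) (M : R).
Hypotheses (mh : measurable_fun [set: X] h) (hM : forall x, `|h x| <= M)
  (h0 : \int[P]_x h x = 0).
Variable Qt : R -> probability X R.
Hypothesis QtE : forall s A, measurable A ->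
  (Qt s A = \int[P]_(x in A) (tilt_density P h s x)%:E)%E.

Let mw s := measurable_tilt_density P mh s.
Let w0 := tilt_density_ge0 mh hM h0.
Let wC := tilt_density_bound mh hM h0.

Let rintegrable_mul_tilt s (f : X -> R) : rintegrable P f ->
  rintegrable P (fun x => f x * tilt_density P h s x).
Proof.
move=> intf; have mf := rintegrable_measurable intf.
apply: le_rintegrable (rintegrableZ (expR (`|s| * M)) (rintegrable_norm intf)) _.
  exact: measurable_funM.
by move=> x; rewrite normrM mulrC (ger0_norm (w0 _ _)) ler_wpM2r.
Qed.

Lemma rintegrable_tilt s (f : X -> R) : rintegrable P f -> rintegrable (Qt s) f.
Proof.
move=> intf; have mf := rintegrable_measurable intf.
apply/(rintegrable_density (mw s) (w0 s) (QtE s)) => //.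
exact: rintegrable_mul_tilt.
Qed.

Lemma Exp_tilt s (f : X -> R) : rintegrable P f ->
  \int[Qt s]_x f x = \int[P]_x (f x * tilt_density P h s x).
Proof.
move=> intf; apply: (Exp_density (mw s) (QtE s)); exact: rintegrable_tilt.
Qed.

Variables (k : X -> R) (t : R).
Hypotheses (kL : L2 P k) (k0 : \int[P]_x k x = 0) (kpos : 0 < l2norm P k).

Let s n : R := t / Num.sqrt n%:R.

Let s_small : \forall n \near \oo, `|s n| * M <= 2^-1.
Proof.
have : `|s n| * M @[n --> \oo] --> (0 : R).
  rewrite -[X in _ --> X](mul0r M) -(@normr0 R R); apply: cvgMl.
  apply: cvg_norm; rewrite -(mulr0 t); apply: cvgMr; exact: cvg_inv_sqrt.
move/cvgrPdist_le => /(_ 2^-1); rewrite invr_gt0 => /(_ (ltr0Sn _ _)); apply: filterS => n.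
by rewrite sub0r normrN; apply: le_trans; exact: ler_norm.
Qed.

Let ki := L2_rintegrable kL.

(** As [k] is centred, only the linear term [s h] of the density contributes, and [sqrt n * s = t].
    The rest is of order [sqrt n * s^2], that is, [1 / sqrt n]. *)
Lemma tilt_mean_cvg :
  Num.sqrt n%:R * \int[Qt (s n)]_x k x @[n --> \oo] --> t * inner P k h.
Proof.
have hL : L2 P h by exact: bounded_L2 mh hM.
have ikh := rintegrable_mul kL hL.
pose B := \int[P]_x `|k x|.
apply/cvgrPdist_le => e e0.
have cB : 6 * (t * M) ^+ 2 * B * (Num.sqrt n%:R)^-1 @[n --> \oo] --> (0 : R).
  rewrite -[X in _ --> X](mulr0 (6 * (t * M) ^+ 2 * B)); apply: cvgMr.
  exact: cvg_inv_sqrt.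
move/cvgrPdist_le : cB => /(_ _ e0) cB.
near=> n.
have n0 : 0 < n%:R :> R by rewrite ltr0n; near: n; exists 1%N.
have sn0 : 0 < Num.sqrt n%:R :> R by rewrite sqrtr_gt0.
have snM : `|s n| * M <= 2^-1 by near: n.
have cBn : 6 * (t * M) ^+ 2 * B * (Num.sqrt n%:R)^-1 <= e.
  have : `|0 - 6 * (t * M) ^+ 2 * B * (Num.sqrt n%:R)^-1| <= e by near: n.
  by rewrite sub0r normrN; apply: le_trans; exact: ler_norm.
rewrite (Exp_tilt _ ki) distrC.
have ikw := rintegrable_mul_tilt (s n) ki.
have i1 := rintegrableB ikw ki.
have i2 := rintegrableB i1 (rintegrableZ (s n) ikh).
have E : \int[P]_x (k x * tilt_density P h (s n) x - k x - s n * (k x * h x)) =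
    \int[P]_x (k x * tilt_density P h (s n) x) - s n * inner P k h.
  by rewrite (ExpB i1 (rintegrableZ _ ikh)) (ExpB ikw ki) k0 subr0 (ExpZ _ ikh).
have -> : Num.sqrt n%:R * \int[P]_x (k x * tilt_density P h (s n) x) -
    t * inner P k h = Num.sqrt n%:R *
    \int[P]_x (k x * tilt_density P h (s n) x - k x - s n * (k x * h x)).
  by rewrite E mulrBr mulrA /s (mulrC _ (t / _)) divfK// gt_eqF.
rewrite normrM (gtr0_norm sn0).
have hb : `|\int[P]_x (k x * tilt_density P h (s n) x - k x - s n * (k x * h x))| <=
    6 * (s n * M) ^+ 2 * B.
  rewrite -(ExpZ _ (rintegrable_norm ki)); apply: normr_Exp.
  - exact: rintegrable_measurable i2.
  - by apply: rintegrableZ; exact: rintegrable_norm.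
  - move=> x; have -> : k x * tilt_density P h (s n) x - k x - s n * (k x * h x) =
      k x * (tilt_density P h (s n) x - 1 - s n * h x) by ring.
    rewrite normrM mulrC ler_wpM2r//.
    exact: tilt_density_expansion.
apply: le_trans cBn; apply: (le_trans (ler_wpM2l (ltW sn0) hb)).
by rewrite le_eqVlt; apply/orP; left; apply/eqP; rewrite /s; field; rewrite gt_eqF.
Unshelve. all: by end_near. Qed.

Lemma tilt_second_moment_cvg :
  \int[Qt (s n)]_x (k x ^+ 2) @[n --> \oo] --> l2norm P k ^+ 2.
Proof.
rewrite sqr_l2norm//; have ik2 := kL.2.
pose B := \int[P]_x (k x ^+ 2).
have B0 : 0 <= B by apply: Rintegral_ge0 => x _; exact: sqr_ge0.
apply/cvgrPdist_le => e e0.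
have cB : 4 * M * B * `|s n| @[n --> \oo] --> (0 : R).
  rewrite -[X in _ --> X](mulr0 (4 * M * B)); apply: cvgMr.
  rewrite -(@normr0 R R); apply: cvg_norm; rewrite -(mulr0 t); apply: cvgMr.
  exact: cvg_inv_sqrt.
move/cvgrPdist_le : cB => /(_ _ e0) cB.
near=> n.
have snM : `|s n| * M <= 2^-1 by near: n.
have cBn : 4 * M * B * `|s n| <= e.
  have : `|0 - 4 * M * B * `|s n| | <= e by near: n.
  by rewrite sub0r normrN; apply: le_trans; exact: ler_norm.
rewrite (Exp_tilt _ ik2) distrC.
have ikw := rintegrable_mul_tilt (s n) ik2.
rewrite -(ExpB ikw ik2); apply: le_trans cBn.
(* With [y = |s n| M <= 1/2], the density deviates from 1 by at most [6 y^2 + y <= 4 y]. *)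
have -> : 4 * M * B * `|s n| = (4 * (`|s n| * M)) * B by ring.
rewrite -(ExpZ _ ik2); apply: normr_Exp.
- exact: rintegrable_measurable (rintegrableB ikw ik2).
- exact: rintegrableZ.
- move=> x; have := tilt_density_expansion mh hM h0 x snM.
  have -> : k x ^+ 2 * tilt_density P h (s n) x - k x ^+ 2 =
    k x ^+ 2 * (tilt_density P h (s n) x - 1) by ring.
  move=> hx; rewrite normrM (ger0_norm (sqr_ge0 _)) mulrC ler_wpM2r ?sqr_ge0//.
  have shx : `|s n * h x| <= `|s n| * M by rewrite normrM ler_wpM2l.
  have -> : tilt_density P h (s n) x - 1 =
    (tilt_density P h (s n) x - 1 - s n * h x) + s n * h x by rewrite subrK.
  apply: (le_trans (ler_normD _ _)); apply: (le_trans (lerD hx shx)).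
  have -> : (s n * M) ^+ 2 = (`|s n| * M) ^+ 2.
    by rewrite exprMn [RHS]exprMn real_normK ?num_real.
  have sM0 : 0 <= `|s n| * M by exact: le_trans shx.
  move: sM0 snM; move: (`|s n| * M) => y y0 y1; nra.
Unshelve. all: by end_near. Qed.

(** This is the Lindeberg condition for a fixed law; by dominated convergence the finite second
    moment of [k] suffices. *)
Lemma min_norm_cvg0 :
  \int[P]_x (k x ^+ 2 * Num.min 1 (`|k x| / Num.sqrt n%:R)) @[n --> \oo] --> (0 : R).
Proof.
have min0 n x : 0 <= Num.min 1 (`|k x| / Num.sqrt n%:R).
  by rewrite le_min ler01 divr_ge0// sqrtr_ge0.
apply: (@dominated_Exp_cvg0 _ _ _ P _ (fun x => k x ^+ 2)).
- move=> n; apply: measurable_funM; first by apply: measurable_funX; exact: kL.1.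
  apply: measurable_minr => //; apply: measurable_funM => //.
  by apply: measurableT_comp => //; exact: kL.1.
- exact: kL.2.
- move=> n x; rewrite ger0_norm; last by rewrite (mulr_ge0 (sqr_ge0 _)).
  by rewrite ler_piMr ?sqr_ge0// ge_min lexx.
- move=> x; rewrite -[X in _ --> X](mulr0 (k x ^+ 2)); apply: cvgMr.
  apply: (@squeeze_cvgr _ _ _ _ (fun=> 0) (fun n => `|k x| * (Num.sqrt n%:R)^-1)).
  + by apply: nearW => n; rewrite min0 ge_min lexx orbT.
  + exact: cvg_cst.
  + by rewrite -[X in _ --> X](mulr0 `|k x|); apply: cvgMr; exact: cvg_inv_sqrt.
Qed.

Lemma tilt_min_norm_cvg0 :
  \int[Qt (s n)]_x (k x ^+ 2 * Num.min 1 (`|k x| / Num.sqrt n%:R))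
    @[n --> \oo] --> (0 : R).
Proof.
have min0 n x : 0 <= Num.min 1 (`|k x| / Num.sqrt n%:R).
  by rewrite le_min ler01 divr_ge0// sqrtr_ge0.
have imin n : rintegrable P (fun x => k x ^+ 2 * Num.min 1 (`|k x| / Num.sqrt n%:R)).
  apply: le_rintegrable kL.2 _ => [|x].
    apply: measurable_funM; first by apply: measurable_funX; exact: kL.1.
    apply: measurable_minr => //; apply: measurable_funM => //.
    by apply: measurableT_comp => //; exact: kL.1.
  rewrite ger0_norm; last by rewrite (mulr_ge0 (sqr_ge0 _)).
  by rewrite ler_piMr ?sqr_ge0// ge_min lexx.
(* The factor 2 bounds the density of the tilt once [|s n| M <= 1/2]. *)
apply: (@squeeze_cvgr _ _ _ _ (fun=> 0) (fun n => 2 *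
  \int[P]_x (k x ^+ 2 * Num.min 1 (`|k x| / Num.sqrt n%:R)))).
- near=> n; apply/andP; split.
    by apply: Rintegral_ge0 => x _; rewrite (mulr_ge0 (sqr_ge0 _)).
  have snM : `|s n| * M <= 2^-1 by near: n.
  rewrite (Exp_tilt _ (imin n)) -(ExpZ _ (imin n)); apply: le_Exp.
  + exact: rintegrable_mul_tilt.
  + exact: rintegrableZ.
  + move=> x; rewrite mulrC ler_wpM2r ?(mulr_ge0 (sqr_ge0 _))//.
    apply: (le_trans (wC _ _)).
    have snM0 : `| `|s n| * M| <= 2^-1.
      by rewrite ger0_norm// mulr_ge0// (le_trans _ (hM x)).
    by have [] := expR_bounds snM0.
- exact: cvg_cst.
- by rewrite -[X in _ --> X](mulr0 2); apply: cvgMr; exact: min_norm_cvg0.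
Unshelve. all: by end_near. Qed.

Lemma tilt_central_limit (a : R) :
  \int[prob_power (Qt (s n)) n]_z exceedance k a z @[n --> \oo] -->
    Phi ((t * inner P k h - a) / l2norm P k).
Proof.
apply: (central_limit (Q := fun n => Qt (s n))) => //.
- exact: kL.1.
- by move=> n; exact: rintegrable_tilt.
- by move=> n; apply: rintegrable_tilt; exact: kL.2.
- exact: tilt_mean_cvg.
- exact: tilt_second_moment_cvg.
- exact: tilt_min_norm_cvg0.
Qed.

End tilt_limits.

Section null_limit.
Context d (X : measurableType d) (R : realType) (P : probability X R).
Variable k : X -> R.
Hypotheses (kL : L2 P k) (k0 : \int[P]_x k x = 0) (kpos : 0 < l2norm P k).

Lemma null_central_limit (a : R) :
  \int[prob_power P n]_z exceedance k a z @[n --> \oo] --> Phi (- a / l2norm P k).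
Proof.
rewrite -[X in Phi (X / _)]sub0r.
apply: (central_limit (Q := fun=> P)) => //.
- exact: kL.1.
- by move=> n; exact: L2_rintegrable.
- by move=> n; exact: kL.2.
- by rewrite k0; under eq_fun do rewrite mulr0; exact: cvg_cst.
- by rewrite sqr_l2norm//; exact: cvg_cst.
- exact: min_norm_cvg0.
Qed.

End null_limit.

(** * Neyman-Pearson tests *)


Section power_density.
Context d (X : measurableType d) (R : realType) (P Q : probability X R).
Variables (w : X -> R) (C : R).
Hypotheses (mw : measurable_fun [set: X] w) (w0 : forall x, 0 <= w x)
  (wC : forall x, w x <= C)
  (QE : forall A, measurable A -> (Q A = \int[P]_(x in A) (w x)%:E)%E).

Lemma measurable_prod_tnth n :
  measurable_fun [set: n.-tuple X] (fun z => \prod_(i < n) w (tnth z i)).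
Proof.
apply: measurable_prod => i _.
by apply: measurableT_comp => //; exact: measurable_tnth.
Qed.

Lemma prod_tnth_bounds n (z : n.-tuple X) :
  0 <= \prod_(i < n) w (tnth z i) <= C ^+ n.
Proof.
rewrite prodr_ge0//= -[in leRHS](card_ord n) -prodr_const.
by apply: ler_prod => i _; rewrite w0 wC.
Qed.

Lemma Exp_power_density n (f : n.-tuple X -> R) (M : R) :
  measurable_fun [set: n.-tuple X] f -> (forall z, 0 <= f z <= M) ->
  \int[prob_power Q n]_z f z =
  \int[prob_power P n]_z (f z * \prod_(i < n) w (tnth z i)).
Proof.
elim: n f => [|n IH] f mf fM.
  rewrite !Exp_prob_power0 ?big_ord0 ?mulr1//.
  by apply: measurable_funM => //; exact: measurable_prod_tnth.
have f0 z : 0 <= f z by have /andP[] := fM z.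
have fleM z : f z <= M by have /andP[] := fM z.
pose F z := f z * \prod_(i < n.+1) w (tnth z i).
have mF : measurable_fun [set: n.+1.-tuple X] F.
  by apply: measurable_funM => //; exact: measurable_prod_tnth.
have F0 z : 0 <= F z.
  by rewrite mulr_ge0//; have /andP[] := prod_tnth_bounds z.
have FM z : F z <= M * C ^+ n.+1.
  by have /andP[? ?] := prod_tnth_bounds z; rewrite ler_pM.
rewrite (Exp_prob_powerS Q mf f0 fleM) (Exp_prob_powerS P mF F0 FM).
have mI := measurable_Exp_prob_powerS Q mf f0.
have Ib := Exp_prob_powerS_bounds Q mf f0 fleM.
rewrite (Exp_density mw QE); last first.
  apply: (@rintegrable_bounded _ _ _ _ _ M) => // x.
  by have /andP[? ?] := Ib x; rewrite ger0_norm.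
apply: eq_Exp => x.
have mfx : measurable_fun [set: n.-tuple X] (fun z => f (cons_pair (x, z))).
  by apply: measurableT_comp => //; apply: measurableT_comp => //;
    exact: measurable_cons_pair.
rewrite (IH _ mfx); last by move=> z; exact: fM.
rewrite mulrC -ExpZ.
  apply: eq_Exp => z; rewrite /F mulrCA; congr (_ * _).
  rewrite big_ord_recl; congr (_ * _).
  by apply: eq_bigr => i _; rewrite tnthS.
apply: (@rintegrable_bounded _ _ _ _ _ (M * C ^+ n)) => [|z].
  by apply: measurable_funM => //; exact: measurable_prod_tnth.
have /andP[p0 pC] := prod_tnth_bounds z.
by rewrite ger0_norm ?mulr_ge0// ler_pM.
Qed.

End power_density.

Section neyman_pearson.
Context d (X : measurableType d) (R : realType) (P : probability X R).
Variables (h : X -> R) (M : R).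
Hypotheses (mh : measurable_fun [set: X] h) (hM : forall x, `|h x| <= M)
  (h0 : \int[P]_x h x = 0).
Variable Qt : R -> probability X R.
Hypothesis QtE : forall s A, measurable A ->
  (Qt s A = \int[P]_(x in A) (tilt_density P h s x)%:E)%E.

(* The likelihood ratio of the tilt is an increasing function of the sum of the
   [h x_i], so that the exceedance tests are the Neyman-Pearson tests. *)
Lemma tilt_neyman_pearson n (t a : R) (tau : n.-tuple X -> R) :
  (0 < n)%N -> 0 < t -> measurable_fun [set: n.-tuple X] tau ->
  (forall z, 0 <= tau z <= 1) -> exists2 K : R, 0 <= K <= expR (t * a) &
  \int[prob_power (Qt (t / Num.sqrt n%:R)) n]_z tau z <=
  \int[prob_power (Qt (t / Num.sqrt n%:R)) n]_z exceedance h a z +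
  K * (\int[prob_power P n]_z tau z - \int[prob_power P n]_z exceedance h a z).
Proof.
move=> n_gt0 t0 mtau tau01; set s := t / _.
have n0 : 0 < n%:R :> R by rewrite ltr0n.
have sn0 : 0 < Num.sqrt n%:R :> R by rewrite sqrtr_gt0.
have mw := measurable_tilt_density P mh s.
have w0 := tilt_density_ge0 mh hM h0 s.
have wC := tilt_density_bound mh hM h0 s.
have me : measurable_fun [set: n.-tuple X] (@exceedance _ X R h a n).
  exact: measurable_exceedance.
have e01 := @exceedance_bounds _ X R h a n.
rewrite (Exp_power_density mw w0 wC (QtE s) mtau tau01).
rewrite (Exp_power_density mw w0 wC (QtE s) me e01).
pose L (z : n.-tuple X) := \prod_(i < n) tilt_density P h s (tnth z i).
have Z1 := tilt_const_ge1 mh hM h0 s; have Z0 := tilt_const_gt0 mh hM h0 s.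
(* The value of the likelihood ratio where the standardized sum equals [a]. It is at most
   [expR (t * a)] for every [n], because the normalising constant is at least 1. *)
pose K := expR (t * a) / tilt_const P h s ^+ n.
have LE z : L z = expR (t * standardized_sum h z) / tilt_const P h s ^+ n.
  rewrite /L /tilt_density big_split/= prodr_const card_ord exprVn; congr (_ / _).
  rewrite -expR_sum -mulr_sumr; congr expR.
  by rewrite /s /standardized_sum mulrA.
exists K.
  rewrite divr_ge0 ?expR_ge0 ?exprn_ge0 ?(ltW Z0)//=.
  rewrite ler_pdivrMr ?exprn_gt0// ler_peMr ?expR_ge0//.
  exact: exprn_ege1.
have it (f : n.-tuple X -> R) : measurable_fun [set: n.-tuple X] f ->
    (forall z, 0 <= f z <= 1) -> rintegrable (prob_power P n) f.
  move=> mf f01; apply: (@rintegrable_bounded _ _ _ _ _ 1) => // z.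
  by have /andP[? ?] := f01 z; rewrite ger0_norm.
have itL (f : n.-tuple X -> R) : measurable_fun [set: n.-tuple X] f ->
    (forall z, 0 <= f z <= 1) -> rintegrable (prob_power P n) (fun z => f z * L z).
  move=> mf f01; apply: (@rintegrable_bounded _ _ _ _ _ (expR (`|s| * M) ^+ n)) => [|z].
    by apply: measurable_funM => //; exact: measurable_prod_tnth.
  have /andP[? ?] := f01 z; have /andP[? ?] := prod_tnth_bounds w0 wC z.
  by rewrite ger0_norm ?mulr_ge0// -[leRHS]mul1r ler_pM.
have iB := rintegrableB (it _ mtau tau01) (it _ me e01).
rewrite -lerBlDl -(ExpB (itL _ mtau tau01) (itL _ me e01)).
rewrite -(ExpB (it _ mtau tau01) (it _ me e01)) -(ExpZ _ iB).
(* Pointwise, [tau - exceedance] and [L - K] have opposite signs: the exceedance test is 1 exactly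
   where [L > K]. *)
apply: le_Exp => [||z].
- exact: rintegrableB (itL _ mtau tau01) (itL _ me e01).
- exact: rintegrableZ.
- rewrite -mulrBl [leRHS]mulrC; have /andP[ta0 ta1] := tau01 z.
  have Zn0 : 0 < tilt_const P h s ^+ n by rewrite exprn_gt0.
  rewrite /exceedance; case: ifPn => [az|].
    rewrite ler_wnM2l ?subr_le0// LE /K ler_pM2r ?invr_gt0// ler_expR.
    by rewrite ler_pM2l// ltW.
  rewrite -leNgt subr0 => az; rewrite ler_wpM2l// LE /K ler_pM2r ?invr_gt0//.
  by rewrite ler_expR ler_pM2l.
Qed.

End neyman_pearson.

(** * Limits along paths *)


Section l2norm_lemmas.
Context d (X : measurableType d) (R : realType) (P : probability X R).
Implicit Types f g : X -> R.

Lemma innerE f : inner P f f = \int[P]_x (f x ^+ 2).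
Proof. by apply: eq_Exp => x; rewrite expr2. Qed.

Lemma innerC f g : inner P f g = inner P g f.
Proof. by apply: eq_Exp => x; rewrite mulrC. Qed.

Lemma innerZr f g (a : R) : L2 P f -> L2 P g ->
  inner P f (fun x => a * g x) = a * inner P f g.
Proof.
move=> fL gL; rewrite /inner -(ExpZ _ (rintegrable_mul fL gL)).
by apply: eq_Exp => x; rewrite mulrCA.
Qed.

Lemma innerBr f g1 g2 : L2 P f -> L2 P g1 -> L2 P g2 ->
  inner P f (fun x => g1 x - g2 x) = inner P f g1 - inner P f g2.
Proof.
move=> fL g1L g2L; rewrite /inner -(ExpB (rintegrable_mul fL g1L) (rintegrable_mul fL g2L)).
by apply: eq_Exp => x; rewrite mulrBr.
Qed.

Lemma innerBl f1 f2 g : L2 P f1 -> L2 P f2 -> L2 P g ->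
  inner P (fun x => f1 x - f2 x) g = inner P f1 g - inner P f2 g.
Proof. by move=> f1L f2L gL; rewrite innerC innerBr// !(innerC g). Qed.

Lemma sqr_l2norm_inner f : L2 P f -> l2norm P f ^+ 2 = inner P f f.
Proof. by move=> fL; rewrite sqr_l2norm// innerE. Qed.

Lemma l2normD f g : L2 P f -> L2 P g ->
  l2norm P (fun x => f x + g x) <= l2norm P f + l2norm P g.
Proof.
move=> fL gL; have fgL := L2D fL gL.
rewrite -(@ler_pXn2r _ 2)// ?nnegrE ?addr_ge0 ?l2norm_ge0//.
rewrite sqr_l2norm//.
have -> : \int[P]_x ((f x + g x) ^+ 2) =
    \int[P]_x (f x ^+ 2) + \int[P]_x (g x ^+ 2) + 2 * inner P f g.
  have ifg := rintegrable_mul fL gL.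
  rewrite -(ExpZ _ ifg) -(ExpD fL.2 gL.2).
  rewrite -(ExpD (rintegrableD fL.2 gL.2) (rintegrableZ _ ifg)).
  by apply: eq_Exp => x; ring.
rewrite -!sqr_l2norm//; have := le_trans (ler_norm _) (cauchy_schwarz fL gL).
by rewrite sqrrD; lra.
Qed.

Lemma l2norm_dist f g (e : R) : L2 P f -> L2 P g -> 0 <= e ->
  \int[P]_x ((f x - g x) ^+ 2) <= e ^+ 2 -> l2norm P (fun x => f x - g x) <= e.
Proof.
move=> fL gL e0 h; rewrite -(@ler_pXn2r _ 2)// ?nnegrE ?l2norm_ge0//.
by rewrite sqr_l2norm//; exact: L2B.
Qed.

End l2norm_lemmas.

Lemma Phi_Lipschitz (R : realType) (x y : R) :
  `|Phi y - Phi x| <= normal_peak 1 * `|y - x|.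
Proof.
have := @Lipschitz_of_derive _ (@Phi R) _ (normal_peak 1) x (y - x) (@is_derive_Phi R).
have -> : x + (y - x) = y by ring.
apply => z; rewrite ger0_norm ?normal_pdf_ge0//.
by apply: normal_pdf_ub; rewrite oner_eq0.
Qed.

Section path_limits.
Context d (X : measurableType d) (R : realType) (P : probability X R).
Variables (calP : set (probability X R)) (g : X -> R) (Pg : R -> probability X R).
Hypothesis path : path_with_tangent calP P g Pg.
Variable t : R.
Hypothesis t0 : 0 < t.

Let gL : L2 P g.
Proof. by apply/Lfun2P; case: path. Qed.

Let peak : R := normal_peak 1.

Let peak0 : 0 <= peak. Proof. exact: normal_peak_ge0. Qed.

(** The choices [del = eta^2] and [x = eta] in [path_tilt_tests] balance the two terms of
    [t^2 del / x + x]. *)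
Let tilt_approx (eta : R) : 0 < eta < 1 ->
  exists (h : X -> R) (M : R) (Qt : R -> probability X R),
  [/\ measurable_fun [set: X] h, (forall x, `|h x| <= M) /\ \int[P]_x h x = 0,
    (forall s A, measurable A ->
      (Qt s A = \int[P]_(x in A) (tilt_density P h s x)%:E)%E),
    l2norm P (fun x => h x - g x) <= eta &
    \forall n \near \oo, forall tau : n.-tuple X -> R,
    measurable_fun [set: n.-tuple X] tau -> (forall z, 0 <= tau z <= 1) ->
    `|\int[prob_power (Pg (t / Num.sqrt n%:R)) n]_z tau z -
      \int[prob_power (Qt (t / Num.sqrt n%:R)) n]_z tau z| <=
    (t ^+ 2 + 1) * eta].
Proof.
move=> eta01; have /andP[eta0 eta1] := eta01.
have eta2 : 0 < eta ^+ 2 by rewrite exprn_gt0.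
have [h [M [mh hM h0 gh]]] := bounded_centered_approx gL (tangent_mean0 path) eta2.
have hL : L2 P h by exact: bounded_L2 mh hM.
have [Qt QtE] := choice (tilt_exists mh hM h0).
exists h, M, Qt; split => //.
  apply: l2norm_dist => //; first exact: ltW.
  rewrite (le_trans _ (ltW gh))// le_eqVlt; apply/orP; left; apply/eqP.
  by apply: eq_Exp => x; ring.
have := path_tilt_tests path mh hM h0 QtE gh t0 eta01; apply: filterS => n H tau mtau tau01.
apply: (le_trans (H tau mtau tau01)).
by rewrite le_eqVlt; apply/orP; left; apply/eqP; field; rewrite gt_eqF.
Qed.

Let choose_eta (K e : R) : 0 <= K -> 0 < e -> exists2 eta : R, 0 < eta < 1 & K * eta <= e.
Proof.
move=> K0 e0; have K1 : 0 < K + 1 by rewrite ltr_wpDl.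
exists (Num.min 2^-1 (e / (K + 1))).
  by rewrite lt_min invr_gt0 ltr0n divr_gt0//= gt_min; apply/orP; left; lra.
apply: (@le_trans _ _ (K * (e / (K + 1)))).
  by rewrite ler_wpM2l// ge_min lexx orbT.
by rewrite mulrCA ler_piMr ?(ltW e0)// ler_pdivrMr// mul1r lerDl.
Qed.

(** Moving the test from the path to the tilt costs [(t^2 + 1) eta], and replacing [<k, h>] by
    [<k, g>] in the limit costs [peak * t * eta] by Cauchy-Schwarz. Together they take [e / 3], the
    convergence under the tilt another [e / 3]. *)
Lemma path_score_limit (k : X -> R) (a : R) : L2 P k -> \int[P]_x k x = 0 ->
  0 < l2norm P k ->
  \int[prob_power (Pg (t / Num.sqrt n%:R)) n]_z exceedance k a z @[n --> \oo] -->
    Phi ((t * inner P k g - a) / l2norm P k).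
Proof.
move=> kL k0 kpos; apply/cvgrPdist_le => e e0.
have e3 : 0 < e / 3 by rewrite divr_gt0.
have K0 : 0 <= t ^+ 2 + 1 + peak * t by rewrite !addr_ge0 ?sqr_ge0// mulr_ge0// ltW.
have [eta eta01 etae] := choose_eta K0 e3; have /andP[eta0 _] := eta01.
have [h [M [Qt [mh [hM h0] QtE hg near_tests]]]] := tilt_approx eta01.
have hL : L2 P h by exact: bounded_L2 mh hM.
have lim := @tilt_central_limit _ _ _ _ _ _ mh hM h0 _ QtE k t kL k0 kpos a.
have lim_dist : `|Phi ((t * inner P k g - a) / l2norm P k) -
    Phi ((t * inner P k h - a) / l2norm P k)| <= peak * t * eta.
  rewrite distrC; apply: (le_trans (Phi_Lipschitz _ _)); rewrite -mulrA ler_wpM2l//.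
  have -> : (t * inner P k h - a) / l2norm P k - (t * inner P k g - a) / l2norm P k =
    t * (inner P k (fun x => h x - g x) / l2norm P k).
    by rewrite innerBr//; field; rewrite gt_eqF.
  rewrite normrM (gtr0_norm t0) ler_wpM2l ?(ltW t0)//.
  rewrite normrM normfV (gtr0_norm kpos) ler_pdivrMr//.
  rewrite (le_trans (cauchy_schwarz kL (L2B hL gL)))// mulrC.
  by rewrite ler_wpM2r// ltW.
move/cvgrPdist_le : lim => /(_ _ e3) lim.
apply: filterS2 near_tests lim => n near_tests lim.
have := near_tests (@exceedance _ X R k a n) (measurable_exceedance a kL.1)
  (exceedance_bounds k a (n := n)).
move: lim lim_dist etae; rewrite distrC.
move: (\int[_]_z _) (\int[_]_z _) (Phi _) (Phi _) => I1 I2 p1 p2.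
rewrite !ler_norml => /andP[? ?] /andP[? ?] ? /andP[? ?].
by apply/andP; split; lra.
Qed.

(** The Neyman-Pearson comparison is made for the tilt by [h], with critical value [a = ||h|| u],
    for which the exceedance test has limit [Phi (- u)] under [P] and [Phi (- u + t ||h||)] under
    the tilt. *)
Lemma path_power_bound (tau : forall n, n.-tuple X -> R) (u e : R) :
  test_sequence tau -> 0 < l2norm P g -> 0 < e ->
  (forall e' : R, 0 < e' -> \forall n \near \oo,
     \int[prob_power P n]_z tau n z <= Phi (- u) + e') ->
  \forall n \near \oo, \int[prob_power (Pg (t / Num.sqrt n%:R)) n]_z tau n z <=
    Phi (- u + t * l2norm P g) + e.
Proof.
move=> tau_test gpos e0 level.
have e5 : 0 < e / 5 by rewrite divr_gt0.
have K0 : 0 <= t ^+ 2 + 1 + peak * t by rewrite !addr_ge0 ?sqr_ge0// mulr_ge0// ltW.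
(* The additional summand forces [2 eta <= ||g||], so that [h] cannot vanish. *)
have K1 : 0 <= (t ^+ 2 + 1 + peak * t) + 2 * (l2norm P g)^-1 * (e / 5).
  by rewrite addr_ge0// !mulr_ge0 ?invr_ge0 ?(ltW gpos)// ltW.
have [eta eta01 etae] := choose_eta K1 e5; have /andP[eta0 _] := eta01.
have etae1 : (t ^+ 2 + 1 + peak * t) * eta <= e / 5.
  by apply: le_trans etae; rewrite ler_wpM2r ?(ltW eta0)// lerDl
    !mulr_ge0 ?invr_ge0 ?(ltW gpos)// ltW.
have eta_g : eta < l2norm P g.
  have : 2 * (l2norm P g)^-1 * (e / 5) * eta <= e / 5.
    by apply: le_trans etae; rewrite ler_wpM2r ?(ltW eta0)// lerDr.
  rewrite mulrAC -[leRHS]mul1r ler_pM2r// mulrAC ler_pdivrMr// mul1r; lra.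
have [h [M [Qt [mh [hM h0] QtE hg near_tests]]]] := tilt_approx eta01.
have hL : L2 P h by exact: bounded_L2 mh hM.
have hgL := L2B hL gL.
have hle : l2norm P h <= l2norm P g + eta.
  have := l2normD gL hgL; have -> : (fun x => g x + (h x - g x)) = h.
    by apply/funext => x; rewrite addrC subrK.
  by move/le_trans; apply; rewrite lerD2l.
have hpos : 0 < l2norm P h.
  have := l2normD hL (L2Z (-1) hgL).
  have -> : (fun x => h x + -1 * (h x - g x)) = g by apply/funext => x; ring.
  have -> : l2norm P (fun x => -1 * (h x - g x)) = l2norm P (fun x => h x - g x).
    have := @sqr_l2norm _ _ _ P _ (L2Z (-1) hgL).
    under eq_Rintegral do rewrite mulN1r sqrrN.
    rewrite -sqr_l2norm// => /eqP; rewrite eqrXn2 ?l2norm_ge0// => /eqP -> //.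
  by move=> hgle; have := le_trans hgle (lerD (lexx _) hg); lra.
pose a := l2norm P h * u.
have limQ := @tilt_central_limit _ _ _ _ _ _ mh hM h0 _ QtE h t hL h0 hpos a.
have limP := @null_central_limit _ _ _ _ _ hL h0 hpos a.
have aE : - a / l2norm P h = - u by rewrite /a; field; rewrite gt_eqF.
have bE : (t * inner P h h - a) / l2norm P h = - u + t * l2norm P h.
  by rewrite -sqr_l2norm_inner// /a; field; rewrite gt_eqF.
rewrite aE in limP; rewrite bE in limQ.
have Phih : Phi (- u + t * l2norm P h) <= Phi (- u + t * l2norm P g) + peak * t * eta.
  apply: (@le_trans _ _ (Phi (- u + t * l2norm P g + t * eta))).
    by apply: Phi_nondecreasing; rewrite -addrA lerD2l -mulrDr ler_wpM2l// ltW.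
  have := Phi_Lipschitz (- u + t * l2norm P g) (- u + t * l2norm P g + t * eta).
  have -> : - u + t * l2norm P g + t * eta - (- u + t * l2norm P g) = t * eta by ring.
  rewrite (gtr0_norm (mulr_gt0 t0 eta0)) mulrA.
  by move/(le_trans (ler_norm _)); rewrite lerBlDl.
pose E := expR (t * a).
have E0 : 0 < E by exact: expR_gt0.
(* Two errors of this size under [P], one for each test, are multiplied by [K <= E] and then amount
   to [e / 5]. *)
have eE : 0 < e / 5 / E / 2 by rewrite !divr_gt0.
move/cvgrPdist_le : limQ => /(_ _ e5) limQ.
move/cvgrPdist_le : limP => /(_ _ eE) limP.
have lev := level _ eE.
near=> n.
have n_gt0 : (0 < n)%N by near: n; exists 1%N.
have [mtau tau01] := tau_test n.
have [K /andP[K_ge0 KE] np] :=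
  tilt_neyman_pearson mh hM h0 QtE a n_gt0 t0 mtau tau01.
have h1 : `|\int[prob_power (Pg (t / Num.sqrt n%:R)) n]_z tau n z -
      \int[prob_power (Qt (t / Num.sqrt n%:R)) n]_z tau n z| <=
    (t ^+ 2 + 1) * eta.
  have near_n : forall tau : n.-tuple X -> R,
    measurable_fun [set: n.-tuple X] tau -> (forall z, 0 <= tau z <= 1) ->
    `|\int[prob_power (Pg (t / Num.sqrt n%:R)) n]_z tau z -
      \int[prob_power (Qt (t / Num.sqrt n%:R)) n]_z tau z| <=
    (t ^+ 2 + 1) * eta by near: n.
  exact: near_n.
have h2 : `|Phi (- u + t * l2norm P h) -
   \int[prob_power (Qt (t / Num.sqrt n%:R)) n]_z exceedance h a z| <= e / 5 by near: n.
have h3 : `|Phi (- u) - \int[prob_power P n]_z exceedance h a z| <= e / 5 / E / 2.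
  by near: n.
have h4 : \int[prob_power P n]_z tau n z <= Phi (- u) + e / 5 / E / 2 by near: n.
have h5 : K * (\int[prob_power P n]_z tau n z -
    \int[prob_power P n]_z exceedance h a z) <= e / 5.
  have : \int[prob_power P n]_z tau n z -
    \int[prob_power P n]_z exceedance h a z <= e / 5 / E.
    move: h3 h4; rewrite ler_norml => /andP[_ h3] h4.
    have := lerD h3 h4; lra.
  move=> /(ler_wpM2l K_ge0)/le_trans; apply.
  by rewrite mulrCA ler_piMr ?(ltW e5)// ler_pdivrMr// mul1r.
move: h1 h2 h5 np Phih etae1; clear -e0.
move: (\int[_]_z _) (\int[_]_z _) (\int[_]_z _) (K * _) (Phi _) (Phi _) => I1 I2 I3 J p1 p2.
rewrite !ler_norml => /andP[? ?] /andP[? ?] ? ? ? ?.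
lra.
Unshelve. all: by end_near. Qed.

End path_limits.

(** * Projections on tangent cones *)


Section limsup.
Context {R : realType}.
Implicit Types (u : nat -> \bar R) (x : nat -> R) (l e : R).

Lemma limn_esup_le_near u (l : \bar R) :
  (\forall n \near \oo, (u n <= l)%E) -> (limn_esup u <= l)%E.
Proof.
move=> ul; apply: (@le_trans _ _ (ereal_sup (u @` [set n | (u n <= l)%E]))).
  by apply: ereal_inf_lbound; exists [set n | (u n <= l)%E].
by apply: ge_ereal_sup => _ [n /= un <-].
Qed.

Lemma near_le_limn_esup u l e : (limn_esup u <= l%:E)%E -> 0 < e ->
  \forall n \near \oo, (u n <= (l + e)%:E)%E.
Proof.
move=> ul e0; have : (limn_esup u < (l + e)%:E)%E.
  by rewrite (le_lt_trans ul)// lte_fin ltrDl.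
move=> /ereal_inf_lt[_ [A FA <-] Ale]; apply: filterS FA => n An.
by apply: le_trans (ltW Ale); apply: ereal_sup_ubound; exists n.
Qed.

End limsup.

Section local_sequence.
Context d (X : measurableType d) (R : realType) (P : probability X R).
Variables (calP : set (probability X R)) (T : probability X R -> R) (kappa : X -> R).
Hypothesis T_diff : influence_curve calP P T kappa.

(** As the limit exists, the limsup in [hypH] and the liminf in [hypK] are both equal to
    [t <kappa, g>]. *)
Lemma cvg_local_functional (g : X -> R) (Pg : R -> probability X R) (t : R)
    (Q : nat -> probability X R) : path_with_tangent calP P g Pg -> 0 < t ->
  (\forall n \near \oo, Q n = Pg (t / Num.sqrt n%:R)) ->
  (Num.sqrt n%:R * (T (Q n) - T P))%:E @[n --> \oo] --> (t * inner P kappa g)%:E.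
Proof.
move=> path t0 QE; have [_ /(_ _ _ path) Tg] := T_diff.
apply: cvg_EFin; first exact: nearW.
apply/cvgrPdist_le => e e0.
have et0 : 0 < e / t by rewrite divr_gt0.
move/cvgrPdist_le : Tg => /(_ _ et0) Tg.
have {}Tg := cvg_div_sqrt t0 Tg.
near=> n; rewrite /comp/=.
have n0 : 0 < n%:R :> R by rewrite ltr0n; near: n; exists 1%N.
have sn0 : 0 < Num.sqrt n%:R :> R by rewrite sqrtr_gt0.
have -> : Q n = Pg (t / Num.sqrt n%:R) by near: n.
have : `|0 - (T (Pg (t / Num.sqrt n%:R)) - T P - t / Num.sqrt n%:R * inner P kappa g) /
    (t / Num.sqrt n%:R)| <= e / t by near: n; exact: Tg.
rewrite ler_pdivlMr// -[X in _ * X](gtr0_norm t0) -normrM; congr (_ <= _).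
by congr (`| _ |); field; rewrite !gt_eqF.
Unshelve. all: by end_near. Qed.

End local_sequence.

Section cones.
Context d (X : measurableType d) (R : realType) (P : probability X R).
Variables (G : set (X -> R)) (kappa : X -> R).
Hypotheses (GL : forall g, G g -> L2 P g) (kL : L2 P kappa).

Lemma l2closure_L2 f : l2closure P G f -> L2 P f.
Proof. by move=> [/Lfun2P]. Qed.

Lemma sub_l2closure : G `<=` l2closure P G.
Proof.
move=> g Gg; split; first exact/Lfun2P/GL.
move=> e e0; exists g => //; apply: le_lt_trans e0.
apply: l2norm_dist; rewrite ?lexx//; [exact: GL|exact: GL|].
have -> : \int[P]_x ((g x - g x) ^+ 2) = \int[P]_x (0 : R).
  by apply: eq_Exp => x; rewrite subrr expr0n.
by rewrite Exp_cst expr0n.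
Qed.

Lemma l2closure_convex_cone : convex_cone G -> convex_cone (l2closure P G).
Proof.
move=> Gc a b f1 f2 a0 b0 f1C f2C.
have f1L := l2closure_L2 f1C; have f2L := l2closure_L2 f2C.
have fL := L2D (L2Z a f1L) (L2Z b f2L).
split; first exact/Lfun2P.
(* The added 1 keeps the divisor positive when [a] and [b] both vanish. *)
move=> e e0; have ab0 : 0 < a + b + 1 by rewrite ltr_wpDl// addr_ge0.
have eab0 : 0 < e / (a + b + 1) by rewrite divr_gt0.
have [_ /(_ _ eab0)[g1 Gg1 h1]] := f1C.
have [_ /(_ _ eab0)[g2 Gg2 h2]] := f2C.
exists (fun x => a * g1 x + b * g2 x); first exact: Gc.
have d1L := L2B f1L (GL Gg1); have d2L := L2B f2L (GL Gg2).
have normZ c f : 0 <= c -> L2 P f -> l2norm P (fun x => c * f x) <= c * l2norm P f.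
  move=> c0 fL'; rewrite -(@ler_pXn2r _ 2)// ?nnegrE ?mulr_ge0 ?l2norm_ge0//.
  rewrite exprMn !sqr_l2norm//; last exact: L2Z.
  rewrite -(ExpZ _ fL'.2) le_eqVlt; apply/orP; left; apply/eqP.
  by apply: eq_Exp => x; rewrite exprMn.
have -> : ((fun x => a * f1 x + b * f2 x) \- (fun x => a * g1 x + b * g2 x)) =
  (fun x => a * (f1 x - g1 x) + b * (f2 x - g2 x)).
  by apply/funext => x /=; ring.
apply: (le_lt_trans (l2normD (L2Z a d1L) (L2Z b d2L))).
apply: (le_lt_trans (lerD (normZ _ _ a0 d1L) (normZ _ _ b0 d2L))).
have := ler_wpM2l a0 (ltW h1); have := ler_wpM2l b0 (ltW h2).
move=> k2 k1; apply: (le_lt_trans (lerD k1 k2)).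
by rewrite -mulrDl mulrCA gtr_pMr// ltr_pdivrMr// mul1r ltrDl.
Qed.

(** First-order conditions at the closest point: moving to [pk + b w] in the cone, with small
    [b > 0], gives [<kappa - pk, w> <= 0]. For [w = pk] the opposite inequality also holds, since a
    cone allows shrinking to [(1 - b) pk]. *)
Lemma closest_point_variational pk v : convex_cone G ->
  closest_point P (l2closure P G) kappa pk -> l2closure P G v ->
  inner P kappa v <= inner P pk v /\ inner P kappa pk = inner P pk pk.
Proof.
move=> Gc [pkC pkmin] vC; have pkL := l2closure_L2 pkC; have vL := l2closure_L2 vC.
have Cc := l2closure_convex_cone Gc.
have dL := L2B kL pkL.
have key (a b : R) (w : X -> R) : 0 <= a -> 0 <= b -> l2closure P G w ->
    2 * inner P (fun x => kappa x - pk x) (fun x => (a - 1) * pk x + b * w x) <=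
    inner P (fun x => (a - 1) * pk x + b * w x) (fun x => (a - 1) * pk x + b * w x).
  move=> a0 b0 wC; have wL := l2closure_L2 wC.
  have zL := L2D (L2Z (a - 1) pkL) (L2Z b wL).
  set z := (fun x => _) in zL *.
  have := pkmin _ (Cc a b pk w a0 b0 pkC wC).
  have -> : kappa \- (fun x => a * pk x + b * w x) = (fun x => (kappa x - pk x) - z x).
    by apply/funext => x; rewrite /z /=; ring.
  rewrite -(@ler_pXn2r _ 2)// ?nnegrE ?l2norm_ge0//.
  rewrite !sqr_l2norm//; last exact: L2B.
  have -> : \int[P]_x ((kappa x - pk x - z x) ^+ 2) =
    \int[P]_x ((kappa x - pk x) ^+ 2) - 2 * inner P (fun x => kappa x - pk x) z +
    inner P z z.
    have idz := rintegrable_mul dL zL.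
    rewrite innerE -(ExpZ _ idz) -(ExpB dL.2 (rintegrableZ _ idz)).
    rewrite -(ExpD (rintegrableB dL.2 (rintegrableZ _ idz)) zL.2).
    by apply: eq_Exp => x; ring.
  by rewrite -addrA lerDl addrC subr_ge0.
(* Division by [b] and [b] tending to 0; the chosen [b] makes [b c <= e]. *)
have lin_le (q c : R) : (forall b, 0 < b <= 1 -> 2 * (b * q) <= b ^+ 2 * c) -> q <= 0.
  move=> H; apply/ler_addgt0Pr => e e0; rewrite add0r.
  pose b := Num.min 1 (e / (`|c| + 1)).
  have c1 : 0 < `|c| + 1 by rewrite ltr_wpDl.
  have b0 : 0 < b by rewrite lt_min ltr01 divr_gt0.
  have b01 : 0 < b <= 1 by rewrite b0 ge_min lexx.
  have := H b b01; rewrite expr2 -mulrA mulrCA ler_pM2l// => h.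
  have bc : b * c <= e.
    apply: (@le_trans _ _ (b * (`|c| + 1))).
      by rewrite ler_wpM2l ?(ltW b0)// (le_trans (ler_norm _))// lerDl.
    by rewrite -ler_pdivlMr// ge_min lexx orbT.
  lra.
have dv w : l2closure P G w -> inner P (fun x => kappa x - pk x) w <= 0.
  move=> wC; have wL := l2closure_L2 wC.
  apply: (@lin_le _ (inner P w w)) => b /andP[b0 b1].
  have := key 1 b w ler01 (ltW b0) wC.
  have -> : (fun x => (1 - 1) * pk x + b * w x) = (fun x => b * w x).
    by apply/funext => x; ring.
  rewrite !innerZr//; last exact: L2Z.
  by rewrite [inner P (fun x => b * w x) w]innerC innerZr// expr2 -[b * b * _]mulrA.
split; first by have := dv v vC; rewrite innerBl// subr_le0.
apply/eqP; rewrite -subr_eq0 -innerBl// eq_le dv//=.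
rewrite -oppr_le0; apply: (@lin_le _ (inner P pk pk)) => b /andP[b0 b1].
have b1' : 0 <= 1 - b by rewrite subr_ge0.
have := key (1 - b) 0 pk b1' (lexx _) pkC.
have -> : (fun x => (1 - b - 1) * pk x + 0 * pk x) = (fun x => - b * pk x).
  by apply/funext => x; ring.
rewrite !innerZr//; last exact: L2Z.
rewrite [inner P (fun x => - b * pk x) pk]innerC innerZr//.
by rewrite mulrN mulNr !mulrA mulrNN expr2.
Qed.

End cones.


(** * Asymptotic power of arbitrary tests and of the score test *)

Section asymptotic_power.
Context d (X : measurableType d) (R : realType) (P : probability X R).
Variables (calP : set (probability X R)) (T : probability X R -> R).
Variables (kappa pk : X -> R) (alpha u c : R).
Local Notation G := (tangent_set calP P).
Hypotheses (T_diff : influence_curve calP P T kappa) (u_def : Phi (- u) = alpha)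
  (c0 : 0 < c) (pkC : l2closure P G pk) (pk0 : l2norm P pk != 0)
  (pk_ge : forall g, G g -> inner P kappa g <= inner P pk g)
  (pk_eq : inner P kappa pk = inner P pk pk).

Local Notation nu := (l2norm P pk).

Let nu0 : 0 < nu. Proof. by rewrite lt_def pk0 l2norm_ge0. Qed.

Lemma tangent_L2 g : G g -> L2 P g.
Proof. by move=> [Pg [/Lfun2P]]. Qed.

Let kL : L2 P kappa. Proof. by case: T_diff => /Lfun2P. Qed.

Let pkL : L2 P pk. Proof. exact: l2closure_L2 pkC. Qed.

(** The mean is the inner product with 1; it vanishes on tangents and is continuous, hence vanishes
    on their closure. *)
Let pk_mean0 : \int[P]_x pk x = 0.
Proof.
apply/eqP; rewrite -normr_le0; apply/ler_addgt0Pr => e e0; rewrite add0r.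
have [_ /(_ _ e0)[g Gg ge]] := pkC.
have gL := tangent_L2 Gg; have dL := L2B pkL gL.
have oneL : L2 P (fun=> 1) by split => //; exact: rintegrable_cst.
have [Pg path] := Gg.
have -> : \int[P]_x pk x = inner P (fun=> 1) (fun x => pk x - g x).
  rewrite /inner; under [RHS]eq_Rintegral do rewrite mul1r.
  by rewrite (ExpB (L2_rintegrable pkL) (L2_rintegrable gL)) (tangent_mean0 path) subr0.
apply: (le_trans (cauchy_schwarz oneL dL)).
have -> : l2norm P (fun=> 1) = 1.
  apply/eqP; rewrite -(@eqrXn2 _ 2)// ?l2norm_ge0// sqr_l2norm// expr1n.
  rewrite (@eq_Exp _ _ _ P _ (fun=> 1)) ?Exp_cst// => x; exact: expr1n.
by rewrite mul1r; exact: ltW.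
Qed.

Lemma power_EFin (tau : forall n, n.-tuple X -> R) (Q : nat -> probability X R) n :
  test_sequence tau -> power tau Q n = (\int[prob_power (Q n) n]_z tau n z)%:E.
Proof.
move=> tau_test; have [mtau tau01] := tau_test n.
rewrite /power /Rintegral fineK//; apply: integrable_fin_num => //.
apply: (@rintegrable_bounded _ _ _ (prob_power (Q n) n) _ 1) => // z.
by have /andP[? ?] := tau01 z; rewrite ger0_norm.
Qed.

Lemma score_test_sequence : test_sequence (@score_test _ X R P pk u).
Proof.
move=> n; split; first exact: (measurable_exceedance (l2norm P pk * u) pkL.1).
exact: (exceedance_bounds pk (l2norm P pk * u)).
Qed.

Lemma cvg_score_power (g : X -> R) (Pg : R -> probability X R) (t : R)
    (Q : nat -> probability X R) : path_with_tangent calP P g Pg -> 0 < t ->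
  (\forall n \near \oo, Q n = Pg (t / Num.sqrt n%:R)) ->
  power (@score_test _ X R P pk u) Q n @[n --> \oo] -->
    (Phi (- u + t * inner P pk g / nu))%:E.
Proof.
move=> path t0 QE.
have lim := @path_score_limit _ _ _ _ _ _ _ path t t0 pk (nu * u) pkL pk_mean0 nu0.
have e : (t * inner P pk g - nu * u) / nu = - u + t * inner P pk g / nu.
  by field; rewrite gt_eqF.
rewrite e in lim.
apply: (@cvg_trans _ ((\int[prob_power (Pg (t / Num.sqrt n%:R)) n]_z
    exceedance pk (nu * u) z)%:E @[n --> \oo])).
  apply: near_eq_cvg; apply: filterS QE => n Qn.
  by rewrite (power_EFin _ _ score_test_sequence) Qn.
by apply: cvg_EFin; [exact: nearW|exact: lim].
Qed.

Lemma score_level : (limn_esup (power (@score_test _ X R P pk u) (fun=> P)) <= alpha%:E)%E.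
Proof.
have lim := @null_central_limit _ _ _ P pk pkL pk_mean0 nu0 (nu * u).
have e : - (nu * u) / nu = - u by field; rewrite gt_eqF.
rewrite e u_def in lim.
have clim : power (@score_test _ X R P pk u) (fun=> P) n @[n --> \oo] --> alpha%:E.
  apply: (@cvg_trans _ ((\int[prob_power P n]_z exceedance pk (nu * u) z)%:E @[n --> \oo])).
    apply: near_eq_cvg; apply: nearW => n.
    by rewrite (power_EFin _ _ score_test_sequence).
  by apply: cvg_EFin; [exact: nearW|exact: lim].
by have [_ ->] := cvg_limn_einf_sup clim.
Qed.

(** One sequence in a nearly least favourable direction bounds the infimum: a tangent [g] close to
    [pk], at the smallest [t] that [hypK] admits. *)
Lemma inf_power_le (tau : forall n, n.-tuple X -> R) : test_sequence tau ->
  (limn_esup (power tau (fun=> P)) <= alpha%:E)%E ->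
  (ereal_inf [set limn_esup (power tau Q) | Q in hypK calP P T c]
    <= (Phi (- u + c / nu))%:E)%E.
Proof.
move=> tau_test level; apply/lee_addgt0Pr => e e0; rewrite -EFinD.
have e2 : 0 < e / 2 by rewrite divr_gt0.
(* A tangent within [del] of [pk] has [||g|| <= nu + del] and, by [pk_eq],
   [<kappa, g> >= nu^2 - ||kappa|| del]; [F] inserts both into the bound with [t = c / <kappa, g>].
   At [del = 0] the shift is [c nu / nu^2 = c / nu]. *)
pose F del := Phi (- u + c * (nu + del) / (nu ^+ 2 - l2norm P kappa * del)).
have nu2 : 0 < nu ^+ 2 by rewrite exprn_gt0.
have cF : F del @[del --> (0 : R)^'+] --> Phi (- u + c / nu).
  apply: cvg_at_right_filter.
  have -> : c / nu = c * (nu + 0) / (nu ^+ 2 - l2norm P kappa * 0).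
    by field; rewrite gt_eqF//= mulr0 subr0 gt_eqF.
  apply: (cvg_comp _ (@Phi R)); last exact: continuous_Phi.
  apply: cvgD; first exact: cvg_cst.
  apply: cvgM.
    by apply: cvgMr; apply: cvgD; [exact: cvg_cst|exact: cvg_id].
  apply: cvgV; first by rewrite mulr0 subr0 gt_eqF.
  by apply: cvgB; [exact: cvg_cst|apply: cvgMr; exact: cvg_id].
move/cvgrPdist_le : cF => /(_ _ e2) cF.
have [del [del0 delnu delk Fdel]] : exists del : R, [/\ 0 < del, del < nu,
    l2norm P kappa * del < nu ^+ 2 & F del <= Phi (- u + c / nu) + e / 2].
  have k1 : 0 < l2norm P kappa + 1 by rewrite ltr_wpDl// l2norm_ge0.
  near (0 : R)^'+ => del.
  have del0 : 0 < del by near: del; exact: nbhs_right_gt.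
  exists del; split => //.
  - apply: (@lt_trans _ _ ((l2norm P kappa + 1) * del)).
      by rewrite ltr_pM2r// ltrDl.
    rewrite mulrC -ltr_pdivlMr//; near: del; apply: nbhs_right_lt.
    by rewrite divr_gt0.
  - have : `|Phi (- u + c / nu) - F del| <= e / 2 by near: del.
    by rewrite distrC => /(le_trans (ler_norm _)); rewrite lerBlDl.
have [_ /(_ _ del0)[g Gg gdel]] := pkC.
have gL := tangent_L2 Gg; have [Pg path] := Gg.
have dL := L2B pkL gL.
have kg : nu ^+ 2 - l2norm P kappa * del <= inner P kappa g.
  have h : inner P kappa (fun x => pk x - g x) <= l2norm P kappa * del.
    apply: (le_trans (ler_norm _)); apply: (le_trans (cauchy_schwarz kL dL)).
    by rewrite ler_wpM2l ?l2norm_ge0// ltW.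
  move: h; rewrite innerBr// pk_eq -sqr_l2norm_inner//; lra.
have kgpos : 0 < inner P kappa g by apply: lt_le_trans kg; rewrite subr_gt0.
have gle : l2norm P g <= nu + del.
  have := l2normD pkL (L2Z (-1) dL).
  have -> : (fun x => pk x + -1 * (pk x - g x)) = g by apply/funext => x; ring.
  have -> : l2norm P (fun x => -1 * (pk x - g x)) = l2norm P (fun x => pk x - g x).
    have := @sqr_l2norm _ _ _ P _ (L2Z (-1) dL).
    under eq_Rintegral do rewrite mulN1r sqrrN.
    rewrite -sqr_l2norm// => /eqP; rewrite eqrXn2 ?l2norm_ge0// => /eqP -> //.
  by move/le_trans; apply; rewrite lerD2l ltW.
have gpos : 0 < l2norm P g.
  rewrite lt_def l2norm_ge0 andbT; apply/eqP => g0.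
  have := le_trans (ler_norm _) (cauchy_schwarz kL gL).
  by rewrite g0 mulr0 leNgt kgpos.
(* With this [t] the scaled increments of [T] tend to exactly [c]. *)
pose t := c / inner P kappa g.
have t0 : 0 < t by rewrite divr_gt0.
pose Q n := Pg (t / Num.sqrt n%:R).
have QE : \forall n \near \oo, Q n = Pg (t / Num.sqrt n%:R) by exact: nearW.
have QK : hypK calP P T c Q.
  split; first by exists g, Pg, t.
  have := cvg_local_functional T_diff path t0 QE.
  move=> /cvg_limn_einf_sup[+ _]; rewrite /= => ->.
  by rewrite /t divfK// gt_eqF.
apply: (@le_trans _ _ (limn_esup (power tau Q))).
  by apply: ereal_inf_lbound; exists Q.
apply: limn_esup_le_near.
have lev (e' : R) : 0 < e' -> \forall n \near \oo,
    \int[prob_power P n]_z tau n z <= Phi (- u) + e'.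
  move=> e'0; have := near_le_limn_esup level e'0; apply: filterS => n.
  by rewrite power_EFin// lee_fin u_def.
have := @path_power_bound _ _ _ _ _ _ _ path t t0 tau u (e / 2) tau_test gpos e2 lev.
apply: filterS => n; rewrite power_EFin// lee_fin => /le_trans; apply.
have : Phi (- u + t * l2norm P g) <= F del.
  apply: Phi_nondecreasing; rewrite lerD2l /t -mulrA -[leRHS]mulrA ler_pM2l//.
  rewrite mulrC ler_pM ?invr_ge0 ?l2norm_ge0 ?(ltW kgpos)//.
  by rewrite lef_pV2 ?posrE// subr_gt0.
by move: Fdel; move: (F del) (Phi _) (Phi _) => *; lra.
Unshelve. all: by end_near. Qed.

(** The upper half is [inf_power_le] for the score test itself, as the liminf is at most the limsup.
    For the lower half the limit of the power is explicit, and [c <= t <kappa, g> <= t <pk, g>]. *)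
Lemma inf_score_power :
  ereal_inf [set limn_einf (power (@score_test _ X R P pk u) Q) | Q in hypK calP P T c]
  = (Phi (- u + c / nu))%:E.
Proof.
apply/eqP; rewrite eq_le; apply/andP; split.
  apply: le_trans (inf_power_le score_test_sequence score_level).
  apply: le_ereal_inf_tmp => _ [Q QK <-].
  apply: le_trans (limn_einf_sup _).
  by apply: ereal_inf_lbound; exists Q.
apply: le_ereal_inf_tmp => _ [Q [[g [Pg [t [Gg path t0 QE]]]] QK] <-].
have [-> _] := cvg_limn_einf_sup (cvg_score_power path t0 QE).
have := cvg_local_functional T_diff path t0 QE.
move=> /cvg_limn_einf_sup[+ _]; move: QK; rewrite /= => + e; rewrite e lee_fin => ckg.
rewrite lee_fin; apply: Phi_nondecreasing; rewrite lerD2l ler_pM2r ?invr_gt0//.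
by apply: (le_trans ckg); rewrite ler_pM2l//; exact: pk_ge.
Qed.

(** A sequence in [hypH] controls the sign of [<kappa, g>], whereas the limiting power depends on
    [<pk, g>]. The inequality assumed here transfers the sign; it holds for an orthogonal
    projection, but on a mere cone [<pk, g>] may exceed [<kappa, g>]. *)
Lemma sup_score_level : (forall g, G g -> inner P pk g <= inner P kappa g) ->
  (ereal_sup [set limn_esup (power (@score_test _ X R P pk u) Q) | Q in hypH calP P T]
    <= alpha%:E)%E.
Proof.
move=> pk_le; apply: ge_ereal_sup => _ [Q [[g [Pg [t [Gg path t0 QE]]]] QH] <-].
have [_ ->] := cvg_limn_einf_sup (cvg_score_power path t0 QE).
have := cvg_local_functional T_diff path t0 QE.
move=> /cvg_limn_einf_sup[_]; move: QH; rewrite /= => + e; rewrite e lee_fin => kg.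
rewrite lee_fin -u_def; apply: Phi_nondecreasing; rewrite gerDl.
rewrite pmulr_lle0 ?invr_gt0//; apply: le_trans kg.
by rewrite ler_pM2l//; exact: pk_le.
Qed.

End asymptotic_power.

Unset Implicit Arguments.
Set Strict Implicit.

Theorem theorem2p1 (d : measure_display) (X : measurableType d) (R : realType)
  (calP : set (probability X R)) (P : probability X R) (calP_P : calP P)
  (T : probability X R -> R)
  (kappa : X -> R) (T_diff : influence_curve calP P T kappa)
  (alpha : R) (alpha_in : 0 < alpha < 1)
  (u : R) (u_def : Phi (- u) = alpha)
  (c : R) (c_gt0 : 0 < c)
  (tau : forall n : nat, n.-tuple X -> R)
  (tau_test : test_sequence tau)
  (tau_level : (limn_esup (power tau (fun=> P)) <= alpha%:E)%E) :
  (convex_cone (tangent_set calP P) ->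
   forall tkappa : X -> R,
     closest_point P (l2closure P (tangent_set calP P)) kappa tkappa ->
     l2norm P tkappa != 0 ->
     [/\ (ereal_inf [set limn_esup (power tau Q) | Q in hypK calP P T c]
            <= (Phi (- u + c / l2norm P tkappa))%:E)%E,
         test_sequence (score_test P tkappa u),
         (limn_esup (power (score_test P tkappa u) (fun=> P)) <= alpha%:E)%E &
         ereal_inf [set limn_einf (power (score_test P tkappa u) Q)
                   | Q in hypK calP P T c]
           = (Phi (- u + c / l2norm P tkappa))%:E])
  /\
  (linear_space (tangent_set calP P) ->
   forall bkappa : X -> R,
     orthogonal_projection P (l2closure P (tangent_set calP P)) kappa bkappa ->
     l2norm P bkappa != 0 ->
     [/\ (ereal_inf [set limn_esup (power tau Q) | Q in hypK calP P T c]
            <= (Phi (- u + c / l2norm P bkappa))%:E)%E,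
         test_sequence (score_test P bkappa u),
         (limn_esup (power (score_test P bkappa u) (fun=> P)) <= alpha%:E)%E,
         ereal_inf [set limn_einf (power (score_test P bkappa u) Q)
                   | Q in hypK calP P T c]
           = (Phi (- u + c / l2norm P bkappa))%:E &
         (ereal_sup [set limn_esup (power (score_test P bkappa u) Q)
                    | Q in hypH calP P T] <= alpha%:E)%E]).
Proof.
have kL : L2 P kappa by case: T_diff => /Lfun2P.
have GL g : tangent_set calP P g -> L2 P g by exact: tangent_L2.
split=> [Gc tk tk_closest tk0|Gl bk [bkC bk_orth] bk0].
- have tkC := tk_closest.1.
  have tk_ge g (Gg : tangent_set calP P g) : inner P kappa g <= inner P tk g.
    by have [] := closest_point_variational GL kL Gc tk_closest (sub_l2closure GL Gg).
  have [_ tk_eq] := closest_point_variational GL kL Gc tk_closest tkC.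
  split.
  + exact: (inf_power_le T_diff u_def c_gt0 tkC tk0 tk_eq tau_test tau_level).
  + exact: score_test_sequence tkC.
  + exact: score_level u_def tkC tk0.
  + exact: (inf_score_power T_diff u_def c_gt0 tkC tk0 tk_ge tk_eq).
- have bkL := l2closure_L2 bkC.
  have bk_inner g (Cg : l2closure P (tangent_set calP P) g) :
      inner P kappa g = inner P bk g.
    have := bk_orth g Cg; rewrite innerBl//; last exact: l2closure_L2 Cg.
    by move/eqP; rewrite subr_eq0 => /eqP.
  have bk_eq := bk_inner _ bkC.
  have bk_tangent g (Gg : tangent_set calP P g) := bk_inner g (sub_l2closure GL Gg).
  have bk_ge g (Gg : tangent_set calP P g) : inner P kappa g <= inner P bk g.
    by rewrite bk_tangent.
  split.
  + exact: (inf_power_le T_diff u_def c_gt0 bkC bk0 bk_eq tau_test tau_level).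
  + exact: score_test_sequence bkC.
  + exact: score_level u_def bkC bk0.
  + exact: (inf_score_power T_diff u_def c_gt0 bkC bk0 bk_ge bk_eq).
  + apply: (sup_score_level T_diff u_def bkC bk0) => g Gg.
    by rewrite bk_tangent.
Qed.
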